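(* Let $(R,\mathfrak m)$ be a regular local ring with quotient field $F$ and $\dim R\ge 2$, let $\{(R_i,\mathfrak m_i)\}_{i\ge 0}$ be an infinite sequence of local quadratic transforms with $R_0=R$, let $S=\bigcup_{i\ge0}R_i$ with maximal ideal $N=\bigcup_i\mathfrak m_i$, let $x\in S$ be such that $xS$ is $N$-primary, let $T$ be the Noetherian hull of $S$ and assume $T$ is a localization of $R$, and let $S^*$ be the complete integral closure of $S$. The following are equivalent: (1) $S$ is not archimedean; (2) $T$ is a fractional ideal of $S$; (3) $S^*=T$; (4) the boundary valuation ring of $S$ has a nonzero nonmaximal prime ideal that does not lie over $N$; (5) the ideal $\bigcap_{i>0}x^iS$ is a nonzero prime ideal of $S$; (6) there exists $0\ne y\in R$ such that for each $n>0$, $\mathrm{ord}_i(y)\ge n\cdot\mathrm{ord}_i(x)$ for all $i\gg 0$.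
   Context: A local quadratic transform of a regular local ring $(A,\mathfrak n)$ is a local ring $A[\mathfrak n/z]_{\mathfrak q}$ with $z\in\mathfrak n\setminus\mathfrak n^2$ and $\mathfrak q$ a prime ideal of $A[\mathfrak n/z]$ containing $\mathfrak n$. The sequence satisfies: for each $i\ge 0$, $R_{i+1}$ is a local quadratic transform of $R_i$, $R_i\subsetneq R_{i+1}$, and each $R_i$ is a regular local ring of dimension at least $2$ with maximal ideal $\mathfrak m_i$. $\mathrm{ord}_i$ is the order valuation of $R_i$ ($\mathrm{ord}_i(a)=\max\{n:a\in\mathfrak m_i^n\}$ for $0\ne a\in R_i$, extended to $F$ by $\mathrm{ord}_i(a/b)=\mathrm{ord}_i(a)-\mathrm{ord}_i(b)$), with valuation ring $V_i$. The boundary valuation ring of $S$ is the unique valuation ring $V$ with $R\subseteq V\subseteq F$ that is a limit point of $\{V_i\}$ in the patch topology (basic open sets $\{U: G\subseteq U, H\subseteq\mathfrak M_U\}$, $G,H\subseteq F$ finite); equivalently $V=\{q\in F:\mathrm{ord}_i(q)\ge 0\text{ for } i\gg0\}$. The Noetherian hull $T$ of $S$ is the intersection of all DVRs with quotient field $F$ properly containing $S$ (empty intersection $=F$). A domain $A$ is archimedean if $\bigcap_{n>0}a^nA=0$ for every nonunit $a\in A$. The complete integral closure of $S$ is the ring of $\theta\in F$ such that $S[\theta]$ is a fractional ideal of $S$. An ideal is $N$-primary if its radical is $N$. *)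

(* Defs.v *)
(* All rings are subrings of a fixed field F (the quotient
   field); subsets of F are predicates F -> Prop. *)
From mathcomp Require Import all_boot all_order all_algebra.
Set Implicit Arguments. Unset Strict Implicit. Unset Printing Implicit Defensive.
Import Order.TTheory GRing.Theory Num.Theory.
Local Open Scope ring_scope.

Section Defs.
Variable F : fieldType.
Implicit Types (A B I P m n : F -> Prop) (q x y z : F).

Definition subset_of A B := forall q, A q -> B q.
Definition proper_subset A B := subset_of A B /\ exists q, B q /\ ~ A q.
Definition set_eq A B := forall q, A q <-> B q.

Definition subring A :=
  [/\ A 0, A 1, (forall x y, A x -> A y -> A (x - y)) &
      (forall x y, A x -> A y -> A (x * y))].

Definition is_ideal A I :=
  [/\ subset_of I A, I 0, (forall x y, I x -> I y -> I (x + y)) &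
      (forall a x, A a -> I x -> I (a * x))].

Definition is_prime A P :=
  [/\ is_ideal A P, ~ P 1 & forall x y, A x -> A y -> P (x * y) -> P x \/ P y].

Definition unit_in A x := A x /\ exists y, A y /\ x * y = 1.

Definition is_local A m :=
  subring A /\ is_ideal A m /\ ~ m 1 /\ forall x, m x <-> (A x /\ ~ unit_in A x).

Definition frac_field A := forall q, exists a b, [/\ A a, A b, b != 0 & q = a / b].

Definition gen_ideal A (s : seq F) x :=
  exists c : 'I_(size s) -> F, (forall i, A (c i)) /\ x = \sum_(i < size s) c i * s`_i.

Definition all_in A (s : seq F) := forall i, (i < size s)%N -> A s`_i.

Definition noetherian A :=
  forall I, is_ideal A I -> exists s : seq F, all_in A s /\ set_eq I (gen_ideal A s).

Definition prime_chain A (P : nat -> F -> Prop) (d : nat) :=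
  (forall i, (i <= d)%N -> is_prime A (P i)) /\
  (forall i, (i < d)%N -> proper_subset (P i) (P i.+1)).

Definition krull_dim A (d : nat) :=
  (exists P : nat -> F -> Prop, prime_chain A P d) /\ ~ (exists P : nat -> F -> Prop, prime_chain A P d.+1).

Definition regular_local A m (d : nat) :=
  [/\ noetherian A, is_local A m, krull_dim A d &
      exists s : seq F, [/\ size s = d, all_in A s & set_eq m (gen_ideal A s)]].

Fixpoint idpow A I (n : nat) : F -> Prop :=
  match n with
  | 0 => A
  | n'.+1 => fun x => exists k (u v : 'I_k -> F),
      (forall j, idpow A I n' (u j) /\ I (v j)) /\ x = \sum_(j < k) u j * v j
  end.

Definition gen_ring G q := forall B, subring B -> subset_of G B -> B q.

Definition blowup_ring A n z :=
  gen_ring (fun q => A q \/ exists y, n y /\ q = y / z).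

Definition localize_at C Q q := exists a b, [/\ C a, C b, ~ Q b & q = a / b].

Definition local_quadratic_transform A n B :=
  exists z, n z /\ ~ idpow A n 2 z /\
  exists Q, is_prime (blowup_ring A n z) Q /\ subset_of n Q /\
    set_eq B (localize_at (blowup_ring A n z) Q).

Definition has_ord A m (a : F) (e : nat) :=
  [/\ A a, a != 0, idpow A m e a & ~ idpow A m e.+1 a].

Definition ordF A m (q : F) (v : int) :=
  exists a b ea eb, [/\ has_ord A m a ea, has_ord A m b eb, q = a / b &
                        v = (ea%:Z - eb%:Z)].

(* membership in the order valuation ring: ord(q) >= 0 (with ord 0 = oo) *)
Definition ord_nonneg A m q := q = 0 \/ exists v, ordF A m q v /\ 0 <= v.

Definition is_DVR V :=
  subring V /\ exists v : F -> int,
   [/\ (forall a b, a != 0 -> b != 0 -> v (a * b) = v a + v b),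
       (forall a b, a != 0 -> b != 0 -> a + b != 0 -> Num.min (v a) (v b) <= v (a + b)),
       (forall k : int, exists a, a != 0 /\ v a = k) &
       (forall q, V q <-> (q = 0 \/ (q != 0 /\ 0 <= v q)))].

Definition noetherian_hull S q := forall V, is_DVR V -> proper_subset S V -> V q.

Definition is_localization_of A C :=
  exists M : F -> Prop, [/\ subset_of M A, M 1, ~ M 0,
    (forall x y, M x -> M y -> M (x * y)) &
    set_eq C (fun q => exists a s, [/\ A a, M s & q = a / s])].

Definition fractional_ideal S I :=
  [/\ I 0, (forall x y, I x -> I y -> I (x + y)),
      (forall a x, S a -> I x -> I (a * x)) &
      exists d, [/\ S d, d != 0 & forall x, I x -> S (d * x)]].

Definition adjoin S (theta : F) q :=
  exists k (c : 'I_k -> F), (forall j, S (c j)) /\ q = \sum_(j < k) c j * theta ^+ j.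

Definition complete_int_closure S theta := fractional_ideal S (adjoin S theta).

Definition principal S a q := exists s, S s /\ q = a * s.

Definition archimedean S :=
  forall a, S a -> ~ unit_in S a ->
    forall q, (forall n : nat, (0 < n)%N -> principal S (a ^+ n) q) -> q = 0.

Definition primary_to S N I :=
  forall q, (S q /\ exists n : nat, I (q ^+ n)) <-> N q.

Definition nonunits A q := A q /\ ~ unit_in A q.

Definition union_seq (R : nat -> F -> Prop) q := exists i, R i q.

Definition boundary_val_ring (R m : nat -> F -> Prop) q :=
  exists i0, forall i, (i0 <= i)%N -> ord_nonneg (R i) (m i) q.

Definition power_intersection S x q :=
  forall n : nat, (0 < n)%N -> principal S (x ^+ n) q.

End Defs.

(* Main.v *)
(** The three facts about a regular local ring that matter are obtained from one construction.
    If [m] is generated by [d = dim] elements, then Krull's principal ideal theorem forces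
    the ideals generated by initial segments of the generators to be prime, and Krull's
    intersection theorem then gives that the associated graded ring is a polynomial ring. Hence
    the order function is a valuation, and the ring is completely integrally closed (lift from
    the quotient by a parameter [x], successively modulo [x^n]).

    Under a quadratic transform along [z], the order cannot increase: if [a] has order [r], its
    initial form translated to the point [x / z] over the residue field of the transform is a
    nonzero polynomial of degree at most [r], so [a / z^r] has order at most [r] there. It
    follows that for every [q] in [F] the sign of [ord_i q] is eventually constant, so the
    boundary ring [V] is a valuation ring.

    The ring [S[1/x]] is a localization of some [R_i], hence Noetherian and normal, hence an
    intersection of discrete valuation rings, while a discrete valuation ring properly
    containing [S] cannot dominate [S] and so contains [1/x]; thus [T = S[1/x]]. Since the strict
    transforms of [x^k] eventually become units, [S] is the intersection of [V] and [T]. All six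
    conditions then express that the intersection of the ideals [x^n S] is nonzero. *)

(* All rings are subsets of one field, so residue rings, graded rings and residue fields have no
   carrier. A statement about $A/P$ is therefore made in $A$ as a congruence modulo [addI P J], and
   a polynomial over a residue field is a polynomial over [F] with coefficients in the ring, read
   modulo the maximal ideal. This is why the inductions on parameters carry a prime [P] and why
   Krull's intersection theorem is proved relative to an ideal.

   The step that needs most care is that strict transforms become units. As $xS$ is $N$-primary, $x$
   divides a power of $z_i$ in $S$, so the strict transform $X_j$ of $x^k$ is invertible once
   $z_i,\dots,z_{j-1}$ are inverted in $R_j$. These are given up one at a time: $X_{k+1}$ has order
   0 for $\mathrm{ord}_k$, while $z_k$ divides every element of $R_{k+1}$ of positive order, so
   $z_k$ cannot contribute to the inverse of $X_j$.

   Primality in (4) and (5) has one source: $\mathrm{ord}_i(a)\le n\,\mathrm{ord}_i(x)$ and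
   $\mathrm{ord}_i(b)\le k\,\mathrm{ord}_i(x)$ for large $i$ exclude
   $\mathrm{ord}_i(ab)\ge(n+k+1)\,\mathrm{ord}_i(x)$. *)
Require Import Defs.
From Stdlib Require Import Classical ClassicalEpsilon FunctionalExtensionality PropExtensionality.
From mathcomp Require Import all_boot all_order all_algebra.
From mathcomp Require Import mpoly zify ring.
Set Implicit Arguments. Unset Strict Implicit. Unset Printing Implicit Defensive.
Import Order.TTheory GRing.Theory Num.Theory.
Local Open Scope ring_scope.

(** * Ideals of subrings of a field *)

Section Basics.
Variable F : fieldType.
Implicit Types (A B I J K P Q : F -> Prop) (a b c q x y z : F).

Lemma set_ext A B : set_eq A B -> A = B.
Proof.
move=> h; apply: functional_extensionality => q.
exact: propositional_extensionality.
Qed.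

Lemma sr0 A : subring A -> A 0. Proof. by case. Qed.
Lemma sr1 A : subring A -> A 1. Proof. by case. Qed.
Lemma srB A : subring A -> forall x y, A x -> A y -> A (x - y). Proof. by case. Qed.
Lemma srM A : subring A -> forall x y, A x -> A y -> A (x * y). Proof. by case. Qed.
Lemma srN A : subring A -> forall x, A x -> A (- x).
Proof. by move=> h x hx; rewrite -sub0r; apply: (srB h) => //; apply: sr0. Qed.
Lemma srD A : subring A -> forall x y, A x -> A y -> A (x + y).
Proof. by move=> h x y hx hy; rewrite -[y]opprK; apply: (srB h) => //; apply: (srN h). Qed.
Lemma srX A : subring A -> forall x n, A x -> A (x ^+ n).
Proof.
move=> h x n hx; elim: n => [|n IH]; first by rewrite expr0; apply: sr1.
by rewrite exprS; apply: (srM h).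
Qed.
Lemma sr_sum A (T : Type) (r : seq T) (C : pred T) (f : T -> F) :
  subring A -> (forall i, C i -> A (f i)) -> A (\sum_(i <- r | C i) f i).
Proof.
move=> h hf; apply: (big_ind A) => //; first exact: sr0.
exact: srD.
Qed.
Lemma sr_nat A n : subring A -> A n%:R.
Proof.
move=> h; elim: n => [|n IH]; first exact: sr0.
by rewrite -addn1 natrD; apply: (srD h) => //; apply: sr1.
Qed.

Lemma idS A I : is_ideal A I -> forall x, I x -> A x. Proof. by case. Qed.
Lemma id0 A I : is_ideal A I -> I 0. Proof. by case. Qed.
Lemma idD A I : is_ideal A I -> forall x y, I x -> I y -> I (x + y). Proof. by case. Qed.
Lemma idM A I : is_ideal A I -> forall a x, A a -> I x -> I (a * x). Proof. by case. Qed.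
Lemma idMr A I : is_ideal A I -> forall a x, I x -> A a -> I (x * a).
Proof. by move=> h a x hx ha; rewrite mulrC; apply: (idM h). Qed.
Lemma idN A I : subring A -> is_ideal A I -> forall x, I x -> I (- x).
Proof.
move=> hA h x hx; rewrite -mulN1r; apply: (idM h) => //.
by apply: (srN hA); apply: sr1.
Qed.
Lemma idB A I : subring A -> is_ideal A I -> forall x y, I x -> I y -> I (x - y).
Proof. by move=> hA h x y hx hy; apply: (idD h) => //; apply: (idN hA h). Qed.
Lemma id_sum A I (T : Type) (r : seq T) (C : pred T) (f : T -> F) :
  is_ideal A I -> (forall i, C i -> I (f i)) -> I (\sum_(i <- r | C i) f i).
Proof.
move=> h hf; apply: (big_ind I) => //; first exact: (id0 h).
exact: (idD h).
Qed.
Lemma idXS A I : is_ideal A I -> subring A -> forall x n, I x -> I (x ^+ n.+1).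
Proof. by move=> h hA x n hx; rewrite exprS; apply: (idMr h) => //; apply: (srX hA); apply: (idS h). Qed.

Lemma prI A P : is_prime A P -> is_ideal A P. Proof. by case. Qed.
Lemma pr1 A P : is_prime A P -> ~ P 1. Proof. by case. Qed.
Lemma prM A P : is_prime A P -> forall x y, A x -> A y -> P (x * y) -> P x \/ P y.
Proof. by case. Qed.
Lemma prX A P : subring A -> is_prime A P -> forall x n, A x -> P (x ^+ n) -> P x.
Proof.
move=> hA hP x n hx; elim: n => [|n IH]; first by rewrite expr0 => /(pr1 hP).
by rewrite exprS => /(prM hP hx) [] //; apply: srX.
Qed.

Lemma loc_sr A m : is_local A m -> subring A. Proof. by case. Qed.
Lemma loc_id A m : is_local A m -> is_ideal A m. Proof. by case=> _ []. Qed.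
Lemma loc_1 A m : is_local A m -> ~ m 1. Proof. by case=> _ [_ []]. Qed.
Lemma loc_nonunit A m : is_local A m -> forall x, m x <-> (A x /\ ~ unit_in A x).
Proof. by case=> _ [_ []]. Qed.
Lemma loc_unit A m : is_local A m -> forall x, A x -> ~ m x -> exists y, A y /\ x * y = 1.
Proof.
move=> h x hx hm; apply: NNPP => hu; apply: hm; apply/(loc_nonunit h); split=> //.
by case=> _.
Qed.
Lemma loc_prime A m : is_local A m -> is_prime A m.
Proof.
move=> h; split; [exact: loc_id h|exact: loc_1 h|move=> x y hx hy hxy].
apply: NNPP => /not_or_and [/(loc_unit h hx) [x' [hx' ex]] /(loc_unit h hy) [y' [hy' ey]]].
apply: (loc_1 h).
have -> : 1 = (x' * y') * (x * y) by rewrite mulrACA [x' * x]mulrC ex [y' * y]mulrC ey mulr1.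
by apply: (idM (loc_id h)) => //; apply: (srM (loc_sr h)).
Qed.
Lemma loc_proper A m I : is_local A m -> is_ideal A I -> ~ I 1 -> subset_of I m.
Proof.
move=> h hI h1 q hq; apply/(loc_nonunit h); split; first exact: (idS hI).
by case=> _ [y [hy e]]; apply: h1; rewrite -e; apply: (idMr hI).
Qed.

Definition addI I J q := exists a b, [/\ I a, J b & q = a + b].
Definition zeroI q := q = 0.

End Basics.

(** Reads the [subring] and [is_ideal] facts from the context; this is why many proofs first restate
    them as local hypotheses. *)
Ltac mem := first [ assumption |
  match goal with
  | H : subring ?A |- ?A 0 => exact: (sr0 H)
  | H : subring ?A |- ?A 1 => exact: (sr1 H)
  | H : subring ?A |- ?A (_%:R) => exact: (sr_nat _ H)
  | H : subring ?A |- ?A (- _) => apply: (srN H); mem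
  | H : subring ?A |- ?A (_ + _) => apply: (srD H); mem
  | H : subring ?A |- ?A (_ * _) => apply: (srM H); mem
  | H : subring ?A |- ?A (_ ^+ _) => apply: (srX H); mem
  | H : is_ideal ?A ?I |- ?I 0 => exact: (id0 H)
  | HA : subring ?A, H : is_ideal ?A ?I |- ?I (- _) => apply: (idN HA H); mem
  | H : is_ideal ?A ?I |- ?I (_ + _) => apply: (idD H); mem
  | H : is_ideal ?A ?I |- ?I (_ * _) => first [solve [apply: (idM H); mem] | solve [apply: (idMr H); mem]]
  | HA : subring ?A, H : is_ideal ?A ?I |- ?I (_ ^+ _.+1) => apply: (idXS H HA); mem
  | H : is_ideal ?A ?I, H' : ?I ?x |- ?A ?x => exact: (idS H)
  end ].

Section Ideals.
Variable F : fieldType.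
Implicit Types (A B I J K P Q : F -> Prop) (a b c q x y z : F).

Lemma addI_ideal A I J : subring A -> is_ideal A I -> is_ideal A J -> is_ideal A (addI I J).
Proof.
move=> hA hI hJ; split.
- by move=> q [a [b [ha hb ->]]]; mem.
- by exists 0, 0; split; [mem|mem|rewrite addr0].
- move=> _ _ [a [b [ha hb ->]]] [a' [b' [ha' hb' ->]]].
  by exists (a + a'), (b + b'); split; [mem|mem|ring].
- move=> c _ hc [a [b [ha hb ->]]].
  by exists (c * a), (c * b); split; [mem|mem|ring].
Qed.

Lemma addI_l A I J : is_ideal A J -> subset_of I (addI I J).
Proof. by move=> hJ q hq; exists q, 0; split; [|apply: (id0 hJ)|rewrite addr0]. Qed.
Lemma addI_r A I J : is_ideal A I -> subset_of J (addI I J).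
Proof. by move=> hJ q hq; exists 0, q; split; [apply: (id0 hJ)| |rewrite add0r]. Qed.
Lemma addI_min A I J K : is_ideal A K -> subset_of I K -> subset_of J K -> subset_of (addI I J) K.
Proof. by move=> hK h1 h2 _ [a [b [ha hb ->]]]; apply: (idD hK); [apply: h1|apply: h2]. Qed.
Lemma addI_mono I J I' J' : subset_of I I' -> subset_of J J' -> subset_of (addI I J) (addI I' J').
Proof. by move=> h1 h2 _ [a [b [ha hb ->]]]; exists a, b; split; [apply: h1|apply: h2|]. Qed.

Lemma principal_ideal A x : subring A -> A x -> is_ideal A (principal A x).
Proof.
move=> hA hx; split.
- by move=> q [s [hs ->]]; mem.
- by exists 0; split; [mem|rewrite mulr0].
- by move=> _ _ [a [ha ->]] [b [hb ->]]; exists (a + b); split; [mem|ring].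
- by move=> c _ hc [a [ha ->]]; exists (c * a); split; [mem|ring].
Qed.
Lemma principal_self A x : subring A -> principal A x x.
Proof. by move=> hA; exists 1; split; [mem|rewrite mulr1]. Qed.
Lemma principal_min A x I : is_ideal A I -> I x -> subset_of (principal A x) I.
Proof. by move=> hI hx _ [s [hs ->]]; mem. Qed.

Lemma zero_prime A : subring A -> is_prime A (@zeroI F).
Proof.
move=> hA; split; first split.
- by move=> q ->; mem.
- by [].
- by move=> a b -> ->; rewrite /zeroI addr0.
- by move=> a b _ ->; rewrite /zeroI mulr0.
- by move=> /eqP; rewrite oner_eq0.
- by move=> a b _ _ /eqP; rewrite mulf_eq0 => /orP [] /eqP; [left|right].
Qed.
Lemma addI_zero A I : is_ideal A I -> addI (@zeroI F) I = I.
Proof.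
move=> hI; apply: set_ext => q; split; first by case=> a [b [-> hb ->]]; rewrite add0r.
by move=> hq; exists 0, q; split=> //; rewrite add0r.
Qed.

Lemma gen_nil A q : gen_ideal A [::] q <-> q = 0.
Proof.
split; first by case=> c [_ ->]; rewrite big_ord0.
by move=> ->; exists (fun=> 0); split; [case|rewrite big_ord0].
Qed.
Lemma gen_cons A x s q :
  gen_ideal A (x :: s) q <-> exists a r, [/\ A a, gen_ideal A s r & q = a * x + r].
Proof.
split.
- case=> c [hc ->]; rewrite big_ord_recl /=.
  exists (c ord0), (\sum_(i < size s) c (lift ord0 i) * s`_i); split=> //.
  by exists (fun i => c (lift ord0 i)).
- case=> a [_ [ha [c [hc ->]] ->]].
  exists (fun i : 'I_(size s).+1 => if unlift ord0 i is Some j then c j else a); split.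
    by move=> i; case: (unlift ord0 i).
  rewrite big_ord_recl /= unlift_none; congr (_ + _); apply: eq_bigr => i _.
  by rewrite liftK.
Qed.
Lemma gen_ideal_ideal A s : subring A -> all_in A s -> is_ideal A (gen_ideal A s).
Proof.
move=> hA; elim: s => [|x s IH] hs.
  have -> : gen_ideal A [::] = @zeroI F by apply: set_ext => q; apply: gen_nil.
  exact: (prI (zero_prime hA)).
have {}IH := IH (fun i hi => hs i.+1 hi).
have hx : A x := hs 0%N isT.
have -> : gen_ideal A (x :: s) = addI (principal A x) (gen_ideal A s).
  apply: set_ext => q; rewrite gen_cons; split.
    by case=> a [r [ha hr ->]]; exists (a * x), r; split=> //; exists a; rewrite mulrC.
  case=> _ [r [[a [ha ->]] hr ->]]; exists a, r; split=> //; by rewrite mulrC.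
by apply: addI_ideal => //; apply: principal_ideal.
Qed.
Lemma gen_min A s I : is_ideal A I -> all_in I s -> subset_of (gen_ideal A s) I.
Proof.
move=> hI hs _ [c [hc ->]]; apply: (id_sum _ hI) => i _; apply: (idM hI) => //.
exact: hs.
Qed.
Lemma gen_in A s : subring A -> all_in (gen_ideal A s) s.
Proof.
move=> hA; elim: s => [|x s IH] [|i] //= hi; apply/gen_cons.
  exists 1, 0; split; [mem| |by rewrite mul1r addr0].
  by exists (fun=> 0); split; [move=> _; mem|rewrite big1 // => i _; rewrite mul0r].
by exists 0, s`_i; split; [mem|exact: IH|rewrite mul0r add0r].
Qed.

Lemma idpow_ideal A I n : subring A -> is_ideal A I -> is_ideal A (idpow A I n).
Proof.
move=> hA hI; elim: n => [|n IH] /=.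
  by split; move=> *; mem.
split.
- move=> _ [k [u [v [h ->]]]]; apply: (sr_sum _ hA) => j _; case: (h j) => hu hv; mem.
- by exists 0%N, (fun=> 0), (fun=> 0); split; [case|rewrite big_ord0].
- move=> _ _ [k [u [v [h ->]]]] [k' [u' [v' [h' ->]]]].
  exists (k + k')%N, (fun i => match split i with inl j => u j | inr j => u' j end),
    (fun i => match split i with inl j => v j | inr j => v' j end); split.
    by move=> j; case: (split j) => i; [apply: h|apply: h'].
  rewrite big_split_ord /=; congr (_ + _); apply: eq_bigr => i _.
    by rewrite (unsplitK (inl i)).
  by rewrite (unsplitK (inr i)).
- move=> a _ ha [k [u [v [h ->]]]].
  exists k, (fun j => a * u j), v; split.
    by move=> j; case: (h j) => hu hv; split=> //; mem.
  by rewrite mulr_sumr; apply: eq_bigr => j _; rewrite mulrA.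
Qed.
Lemma idpowS_ind A I n K : is_ideal A K ->
  (forall u v, idpow A I n u -> I v -> K (u * v)) -> subset_of (idpow A I n.+1) K.
Proof.
by move=> hK h _ [k [u [v [huv ->]]]]; apply: (id_sum _ hK) => j _; case: (huv j); apply: h.
Qed.
Lemma idpowS_mul A I n u v : idpow A I n u -> I v -> idpow A I n.+1 (u * v).
Proof. by move=> hu hv; exists 1%N, (fun=> u), (fun=> v); split=> //; rewrite big_ord1. Qed.
Lemma idpow1 A I : subring A -> is_ideal A I -> idpow A I 1 = I.
Proof.
move=> hA hI; apply: set_ext => q; split; first by apply: (idpowS_ind hI) => u v /= hu hv; mem.
by move=> hq; rewrite -[q]mul1r; apply: idpowS_mul => //=; mem.
Qed.
(** Induction on [t]: the last factor [v] is moved into the target, which becomes the colon ideal of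
    the [w] with [w * v] in [K]. *)
Lemma idpowD_ind A I s t K : subring A -> is_ideal A I -> is_ideal A K ->
  (forall u v, idpow A I s u -> idpow A I t v -> K (u * v)) -> subset_of (idpow A I (s + t)) K.
Proof.
move=> hA hI; elim: t K => [|t IH] K hK h.
  by rewrite addn0 => q hq; rewrite -[q]mulr1; apply: h => //=; mem.
rewrite addnS; apply: (idpowS_ind hK) => u v hu hv.
have hc : is_ideal A (fun w => A w /\ K (w * v)).
  split=> [q []//|||].
  - by rewrite mul0r; split; mem.
  - by move=> x y [? ?] [? ?]; split; [mem|rewrite mulrDl; mem].
  - by move=> x y ? [? ?]; split; [mem|rewrite -mulrA; mem].
have /(IH _ hc) : forall u v0, idpow A I s u -> idpow A I t v0 -> A (u * v0) /\ K (u * v0 * v).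
  move=> u' v' hu' hv'.
  have h1 := idS (idpow_ideal s hA hI) hu'; have h2 := idS (idpow_ideal t hA hI) hv'.
  by split; [mem|rewrite -mulrA; apply: h => //; apply: idpowS_mul].
by case/(_ u hu).
Qed.
Lemma idpow_mul A I s t u v : subring A -> is_ideal A I ->
  idpow A I s u -> idpow A I t v -> idpow A I (s + t) (u * v).
Proof.
move=> hA hI hu; elim: t v => [|t IH] v hv.
  by rewrite addn0; apply: (idMr (idpow_ideal s hA hI)).
have hK := idpow_ideal (s + t.+1) hA hI.
have hu' : A u := idS (idpow_ideal s hA hI) hu.
have hc : is_ideal A (fun w => A w /\ idpow A I (s + t.+1) (u * w)).
  split=> [q []//|||].
  - by rewrite mulr0; split; mem.
  - by move=> x y [? ?] [? ?]; split; [mem|rewrite mulrDr; mem].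
  - by move=> x y ? [? ?]; split; [mem|rewrite mulrCA; mem].
suff h : forall u' v', idpow A I t u' -> I v' -> A (u' * v') /\ idpow A I (s + t.+1) (u * (u' * v')).
  by case: (idpowS_ind hc h hv).
move=> u' v' hu'1 hv'; have h1 := idS (idpow_ideal t hA hI) hu'1; have h2 := idS hI hv'.
by split; [mem|rewrite mulrA addnS; apply: idpowS_mul => //; apply: IH].
Qed.
Lemma idpow_le A I s t : subring A -> is_ideal A I -> (s <= t)%N ->
  subset_of (idpow A I t) (idpow A I s).
Proof.
move=> hA hI /subnKC <-; apply: (idpowD_ind hA hI (idpow_ideal s hA hI)) => u v hu hv.
by apply: (idMr (idpow_ideal s hA hI)) => //; apply: (idS (idpow_ideal (t - s) hA hI)).
Qed.
Lemma idpow_exp A I n x : subring A -> I x -> idpow A I n (x ^+ n).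
Proof.
move=> hA hx; elim: n => [|n IH]; first by rewrite expr0; apply: sr1.
by rewrite exprSr; apply: idpowS_mul.
Qed.
Lemma idpow_mono A I J n : subring A -> is_ideal A J -> subset_of I J ->
  subset_of (idpow A I n) (idpow A J n).
Proof.
move=> hA hJ hIJ; elim: n => [|n IH] // q [k [u [v [h ->]]]].
by exists k, u, v; split=> // j; case: (h j) => hu hv; split; [apply: IH|apply: hIJ].
Qed.
Lemma idpow_addI A P J n : subring A -> is_ideal A P -> is_ideal A J ->
  subset_of (idpow A (addI P J) n) (addI P (idpow A J n)).
Proof.
move=> hA hP hJ; elim: n => [|n IH] /=.
  by move=> q hq; exists 0, q; split; [mem|mem|rewrite add0r].
apply: (idpowS_ind (addI_ideal hA hP (idpow_ideal n.+1 hA hJ))) => u v /IH [p [j [hp hj ->]]].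
case=> [p' [j' [hp' hj' ->]]].
have hj1 := idS (idpow_ideal n hA hJ) hj.
exists (p * (p' + j') + j * p'), (j * j'); split; [mem|exact: idpowS_mul|ring].
Qed.
(** Splits a form into the monomials divisible by the first variable [x] and those free of it. *)
Lemma idpow_cons A x J n : subring A -> A x -> is_ideal A J -> forall w,
  idpow A (addI (principal A x) J) n.+1 w -> exists u w',
   [/\ idpow A (addI (principal A x) J) n u, idpow A J n.+1 w' & w = x * u + w'].
Proof.
move=> hA hx hJ; set K := addI _ _.
have hK : is_ideal A K by apply: addI_ideal => //; apply: principal_ideal.
elim: n => [|n IH] w.
  rewrite !idpow1 // => -[_ [j [[s [hs ->]] hj ->]]].
  by exists s, j; split=> //=.
have hI n' := idpow_ideal n' hA hK. have hI' n' := idpow_ideal n' hA hJ.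
have hid : is_ideal A (fun w => exists u w', [/\ idpow A K n.+1 u, idpow A J n.+2 w' & w = x * u + w']).
  split.
  - move=> _ [u [w' [hu hw' ->]]].
    have h1 := idS (hI _) hu; have h2 := idS (hI' _) hw'; mem.
  - exists 0, 0; split; [exact: id0 (hI _)|exact: id0 (hI' _)|ring].
  - move=> _ _ [u [w1 [hu hw1 ->]]] [u' [w1' [hu' hw1' ->]]].
    exists (u + u'), (w1 + w1'); split; [exact: (idD (hI _))|exact: (idD (hI' _))|ring].
  - move=> a _ ha [u [w1 [hu hw1 ->]]].
    exists (a * u), (a * w1); split; [exact: (idM (hI _))|exact: (idM (hI' _))|ring].
move: w; apply: (idpowS_ind hid) => u v hu [_ [j [[s [hs ->]] hj ->]]].
have [u' [w' [hu' hw' ->]]] := IH _ hu.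
exists (s * (x * u' + w') + u' * j), (w' * j); split; [|exact: idpowS_mul|ring].
apply: (idD (hI _)).
  apply: (idM (hI _)) => //; apply: (idD (hI _)); first by rewrite mulrC; apply: idpowS_mul => //;
    apply: addI_l; [exact: hJ|exact: principal_self].
  by apply: (@idpow_mono A J) hw' => // q hq; apply: addI_r hq; apply: principal_ideal.
by apply: idpowS_mul => //; apply: addI_r hj; apply: principal_ideal.
Qed.

End Ideals.

(** * Noetherian rings and Krull's intersection theorem *)

Section Noetherian.
Variable F : fieldType.
Implicit Types (A B I J K P Q m : F -> Prop) (a b c q x y z : F).

(** Without a maximal member, choice gives a strictly increasing sequence; finitely many generators
    of its union already lie in one term. *)
Lemma noeth_max A (C : (F -> Prop) -> Prop) : subring A -> noetherian A ->
  (exists I, is_ideal A I /\ C I) ->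
  exists I, [/\ is_ideal A I, C I &
    forall J, is_ideal A J -> C J -> subset_of I J -> subset_of J I].
Proof.
move=> hA hN [I0 hI0]; apply: NNPP => hno.
have step I : is_ideal A I /\ C I -> exists J, (is_ideal A J /\ C J) /\ (subset_of I J /\ ~ subset_of J I).
  move=> [hI hC]; apply: NNPP => h; apply: hno; exists I; split=> // J hJ hCJ hIJ.
  by apply: NNPP => hJI; apply: h; exists J.
pose T := {I | is_ideal A I /\ C I}.
have step' (I : T) : {J : T | subset_of (sval I) (sval J) /\ ~ subset_of (sval J) (sval I)}.
  apply: constructive_indefinite_description; case: I => I hI /=.
  by have [J [hJ h]] := step I hI; exists (exist _ J hJ).
pose f n : T := iter n (fun I : T => sval (step' I)) (exist _ I0 hI0).
pose g n := sval (f n).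
have gS n : subset_of (g n) (g n.+1) /\ ~ subset_of (g n.+1) (g n) by exact: (svalP (step' (f n))).
have gi n : is_ideal A (g n) by case: (svalP (f n)).
have gle n k : (n <= k)%N -> subset_of (g n) (g k).
  move=> /subnKC <-; elim: (k - n)%N => [|j IH]; first by rewrite addn0.
  by rewrite addnS => q /IH; case: (gS (n + j)%N) => h _; apply: h.
have hU : is_ideal A (fun q => exists n, g n q).
  split.
  - by move=> q [n]; apply: (idS (gi n)).
  - by exists 0%N; apply: (id0 (gi _)).
  - move=> a b [n ha] [k hb]; exists (maxn n k); apply: (idD (gi _)).
      by apply: gle ha; apply: leq_maxl.
    by apply: gle hb; apply: leq_maxr.
  - by move=> a b ha [n hb]; exists n; apply: (idM (gi _)).
have [s [hs e]] := hN _ hU.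
have [n hn] : exists n, all_in (g n) s.
  have hs' : all_in (fun q => exists n, g n q) s by move=> i hi; apply/e; apply: gen_in.
  elim: {hs e} s hs' => [|y s IH] hs; first by exists 0%N.
  have [k hk] := hs 0%N isT.
  have [l hl] := IH (fun i hi => hs i.+1 hi).
  exists (maxn k l) => -[|i] /= hi; first by apply: gle hk; apply: leq_maxl.
  by apply: (gle l); [apply: leq_maxr|apply: hl].
case: (gS n) => _; apply=> q hq.
by apply: (gen_min (gi n) hn); apply/e; exists n.+1.
Qed.

Lemma noeth_ind A (C : (F -> Prop) -> Prop) : subring A -> noetherian A ->
  (forall I, is_ideal A I ->
    (forall J, is_ideal A J -> subset_of I J -> ~ subset_of J I -> C J) -> C I) ->
  forall I, is_ideal A I -> C I.
Proof.
move=> hA hN h I hI; apply: NNPP => hC.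
have [|K [hK hCK hmax]] := @noeth_max A (fun I => ~ C I) hA hN; first by exists I.
apply: hCK; apply: h => // J hJ hKJ hJK; apply: NNPP => hCJ.
by apply: hJK; apply: hmax.
Qed.

Lemma noeth_acc A (I : nat -> F -> Prop) : subring A -> noetherian A ->
  (forall n, is_ideal A (I n)) -> (forall n, subset_of (I n) (I n.+1)) ->
  exists n, forall k, (n <= k)%N -> subset_of (I k) (I n).
Proof.
move=> hA hN hI hS.
have hle n k : (n <= k)%N -> subset_of (I n) (I k).
  move=> /subnKC <-; elim: (k - n)%N => [|j IH]; first by rewrite addn0.
  by rewrite addnS => q /IH; apply: hS.
have [|K [hK [n ->] hmax]] := @noeth_max A (fun J => exists n, J = I n) hA hN.
  by exists (I 0%N); split=> //; exists 0%N.
by exists n => k hk; apply: hmax => //; [exists k|apply: hle].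
Qed.

(** An ideal maximal among those containing [I] and disjoint from [M] is prime. *)
Lemma prime_avoiding A I (M : F -> Prop) : subring A -> noetherian A -> is_ideal A I ->
  M 1 -> (forall x y, M x -> M y -> M (x * y)) -> (forall x, I x -> ~ M x) ->
  exists P, [/\ is_prime A P, subset_of I P & forall x, P x -> ~ M x].
Proof.
move=> hA hN hI M1 MM hdis.
have [|P [hP [hIP hPM] hmax]] :=
  @noeth_max A (fun J => subset_of I J /\ forall x, J x -> ~ M x) hA hN; first by exists I; split=> //; split.
exists P; split=> //; split=> // [/hPM//|x y hx hy hxy].
apply: NNPP => /not_or_and [nx ny].
have big z : A z -> ~ P z -> exists p s, [/\ P p, A s & M (p + z * s)].
  move=> hz nz; apply: NNPP => hno; apply: nz.
  have hpz := principal_ideal hA hz.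
  apply: (hmax (addI P (principal A z))).
  - exact: addI_ideal.
  - split; first by move=> q /hIP; apply: (addI_l hpz).
    move=> _ [p [_ [hp [s [hs ->]] ->]]] hM; apply: hno.
    by exists p, s.
  - exact: (addI_l hpz).
  - by apply: (addI_r hP); apply: principal_self.
have [p [s [hp hs h1]]] := big x hx nx; have [p' [s' [hp' hs' h2]]] := big y hy ny.
apply: (hPM _ _ (MM _ _ h1 h2)).
have -> : (p + x * s) * (p' + y * s') = p * (p' + y * s') + x * s * p' + (s * s') * (x * y) by ring.
by have ? := idS hP hp; have ? := idS hP hp'; mem.
Qed.

(* An ideal maximal among those containing [K] but no power of [I] is prime. *)
Lemma rad_pow A I K : subring A -> noetherian A -> is_ideal A I -> is_ideal A K ->
  (forall y, I y -> exists n, K (y ^+ n)) -> exists n, subset_of (idpow A I n) K.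
Proof.
move=> hA hN hI hK hrad; apply: NNPP => hno.
have [|P [hP [hKP hPI] hmax]] := @noeth_max A
  (fun J => subset_of K J /\ forall n, ~ subset_of (idpow A I n) J) hA hN.
  by exists K; split=> //; split=> // n hn; apply: hno; exists n.
have prP : is_prime A P.
  split=> // [h1|x y hx hy hxy].
    by apply: (hPI 0%N) => q /= hq; rewrite -[q]mulr1; mem.
  apply: NNPP => /not_or_and [nx ny].
  have big z : A z -> ~ P z -> exists n, subset_of (idpow A I n) (addI P (principal A z)).
    move=> hz nz; apply: NNPP => hno'; apply: nz.
    have hpz := principal_ideal hA hz.
    apply: (hmax (addI P (principal A z))).
    - exact: addI_ideal.
    - split; first by move=> q /hKP; apply: (addI_l hpz).
      by move=> n hn; apply: hno'; exists n.
    - exact: (addI_l hpz).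
    - by apply: (addI_r hP); apply: principal_self.
  have [s hs] := big x hx nx; have [t ht] := big y hy ny.
  apply: (hPI (s + t)%N); apply: idpowD_ind => // u v /hs [p [_ [hp [c [hc ->]] ->]]].
  move=> /ht [p' [_ [hp' [c' [hc' ->]] ->]]].
  have -> : (p + x * c) * (p' + y * c') = p * (p' + y * c') + x * c * p' + (c * c') * (x * y) by ring.
  by have ? := idS hP hp; have ? := idS hP hp'; mem.
apply: (hPI 1%N); rewrite idpow1 // => y hy; have [n /hKP hn] := hrad y hy.
by apply: (prX hA prP) hn; apply: (idS hI).
Qed.

Lemma colon_ideal A K y : subring A -> is_ideal A K -> A y -> is_ideal A (fun r => A r /\ K (r * y)).
Proof.
move=> hA hK hy; split=> [q []//|||].
- by rewrite mul0r; split; mem.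
- by move=> a b [? ?] [? ?]; split; [mem|rewrite mulrDl; mem].
- by move=> a b ? [? ?]; split; [mem|rewrite -mulrA; mem].
Qed.

(* For [K] maximal among the ideals that contain [I + m a] but not [a], stability of the
   colon ideals [(K : y^n)] puts a power of each [y] in [m] into [K]. *)
Lemma krull_intersection A m I a : noetherian A -> is_local A m -> is_ideal A I ->
  (forall n, addI I (idpow A m n) a) -> I a.
Proof.
move=> hN hL hI ha; have hA := loc_sr hL; have hm := loc_id hL.
have haA : A a.
  case: (ha 0%N) => i [j [hi hj ->]]; have ? := idS hI hi; rewrite /= in hj; mem.
have hma : is_ideal A (fun q => exists y, m y /\ q = y * a).
  split.
  - by move=> _ [y [hy ->]]; have ? := idS hm hy; mem.
  - by exists 0; split; [mem|rewrite mul0r].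
  - by move=> _ _ [y [hy ->]] [y' [hy' ->]]; exists (y + y'); split; [mem|ring].
  - by move=> c _ hc [y [hy ->]]; exists (c * y); split; [mem|ring].
have hI1 := addI_ideal hA hI hma.
suff [i [_ [hi [y [hy ->]] e]]] : addI I (fun q => exists y, m y /\ q = y * a) a.
  have [| |u [hu eu]] := @loc_unit _ A m hL (1 - y).
  - by have ? := idS hm hy; mem.
  - by move=> h; apply: (loc_1 hL); rewrite -(subrK y 1); mem.
  have ei : i = a * (1 - y) by rewrite mulrBr mulr1 [a * y]mulrC; apply/eqP; rewrite eq_sym subr_eq -e.
  have -> : a = u * i by rewrite ei mulrCA [u * _]mulrC eu mulr1.
  by mem.
apply: NNPP => hna.
have [|K [hK [hIK haK] hmax]] := @noeth_max A
  (fun K => subset_of (addI I (fun q => exists y, m y /\ q = y * a)) K /\ ~ K a) hA hN.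
  by exists (addI I (fun q => exists y, m y /\ q = y * a)); split=> //; split.
have hrad y : m y -> exists n, K (y ^+ n).
  move=> hy; have hyA := idS hm hy.
  have [| |n hn] := @noeth_acc A (fun n r => A r /\ K (r * y ^+ n)) hA hN.
  - by move=> n; apply: colon_ideal => //; mem.
  - by move=> n q [hq hk]; split=> //; rewrite exprSr mulrA; mem.
  exists n; have hyn : A (y ^+ n) by mem.
  have hpy := principal_ideal hA hyn.
  apply: (hmax (addI K (principal A (y ^+ n)))).
  - exact: addI_ideal.
  - split; first by move=> q /hIK; apply: (addI_l hpy).
    move=> [k [_ [hk [r [hr ->]] e]]]; apply: haK; rewrite e.
    apply: (idD hK) => //; rewrite mulrC.
    have : A r /\ K (r * y ^+ n.+1).
      split=> //; have -> : r * y ^+ n.+1 = y * a + (- y) * k by rewrite e exprS; ring.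
      apply: (idD hK); last by mem.
      by apply: hIK; apply: (addI_r hI); exists y.
    by move/(hn n.+1 (leqnSn n)) => [].
  - exact: (addI_l hpy).
  - by apply: (addI_r hK); apply: principal_self.
have [n hn] := rad_pow hA hN hm hK hrad.
apply: haK; case: (ha n) => i [j [hi /hn hj ->]]; apply: (idD hK) => //.
by apply: hIK; apply: (addI_l hma).
Qed.

(** A nonzero socle element of $A/J$. If there were none, $m^{n+1}\subseteq J$ would imply
    $m^n\subseteq J$, down to $1\in J$. *)
Lemma socle_elt A m J n : is_local A m -> is_ideal A J -> ~ J 1 -> subset_of (idpow A m n) J ->
  exists u, [/\ A u, ~ J u & forall y, m y -> J (y * u)].
Proof.
move=> hL hJ h1 hn; have hA := loc_sr hL; have hm := loc_id hL.
apply: NNPP => hno; apply: h1.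
have {}hno u : A u -> (forall y, m y -> J (y * u)) -> J u.
  by move=> hu h; apply: NNPP => hu'; apply: hno; exists u.
suff : subset_of (idpow A m 0) J by apply; apply: sr1.
elim: n hn => [//|n IH] hn; apply: IH => u hu; apply: hno.
  exact: idS (idpow_ideal n hA hm) _ hu.
by move=> y hy; apply: hn; rewrite mulrC; apply: idpowS_mul.
Qed.

(** Noetherian induction on [J]: add a socle element [u] to [J]. The quotient $(J+uA)/J$ is a line
    over the residue field, so between [J] and $J+uA$ the chain can only drop once. *)
Lemma dcc A m : noetherian A -> is_local A m -> forall J, is_ideal A J -> 
  (exists n, subset_of (idpow A m n) J) -> 
  forall I : nat -> F -> Prop, (forall n, is_ideal A (I n)) -> (forall n, subset_of J (I n)) ->
   (forall n, subset_of (I n.+1) (I n)) -> exists n, forall k, (n <= k)%N -> subset_of (I n) (I k).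
Proof.
move=> hN hL; have hA := loc_sr hL; have hm := loc_id hL.
apply: (noeth_ind hA hN) => J hJ IH [n hn] I hI hJI hdec.
case: (classic (J 1)) => [J1|nJ1].
  exists 0%N => k _ q hq; apply: hJI; rewrite -[q]mulr1.
  by apply: (idM hJ) => //; apply: (idS (hI 0%N)).
have hle i k : (i <= k)%N -> subset_of (I k) (I i).
  move=> /subnKC <-; elim: (k - i)%N => [|j IHj]; first by rewrite addn0.
  by rewrite addnS => q /hdec /IHj.
have [u [hu hJu hmu]] := socle_elt hL hJ nJ1 hn.
have hpu := principal_ideal hA hu.
have hU := addI_ideal hA hJ hpu.
have hJU : subset_of J (addI J (principal A u)) by apply: (addI_l hpu).
have [| | | | |n1 hn1] := IH _ hU hJU _ _ (fun k => addI (I k) (addI J (principal A u))).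
- by move=> h; apply: hJu; apply: h; apply: (addI_r hJ); apply: principal_self.
- by exists n => q /hn /hJU.
- by move=> k; apply: addI_ideal.
- by move=> k; apply: (addI_r (hI k)).
- by move=> k; apply: addI_mono.
(* If [u] leaves the chain at some index, take that index, which makes the premise false; otherwise
   any index works. *)
have [n2 hn2] : exists n2, forall k, (n2 <= k)%N -> I n2 u -> I k u.
  case: (classic (forall k, I k u)) => [h|/not_all_ex_not [k0 h]]; first by exists 0%N.
  by exists k0.
exists (maxn n1 n2) => k; rewrite geq_max => /andP [hk1 hk2] q hq.
have hq1 : I n1 q by apply: hle hq; apply: leq_maxl.
have [i [_ [hi [j [_ [hj [r [hr ->]] ->]]] e]]] := hn1 _ hk1 q (addI_l hU hq1).
rewrite e; apply: (idD (hI k)) => //; apply: (idD (hI k)); first exact: hJI.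
have hur : I n2 (u * r).
  have -> : u * r = q - i - j by rewrite e; ring.
  have ? := hI n2.
  have ? : I n2 q by apply: hle hq; apply: leq_maxr.
  have ? : I n2 i by apply: hle hi.
  have ? : I n2 j by apply: hJI.
  by mem.
case: (classic (m r)) => hmr; first by apply: hJI; rewrite mulrC; apply: hmu.
have [r' [hr' er]] := loc_unit hL hr hmr.
apply: (idMr (hI k)) => //; apply: hn2 => //.
by rewrite -[u]mulr1 -er mulrA; apply: (idMr (hI n2)).
Qed.

End Noetherian.

(** * Localization and the principal ideal theorem *)

Section Localization.
Variable F : fieldType.
Implicit Types (A B I J K P Q M m : F -> Prop) (a b c q x y z : F).

Definition mult_set A M := [/\ subset_of M A, M 1, ~ M 0 & forall x y, M x -> M y -> M (x * y)].
Definition fracs I M q := exists a s, [/\ I a, M s & q = a / s].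

Lemma ms_neq0 A M s : mult_set A M -> M s -> s != 0.
Proof. by case=> _ _ h0 _ hs; apply/eqP => e; rewrite e in hs. Qed.

Lemma fracs_in A M I : mult_set A M -> subset_of I (fracs I M).
Proof. by case=> _ M1 _ _ q hq; exists q, 1; split=> //; rewrite divr1. Qed.

Lemma fracs_inv A M s : subring A -> mult_set A M -> M s -> fracs A M s^-1.
Proof. by move=> hA hM hs; exists 1, s; split=> //; [mem|rewrite mul1r]. Qed.

Lemma fracs_subring A M : subring A -> mult_set A M -> subring (fracs A M).
Proof.
move=> hA hM; have [MA M1 M0 MM] := hM; split.
- by exists 0, 1; split=> //; [mem|rewrite mul0r].
- by exists 1, 1; split=> //; [mem|rewrite divr1].
- move=> _ _ [a [s [ha hs ->]]] [b [t [hb ht ->]]].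
  have hs' := MA _ hs; have ht' := MA _ ht.
  exists (a * t - b * s), (s * t); split; [mem|exact: MM|].
  by field; rewrite (ms_neq0 hM hs) (ms_neq0 hM ht).
- move=> _ _ [a [s [ha hs ->]]] [b [t [hb ht ->]]].
  exists (a * b), (s * t); split; [mem|exact: MM|].
  by field; rewrite (ms_neq0 hM hs) (ms_neq0 hM ht).
Qed.

Lemma fracs_ideal A M I : subring A -> mult_set A M -> is_ideal A I -> is_ideal (fracs A M) (fracs I M).
Proof.
move=> hA hM hI; have [MA M1 M0 MM] := hM; split.
- by move=> _ [a [s [ha hs ->]]]; exists a, s; split=> //; mem.
- by apply: (fracs_in hM); mem.
- move=> _ _ [a [s [ha hs ->]]] [b [t [hb ht ->]]].
  have hs' := MA _ hs; have ht' := MA _ ht.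
  exists (a * t + b * s), (s * t); split; [mem|exact: MM|].
  by field; rewrite (ms_neq0 hM hs) (ms_neq0 hM ht).
- move=> _ _ [a [s [ha hs ->]]] [b [t [hb ht ->]]].
  exists (a * b), (s * t); split; [mem|exact: MM|].
  by field; rewrite (ms_neq0 hM hs) (ms_neq0 hM ht).
Qed.

Lemma fracs_noeth A M : subring A -> mult_set A M -> noetherian A -> noetherian (fracs A M).
Proof.
move=> hA hM hN J hJ; have [MA M1 M0 MM] := hM.
have hI : is_ideal A (fun q => A q /\ J q).
  split=> [q []//|||].
  - by split; mem.
  - by move=> a b [? ?] [? ?]; split; mem.
  - by move=> a b ? [? ?]; split; [mem|apply: (idM hJ) => //; apply: (fracs_in hM)].
have [s [hs e]] := hN _ hI.
have hsJ : all_in (fun q => A q /\ J q) s by move=> i hi; apply/e; apply: gen_in.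
exists s; split; first by move=> i hi; apply: (fracs_in hM); apply: hs.
move=> q; split; last by apply: (gen_min hJ) => i hi; case: (hsJ i hi).
move=> hq; have [a [t [ha ht eq]]] := idS hJ hq.
have t0 := ms_neq0 hM ht.
have /e [c [hc ec]] : A a /\ J a.
  split=> //; have -> : a = t * q by rewrite eq mulrC divfK.
  by apply: (idM hJ) => //; apply: (fracs_in hM); apply: MA.
exists (fun i => c i / t); split; first by move=> i; exists (c i), t.
by rewrite eq ec mulr_suml; apply: eq_bigr => i _; rewrite mulrAC.
Qed.

Definition offset A P s := A s /\ ~ P s.

Lemma offset_ms A P : subring A -> is_prime A P -> mult_set A (offset A P).
Proof.
move=> hA hP; have hI := prI hP; split.
- by move=> q [].
- by split; [mem|exact: pr1 hP].
- by case=> _; apply; mem.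
- by move=> x y [hx nx] [hy ny]; split; [mem|move/(prM hP hx hy) => []].
Qed.

Lemma localize_atE A P : localize_at A P = fracs A (offset A P).
Proof.
apply: set_ext => q; split.
  by case=> a [b [ha hb nb ->]]; exists a, b.
by case=> a [b [ha [hb nb] ->]]; exists a, b.
Qed.

Section AtPrime.
Variables (A P : F -> Prop).
Hypotheses (hA : subring A) (hP : is_prime A P).
Let M := offset A P.
Let hM := offset_ms hA hP.

Lemma ext_contr Q a : is_prime A Q -> subset_of Q P -> A a -> fracs Q M a -> Q a.
Proof.
move=> hQ hQP ha [b [s [hb [hs ns] e]]].
have s0 : s != 0 by apply: (ms_neq0 hM).
have : Q (a * s) by rewrite e divfK.
by case/(prM hQ ha hs) => // /hQP.
Qed.

Lemma ext_prime Q : is_prime A Q -> subset_of Q P -> is_prime (fracs A M) (fracs Q M).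
Proof.
move=> hQ hQP; split; first exact: fracs_ideal (prI hQ).
  by move=> h; apply: (pr1 hQ); apply: ext_contr => //; mem.
move=> _ _ [a [s [ha hs ->]]] [b [t [hb ht ->]]] h.
have s0 := ms_neq0 hM hs; have t0 := ms_neq0 hM ht.
have : Q (a * b).
  apply: ext_contr => //; first by mem.
  have -> : a * b = (s * t) * (a / s * (b / t)) by field; rewrite s0 t0.
  apply: (idM (fracs_ideal hA hM (prI hQ))) => //.
  by apply: (fracs_in hM); case: hs => ? _; case: ht => ? _; mem.
by case/(prM hQ ha hb) => h'; [left; exists a, s|right; exists b, t].
Qed.

Lemma ext_local : is_local (fracs A M) (fracs P M).
Proof.
have hB := fracs_subring hA hM; have hPB := ext_prime hP (fun q h => h).
split=> //; split; first exact: prI hPB.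
split; first exact: pr1 hPB.
move=> q; split=> [hq|[[a [s [ha hs ->]]] hu]].
  split; first exact: (idS (prI hPB)).
  by case=> _ [y [hy e]]; apply: (pr1 hPB); rewrite -e; apply: (idMr (prI hPB)).
exists a, s; split=> //; apply: NNPP => na; apply: hu; split; first by exists a, s.
have s0 := ms_neq0 hM hs.
have a0 : a != 0 by apply/eqP => a0; apply: na; rewrite a0; apply: (id0 (prI hP)).
exists (s / a); split; first by exists s, a; split=> //; case: hs.
by field; rewrite s0 a0.
Qed.

End AtPrime.
End Localization.

(** * Krull's principal ideal theorem modulo a prime, and lengths of chains of primes *)

Section Height.
Variable F : fieldType.
Implicit Types (A B I J K P Q M m : F -> Prop) (a b c q x y z : F).

(** Otherwise $A/(Q+xA)$ has the descending chain condition, so the symbolic powers of [Q'] modulo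
    [Q] stabilize modulo [x]. Since [x] is a unit in the localization at [Q'], they stabilize
    outright, and Krull's intersection theorem there puts a power of every element of [Q'] into
    [Q]. *)
Lemma krull_pit A m Q Q' x : noetherian A -> is_local A m -> is_prime A Q -> is_prime A Q' ->
  proper_subset Q Q' -> m x -> ~ Q' x ->
  ~ exists n, subset_of (idpow A m n) (addI Q (principal A x)).
Proof.
move=> hN hL hQ hQ' [hQQ' [w [hw nw]]] hx nx hn.
have hA := loc_sr hL; have hm := loc_id hL; have hxA := idS hm hx.
have hM := offset_ms hA hQ'; set M := offset A Q' in hM.
have hB := fracs_subring hA hM; have hBl := ext_local hA hQ'.
have hBN := fracs_noeth hA hM hN; have hBQ := ext_prime hA hQ' hQ hQQ'.
rewrite -/M in hBl hBQ; set B := fracs A M in hB hBl hBN hBQ.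
set n' := fracs Q' M in hBl; set QB := fracs Q M in hBQ.
have hn' := loc_id hBl; have hAB : subset_of A B := fracs_in hM (I := A).
(* the symbolic powers of [Q'] modulo [Q] *)
pose I k a := A a /\ addI QB (idpow B n' k) a.
have hIB k : is_ideal B (addI QB (idpow B n' k)).
  by apply: addI_ideal => //; [exact: prI hBQ|exact: idpow_ideal].
have hI k : is_ideal A (I k).
  have h := hIB k; split=> [q []//|||].
  - by split; mem.
  - by move=> a b [? ?] [? ?]; split; mem.
  - by move=> a b ha [? ?]; split; [mem|apply: (idM h) => //; apply: hAB].
have hdec k : subset_of (I k.+1) (I k).
  by move=> q [hq h]; split=> //; apply: addI_mono h => //; apply: idpow_le.
have hQI k : subset_of Q (I k).
  move=> q hq; split; first exact: (idS (prI hQ)).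
  by apply: (addI_l (idpow_ideal k hB hn')); apply: (fracs_in hM).
have hpx := principal_ideal hA hxA.
have hJ := addI_ideal hA (prI hQ) hpx.
have [|||k0 hk0] := dcc hN hL hJ hn (I := fun k => addI (I k) (principal A x)).
- by move=> k; apply: addI_ideal.
- by move=> k; apply: addI_mono.
- by move=> k; apply: addI_mono.
have xB : exists y, B y /\ x * y = 1.
  have x0 : x != 0 by apply/eqP => x0; apply: nx; rewrite x0; apply: (id0 (prI hQ')).
  by exists x^-1; split; [apply: (fracs_inv hA hM)|rewrite divff].
have stab k : (k0 <= k)%N -> subset_of (I k0) (I k).
  move=> hk; have hle : subset_of (I k) (I k0).
    move=> q [hq h]; split=> //; apply: addI_mono h => //; exact: idpow_le.
  (* In place of Nakayama's lemma, the inclusion of [I k0] in [I k + x * I k0] is iterated. The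
     cofactor of [x] stays in [I k0] because [x] is invertible in [B]. *)
  suff hpow n a : I k0 a -> exists r, I k0 r /\ addI (I k) (fun q => q = r * x ^+ n) a.
    move=> a ha; apply: (krull_intersection hN hL (hI k)) => n.
    have [r [[hr _] [u [_ [hu -> ->]]]]] := hpow n a ha.
    exists u, (r * x ^+ n); split=> //.
    by apply: (idM (idpow_ideal n hA hm)) => //; apply: idpow_exp.
  elim: n => [|n IH] ha.
    exists a; split=> //; exists 0, a; split; [exact: id0 (hI k)|by rewrite expr0 mulr1|by rewrite add0r].
  have [r [hr [u [_ [hu -> ->]]]]] := IH ha.
  have [b [_ [hb [s [hs ->]] e]]] := hk0 _ hk r (addI_l hpx hr).
  exists s; split.
    split=> //; have [y [hy exy]] := xB.
    have -> : s = y * (r - b) by rewrite e addrAC subrr add0r mulrA [y * x]mulrC exy mul1r.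
    apply: (idM (hIB k0)) => //; apply: (idB hB (hIB k0)); first by case: hr.
    by case: (hle _ hb).
  exists (u + b * x ^+ n), (s * x ^+ n.+1); split=> //; last by rewrite e exprS; ring.
  apply: (idD (hI k)) => //; apply: (idMr (hI k)) => //; mem.
apply: nw; apply: (prX (n := k0) hA hQ); first exact: (idS (prI hQ')).
have hwA : A w := idS (prI hQ') hw.
apply: (ext_contr hA hQ' hQ hQQ'); first by mem.
apply: (krull_intersection hBN hBl (prI hBQ)) => k.
have hwk : I k0 (w ^+ k0).
  split; first by mem.
  apply: (addI_r (prI hBQ)); apply: idpow_exp => //; exact: (fracs_in hM).
have [] := stab (maxn k0 k) (leq_maxl _ _) _ hwk => _ h.
by apply: addI_mono h => //; apply: idpow_le => //; apply: leq_maxr.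
Qed.

(** If there were no such prime, [P2] would be minimal over $P+xA$, and after localizing at [P2]
    some power of the maximal ideal would lie in $P+xA$, against [krull_pit]. *)
Lemma pit_between A P P1 P2 x : subring A -> noetherian A ->
  is_prime A P -> is_prime A P1 -> is_prime A P2 -> proper_subset P P1 -> subset_of P1 P2 ->
  P2 x -> ~ P1 x ->
  exists P', [/\ is_prime A P', subset_of P P', P' x & proper_subset P' P2].
Proof.
move=> hA hN hP hP1 hP2 hlt hle hx nx; apply: NNPP => hno.
have hPP2 : subset_of P P2 by move=> q /(proj1 hlt) /hle.
have hxA := idS (prI hP2) hx; have hpx := principal_ideal hA hxA.
have hJ := addI_ideal hA (prI hP) hpx.
(* A prime containing $P+xA$ and avoiding all products [s * p ^+ n] with [s] outside [P2] would lie
   inside [P2] and miss [p]. *)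
have hpow p : P2 p -> exists s n, offset A P2 s /\ addI P (principal A x) (s * p ^+ n).
  move=> hp; have hpA := idS (prI hP2) hp.
  apply: NNPP => hno'; apply: hno.
  have [| | |P' [hP' hJP' hdis]] := prime_avoiding (M := fun q => exists s n, offset A P2 s /\ q = s * p ^+ n) hA hN hJ.
  - exists 1, 0%N; split; last by rewrite mul1r.
    by split; [mem|exact: pr1 hP2].
  - move=> _ _ [s [n [hs ->]]] [t [k [ht ->]]]; exists (s * t), (n + k)%N; split; last by rewrite exprD; ring.
    by case: (offset_ms hA hP2) => _ _ _; apply.
  - by move=> w h [s [n [hs e]]]; apply: hno'; exists s, n; split=> //; rewrite -e.
  exists P'; split=> //.
  - by move=> q hq; apply: hJP'; apply: (addI_l hpx).
  - by apply: hJP'; apply: (addI_r (prI hP)); apply: principal_self.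
  split.
    move=> q hq; apply: NNPP => nq; apply: (hdis _ hq); exists q, 0%N.
    by rewrite mulr1; split=> //; split=> //; apply: (idS (prI hP')).
  exists p; split=> // hp'; apply: (hdis _ hp'); exists 1, 1%N; rewrite mul1r; split=> //.
  by split; [mem|exact: pr1 hP2].
have hM := offset_ms hA hP2; have hB := fracs_subring hA hM; have hBl := ext_local hA hP2.
have hAB := fracs_in hM (I := A).
apply: (@krull_pit (fracs A (offset A P2)) (fracs P2 (offset A P2)) (fracs P (offset A P2))
  (fracs P1 (offset A P2)) x) => //.
- exact: fracs_noeth.
- exact: ext_prime.
- exact: ext_prime.
- split; first by move=> _ [a [s [ha hs ->]]]; exists a, s; split=> //; apply: (proj1 hlt).
  have [_ [w [hw nw]]] := hlt; exists w; split; first exact: (fracs_in hM).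
  by move=> h; apply: nw; apply: (ext_contr hA hP2 hP hPP2) h; apply: (idS (prI hP1)).
- exact: (fracs_in hM).
- by move=> h; apply: nx; apply: (ext_contr hA hP2 hP1 hle) h.
apply: rad_pow => //; first exact: fracs_noeth.
- exact: loc_id hBl.
- apply: addI_ideal => //; first by apply: fracs_ideal => //; exact: prI.
  by apply: principal_ideal => //; apply: hAB.
move=> _ [p [t [hp ht ->]]].
have [s [n [hs [a [_ [ha [r [hr ->]] e]]]]]] := hpow p hp.
have s0 := ms_neq0 hM hs; have t0 := ms_neq0 hM ht.
have hst : offset A P2 (s * t ^+ n).
  case: hM => _ M1 _ MM; apply: (MM) => //; elim: n {e} => [|n IH]; first by rewrite expr0.
  by rewrite exprS; apply: MM.
exists n, (a / (s * t ^+ n)), (x * (r / (s * t ^+ n))); split.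
- by exists a, (s * t ^+ n).
- by exists (r / (s * t ^+ n)); split=> //; exists r, (s * t ^+ n).
- rewrite mulrA -mulrDl -e expr_div_n; apply/eqP.
  by rewrite eqr_div ?mulf_neq0 ?expf_neq0 //; apply/eqP; ring.
Qed.

Fixpoint pchain A k P := is_prime A P /\
  match k with 0%N => True | k'.+1 => exists P', proper_subset P P' /\ pchain A k' P' end.

Lemma pchain_prime A k P : pchain A k P -> is_prime A P. Proof. by case: k => [|k] []. Qed.

(** If the second prime [P1] misses [x], the induction hypothesis supplies a prime [P2] over [P1]
    containing [x], and [pit_between] exchanges [P1] for a prime that contains [x]. *)
Lemma pchain_through A m k P x : noetherian A -> is_local A m -> pchain A k.+1 P -> m x ->
  exists P', [/\ subset_of P P', P' x & pchain A k P'].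
Proof.
move=> hN hL + hx; have hA := loc_sr hL.
have pm Q : is_prime A Q -> subset_of Q m.
  by move=> hQ; apply: (loc_proper hL (prI hQ)); exact: pr1 hQ.
elim: k P => [|k IH] P [hP [P1 [hlt hch]]].
  by exists m; split; [exact: pm|by []|split=> //; exact: loc_prime].
have {}hch : pchain A k.+1 P1 by [].
have hP1 := pchain_prime hch.
case: (classic (P1 x)) => hx1; first by exists P1; split=> //; case: hlt.
have [P2 [h12 hx2 hch2]] := IH _ hch.
have [P' [hP' hPP' hx' hlt']] := pit_between hA hN hP hP1 (pchain_prime hch2) hlt h12 hx2 hx1.
by exists P'; split=> //; split=> //; exists P2.
Qed.

(** By [pchain_through], moving a generator into the bottom prime costs one step of the chain. *)
Lemma height_bound A m k P s : noetherian A -> is_local A m -> all_in m s -> pchain A k P ->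
  subset_of m (addI P (gen_ideal A s)) -> (k <= size s)%N.
Proof.
move=> hN hL; have hA := loc_sr hL.
elim: s k P => [|x s IH] [|k] P hs hch hm //.
  case: hch => hP [P1 [[hPP1 [w [hw nw]]] /pchain_prime hP1]]; exfalso; apply: nw.
  have /hm [p [g [hp /gen_nil -> ->]]] : m w.
    by apply: (loc_proper hL (prI hP1)) hw; exact: pr1 hP1.
  by rewrite addr0.
have hx : m x := hs 0%N isT.
have [P' [hPP' hx' hch']] := pchain_through hN hL hch hx.
have hP' := prI (pchain_prime hch').
rewrite /= ltnS; apply: (IH k P') => //; first by move=> i hi; apply: (hs i.+1).
move=> q /hm [p [g [/hPP' hp /gen_cons [a [r [ha hr ->]]] ->]]].
by exists (p + a * x), r; split=> //; [mem|ring].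
Qed.

End Height.

(** * Regular systems of parameters *)

Section Tower.
Variable F : fieldType.
Implicit Types (I J K P Q : F -> Prop) (a b c q x y z : F).
Variables (A m : F -> Prop).
Hypotheses (hN : noetherian A) (hL : is_local A m).
Let hA := loc_sr hL.
Let hm := loc_id hL.
Let hmp n := idpow_ideal n hA hm.

Lemma gen_consE x s : gen_ideal A (x :: s) = addI (principal A x) (gen_ideal A s).
Proof.
apply: set_ext => q; rewrite gen_cons; split.
  by case=> a [r [ha hr ->]]; exists (a * x), r; split=> //; exists a; rewrite mulrC.
by case=> _ [r [[a [ha ->]] hr ->]]; exists a, r; split=> //; rewrite mulrC.
Qed.

Lemma addIA I J K : addI (addI I J) K = addI I (addI J K).
Proof.
apply: set_ext => q; split.
  move=> [_ [c [[a [b [ha hb ->]]] hc ->]]]; exists a, (b + c); split=> //; last by rewrite addrA.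
  by exists b, c.
move=> [a [_ [ha [b [c [hb hc ->]]] ->]]]; exists (a + b), c; split=> //; last by rewrite addrA.
by exists a, b.
Qed.

(* For [P = 0] this says that [s] is a regular system of parameters of [A]. *)
Fixpoint tower P (s : seq F) := is_prime A P /\
  match s with
  | [::] => subset_of m P
  | x :: s' => [/\ m x, ~ P x & tower (addI P (principal A x)) s']
  end.

Lemma tower_prime P s : tower P s -> is_prime A P. Proof. by case: s => [|x s] []. Qed.

Lemma prime_sub_max P : is_prime A P -> subset_of P m.
Proof. by move=> hP; apply: (loc_proper hL (prI hP)); exact: pr1 hP. Qed.

Lemma all_in_sub s : all_in m s -> all_in A s.
Proof. by move=> h i hi; apply: (idS hm); apply: h. Qed.

Lemma tower_all_in P s : tower P s -> all_in m s.
Proof.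
elim: s P => [|x s IH] P //= [hP [hx nx ht]] [|i] //= hi.
exact: (IH _ ht).
Qed.

Lemma tower_gen P s : tower P s -> subset_of m (addI P (gen_ideal A s)).
Proof.
elim: s P => [|x s IH] P /= [hP].
  move=> h q /h hq; exists q, 0; split=> //; [exact/gen_nil|by rewrite addr0].
by case=> hx nx ht; rewrite gen_consE -addIA; apply: IH.
Qed.

(** In the graded ring of [A]: a form of degree [n] in [s] whose value falls into [P] is zero in
    degree [n]. *)
Definition quasi_regular P s := forall n w, idpow A (gen_ideal A s) n w -> P w -> idpow A m n.+1 w.
(** The degree one class of [x] is a nonzerodivisor on the associated graded ring of $A/P$. *)
Definition star P x := forall a n, A a -> addI P (idpow A m n.+1) (x * a) -> addI P (idpow A m n) a.

(** It suffices that $xa\in P+x\,m^n$, since [x] cancels modulo [P]. By Krull's intersection theorem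
    this may be shown modulo each $m^{n+1+k}$: the error splits into a multiple of [x] and a form in
    [s], and this form lies in $P+xA$, so quasi-regularity raises its order by one. *)
Lemma star_step P x s : is_prime A P -> m x -> ~ P x -> all_in m s ->
  subset_of m (addI (addI P (principal A x)) (gen_ideal A s)) ->
  quasi_regular (addI P (principal A x)) s -> star P x.
Proof.
move=> hP hx nx hs hgen hqr a n ha hxa; have hPI := prI hP; have hxA := idS hm hx.
have hg := gen_ideal_ideal hA (all_in_sub hs); have hpx := principal_ideal hA hxA.
set J := addI (principal A x) (gen_ideal A s).
have hJ : is_ideal A J := addI_ideal hA hpx hg.
have hJm : subset_of J m.
  apply: (addI_min hm); [exact: principal_min|exact: gen_min].
have hmJ k : subset_of (idpow A m k) (addI P (idpow A J k)).
  move=> q hq; apply: idpow_addI => //; move: q hq; apply: idpow_mono => //.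
    exact: addI_ideal.
  by rewrite -addIA.
pose X q := exists u, idpow A m n u /\ q = x * u.
have hX : is_ideal A X.
  split.
  - by move=> _ [u [hu ->]]; have ? := idS (hmp n) hu; mem.
  - by exists 0; split; [exact: id0 (hmp n)|rewrite mulr0].
  - by move=> _ _ [u [hu ->]] [v [hv ->]]; exists (u + v); split; [exact: (idD (hmp n))|ring].
  - by move=> c _ hc [u [hu ->]]; exists (c * u); split; [exact: (idM (hmp n))|ring].
have hI := addI_ideal hA hPI hX.
have [p [_ [hp [u [hu ->]] e]]] : addI P X (x * a).
  apply: (krull_intersection hN hL hI) => k.
  suff : addI (addI P X) (idpow A m (n.+1 + k)) (x * a).
    by apply: addI_mono => //; apply: idpow_le => //; rewrite leq_addl.
  elim: k => [|k [_ [w [[p0 [_ [hp0 [u0 [hu0 ->]] ->]]] hw e]]]].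
    by rewrite addn0; apply: addI_mono hxa => // q; apply: (addI_l hX).
  have [p' [j [hp' hj ew]]] := hmJ _ _ hw.
  have [u' [w' [hu' hw' ej]]] := idpow_cons hA hxA hg hj.
  have hu'm : idpow A m n u'.
    apply: (idpow_le (t := (n + k)%N)) => //; first exact: leq_addr.
    exact: (idpow_mono hA hm hJm).
  have hwP : addI P (principal A x) w'.
    have ? := idS (hmp n) hu0; have ? := idS (hmp n) hu'm.
    exists (- (p0 + p')), (x * (a - u0 - u')); split; first by mem.
      by exists (a - u0 - u'); split=> //; mem.
    have -> : w' = x * a - p0 - x * u0 - p' - x * u' by rewrite e ew ej; ring.
    by ring.
  have hw1 := hqr _ _ hw' hwP.
  exists (p0 + p' + x * (u0 + u')), w'; split; last by rewrite e ew ej; ring.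
    exists (p0 + p'), (x * (u0 + u')); split=> //; first by mem.
    by exists (u0 + u'); split=> //; apply: (idD (hmp n)).
  by rewrite addnS.
have huA := idS (hmp n) hu.
exists (a - u), u; split=> //; last by rewrite subrK.
have : P (x * (a - u)) by rewrite mulrBr e addrK.
by case/(prM hP hxA) => //; mem.
Qed.

(** Write $w=xu+w'$ with $w'$ a form in [s]. Modulo $P+xA$ the form $w'$ vanishes, so it has higher
    order; then [star] raises the order of [u] modulo [P], and induction on the degree removes the
    part of [u] in [P]. *)
Lemma quasi_regular_cons P x s : is_prime A P -> m x -> all_in m s -> star P x ->
  subset_of m (addI P (gen_ideal A (x :: s))) ->
  quasi_regular (addI P (principal A x)) s -> quasi_regular P (x :: s).
Proof.
move=> hP hx hs hst hgen hqr n; have hPI := prI hP; have hxA := idS hm hx.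
have hg := gen_ideal_ideal hA (all_in_sub hs); have hpx := principal_ideal hA hxA.
rewrite /quasi_regular gen_consE in hgen *.
set J := addI (principal A x) (gen_ideal A s) in hgen *.
have hJ : is_ideal A J := addI_ideal hA hpx hg.
have hJm : subset_of J m.
  apply: (addI_min hm); [exact: principal_min|exact: gen_min].
elim: n => [|n IH] w hw hPw; first by rewrite idpow1 //; apply: prime_sub_max hPw.
have [u [w' [hu hw' e]]] := idpow_cons hA hxA hg hw.
have huA : A u := idS (idpow_ideal n hA hJ) hu.
have hw1 : idpow A m n.+2 w'.
  apply: hqr => //; exists w, (x * (- u)); split=> //; last by rewrite e; ring.
  by exists (- u); split=> //; mem.
rewrite e; apply: (idD (hmp _)) => //.
have [p [v [hp hv eu]]] : addI P (idpow A m n.+1) u.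
  apply: hst => //; exists w, (- w'); split=> //; last by rewrite e addrK.
  exact: (idN hA (hmp _)).
rewrite mulrC; apply: idpowS_mul => //.
have [p' [j [hp' hj ev]]] : addI P (idpow A J n.+1) v.
  by apply: idpow_addI => //; move: hv; apply: idpow_mono => //; apply: addI_ideal.
have hjm := idpow_mono hA hm hJm hj.
have -> : u = (u - j) + j by rewrite subrK.
apply: (idD (hmp _)) => //; apply: IH; last by rewrite eu ev addrA addrK; mem.
apply: (idB hA (idpow_ideal n hA hJ)) => //.
by apply: (idpow_le (t := n.+1)).
Qed.

Lemma tower_quasi_regular P s : tower P s -> quasi_regular P s.
Proof.
elim: s P => [|x s IH] P ht.
  have e0 : gen_ideal A [::] = @zeroI F by apply: set_ext => q; apply: gen_nil.
  rewrite /quasi_regular e0.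
  have hz := prI (zero_prime hA); case: ht => hP _.
  case=> [|n] w hw hPw; first by rewrite idpow1 //; apply: prime_sub_max hPw.
  have -> : w = 0 by apply: (idpowS_ind hz _ hw) => u v _ ->; rewrite /zeroI mulr0.
  exact: id0 (hmp _).
have hgen := tower_gen ht; case: ht => hP [hx nx ht].
have hqr := IH _ ht; have hs := tower_all_in ht.
by apply: quasi_regular_cons => //; apply: (star_step (s := s)) => //; apply: tower_gen.
Qed.

Lemma tower_star P x s : tower P (x :: s) -> star P x.
Proof.
case=> hP [hx nx ht]; apply: (star_step hP hx nx (tower_all_in ht) (tower_gen ht)).
exact: tower_quasi_regular.
Qed.

(** The principal ideal theorem provides a prime $P'$ over $P+xA$ with a chain one shorter, so
    induction applies to $P'$. An element of $P'$ is, modulo $P+xA$, a form in [s] that lies in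
    $P'$; quasi-regularity over $P'$ makes its order arbitrarily large, hence $P'=P+xA$. *)
Lemma regular_tower P s : all_in m s -> subset_of m (addI P (gen_ideal A s)) ->
  pchain A (size s) P -> tower P s.
Proof.
elim: s P => [|x s IH] P hs hgen hch.
  split; first exact: pchain_prime hch.
  by move=> q /hgen [p [g [hp /gen_nil -> ->]]]; rewrite addr0.
have hx : m x := hs 0%N isT.
have hs' : all_in m s := fun i hi => hs i.+1 hi.
have hP := pchain_prime hch; have hxA := idS hm hx.
have [P' [hPP' hx' hch']] := pchain_through hN hL hch hx.
have hPI := prI hP.
have hP' := pchain_prime hch'; have hP'I := prI hP'.
have hpx := principal_ideal hA hxA.
have hgx : subset_of m (addI (addI P (principal A x)) (gen_ideal A s)).
  by rewrite addIA -gen_consE.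
have hle : subset_of (addI P (principal A x)) P'.
  by apply: (addI_min hP'I) => //; apply: principal_min.
have ht : tower P' s.
  by apply: IH => // q /hgx; apply: addI_mono.
split=> //; split=> //.
  move=> hPx; suff : (size (x :: s) <= size s)%N by rewrite /= ltnn.
  apply: (height_bound hN hL hs' hch) => q /hgx; apply: addI_mono => //.
  by apply: (addI_min hPI) => //; apply: principal_min.
suff <- : P' = addI P (principal A x) by [].
apply: set_ext => q; split; last exact: hle.
have hPx := addI_ideal hA hPI hpx.
have hg := gen_ideal_ideal hA (all_in_sub hs').
move=> hq; apply: (krull_intersection hN hL hPx) => n.
elim: n => [|n [r [w [hr hw e]]]].
  exists 0, q; split; [exact: id0 hPx|exact: (idS hP'I)|by rewrite add0r].
have [r' [j [hr' hj ew]]] : addI (addI P (principal A x)) (idpow A (gen_ideal A s) n) w.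
  by apply: idpow_addI => //; move: hw; apply: idpow_mono => //; apply: addI_ideal.
have hjP : P' j.
  have -> : j = q - r - r' by rewrite e ew; ring.
  have := hle _ hr; have := hle _ hr' => ? ?; mem.
exists (r + r'), j; split; last by rewrite e ew addrA.
  exact: (idD hPx).
exact: (tower_quasi_regular ht).
Qed.

(** The graded ring of $A/P$ is a domain. Modulo [x] this is the induction hypothesis, so the
    leading form of one factor is divisible by that of [x], and [star] cancels [x] to lower the
    total degree. *)
Lemma tower_gr_domain P s : tower P s -> forall k l a b,
  addI P (idpow A m k) a -> addI P (idpow A m l) b -> addI P (idpow A m (k + l).+1) (a * b) ->
  addI P (idpow A m k.+1) a \/ addI P (idpow A m l.+1) b.
Proof.
elim: s P => [|x s IH] P ht.
  case: ht => hP hmP; have hPI := prI hP => k l a b ha hb hab.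
  have hle k' q : P q -> addI P (idpow A m k') q by apply: addI_l; exact: hmp.
  have hin k' q : addI P (idpow A m k'.+1) q -> P q.
    move=> [p [j [hp hj ->]]]; apply: (idD hPI) => //; apply: hmP.
    by rewrite -[m](idpow1 hA hm); apply: idpow_le hj.
  have hAin k' q : addI P (idpow A m k') q -> A q.
    move=> [p [j [hp hj ->]]]; have ? := idS (hmp k') hj; mem.
  by case/(prM hP (hAin _ _ ha) (hAin _ _ hb)): (hin _ _ hab) => h; [left|right]; apply: hle.
have hst := tower_star ht; have [hP [hx nx ht']] := ht.
have hPI := prI hP; have hxA := idS hm hx; have hpx := principal_ideal hA hxA.
have hPm k := addI_ideal hA hPI (hmp k).
have hmx k q : addI P (idpow A m k) q -> addI P (idpow A m k.+1) (x * q).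
  move=> [p [j [hp hj ->]]]; exists (x * p), (j * x); split; [mem|exact: idpowS_mul|ring].
(* The case where the leading form of [a] vanishes modulo [x]. It is stated for one factor with the
   lower degree claim as a premise, so that the case of [b] follows by symmetry. *)
have main k : forall l a b, addI P (idpow A m k) a -> addI P (idpow A m l) b ->
    (forall k' l' a' b', k = k'.+1 -> l' = l -> addI P (idpow A m k') a' -> addI P (idpow A m l') b' ->
      addI P (idpow A m (k' + l').+1) (a' * b') ->
      addI P (idpow A m k'.+1) a' \/ addI P (idpow A m l'.+1) b') ->
    addI P (idpow A m (k + l).+1) (a * b) ->
    addI (addI P (principal A x)) (idpow A m k.+1) a ->
    addI P (idpow A m k.+1) a \/ addI P (idpow A m l.+1) b.
  move=> l a b ha hb IHk hab [_ [w [[p [_ [hp [a' [ha' ->]] ->]]] hw ea]]].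
  have hbA := idS (hPm l) hb.
  have h1 : addI P (idpow A m k.+1) (p + w) by exists p, w.
  case: k IHk ha hab hw ea h1 => [|k] IHk ha hab hw ea h1.
    left; rewrite ea addrAC; apply: (idD (hPm _)) => //.
    by apply: hmx; apply: (addI_r hPI).
  have ha1 : addI P (idpow A m k) a'.
    apply: hst => //; have -> : x * a' = a - (p + w) by rewrite ea; ring.
    apply: (idB hA (hPm _)) => //; apply: addI_mono h1 => //; exact: idpow_le.
  have hab' : addI P (idpow A m (k + l).+1) (a' * b).
    apply: hst; first by mem.
    have -> : x * (a' * b) = a * b - (p + w) * b by rewrite ea; ring.
    apply: (idB hA (hPm _)) => //; rewrite mulrDl.
    have [pb [wb [hpb hwb ->]]] := hb.
    exists (p * (pb + wb) + w * pb), (w * wb); split; last by ring.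
      have ? := idS (hmp _) hw; have ? := idS (hmp _) hwb; mem.
    by apply: (idpow_mul hA hm (s := k.+2)).
  case: (IHk k l a' b erefl erefl ha1 hb hab') => h; last by right.
  left; rewrite ea addrAC; apply: (idD (hPm _)) => //.
  exact: hmx.
suff H n k l a b : (k + l <= n)%N ->  addI P (idpow A m k) a -> addI P (idpow A m l) b ->
    addI P (idpow A m (k + l).+1) (a * b) ->
    addI P (idpow A m k.+1) a \/ addI P (idpow A m l.+1) b.
  by move=> k l a b; apply: (H (k + l)%N).
elim: n k l a b => [|n IHn] k l a b hkl ha hb hab.
all: have sub k' q : addI P (idpow A m k') q -> addI (addI P (principal A x)) (idpow A m k') q
  by apply: addI_mono => // q'; apply: (addI_l hpx).
all: have [h|h] := IH _ ht' _ _ _ _ (sub _ _ ha) (sub _ _ hb) (sub _ _ hab).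
- apply: main => // k' l' a' b' ek; lia.
- apply/or_comm; apply: main => //; last by rewrite addnC mulrC.
  by move=> k' l' a' b' ek; lia.
- apply: main => // k' l' a' b' ek el; apply: IHn; lia.
- apply/or_comm; apply: main => //; last by rewrite addnC mulrC.
  by move=> k' l' a' b' ek el; apply: IHn; lia.
Qed.

End Tower.

(** * Complete integral closedness of regular local rings *)

Section CompleteIntegralClosure.
Variable F : fieldType.
Implicit Types (I J K P Q : F -> Prop) (a b c q x y z : F).
Variables (A m : F -> Prop).
Hypotheses (hN : noetherian A) (hL : is_local A m).
Let hA := loc_sr hL.
Let hm := loc_id hL.

Definition cic_mod P := forall a b c, A a -> A b -> A c -> ~ P b -> ~ P c ->
  (forall n, addI P (principal A (b ^+ n)) (c * a ^+ n)) -> addI P (principal A b) a.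

Section Step.
Variables (P : F -> Prop) (x : F).
Hypotheses (hP : is_prime A P) (hx : m x) (nx : ~ P x).
Let P1 := addI P (principal A x).
Hypotheses (hP1 : is_prime A P1) (cicP1 : cic_mod P1).
Let hPI := prI hP.
Let hxA := idS hm hx.
Let D y q := addI P (principal A y) q.

Let hD y : A y -> is_ideal A (D y).
Proof. by move=> hy; apply: addI_ideal => //; apply: principal_ideal. Qed.

Let DP y q : A y -> P q -> D y q.
Proof. by move=> hy; apply: addI_l; apply: principal_ideal. Qed.

Let Dmul y s : A s -> D y (y * s).
Proof. by move=> hs; apply: (addI_r hPI); exists s. Qed.

Let exp_neq n : ~ P (x ^+ n). Proof. by move=> /(prX hA hP hxA). Qed.

Let powP1 b n : A b -> ~ P1 b -> ~ P1 (b ^+ n).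
Proof. by move=> hb nb /(prX hA hP1 hb). Qed.

Let cancel y w r : A y -> A w -> A r -> ~ P y -> D (y * w) (y * r) -> D w r.
Proof.
move=> hy hw hr ny [p [_ [hp [s [hs ->]] e]]].
exists (r - w * s), (w * s); split; [|by exists s|by rewrite subrK].
have : P (y * (r - w * s)) by rewrite mulrBr e -mulrA addrK.
by case/(prM hP hy) => //; mem.
Qed.

(** [b] is a nonzerodivisor modulo [x], hence modulo every power of [x]. *)
Let xdiv b r k : A b -> ~ P1 b -> A r -> D (x ^+ k) (b * r) -> D (x ^+ k) r.
Proof.
move=> hb nb; elim: k r => [|k IH] r hr hD'.
  by rewrite expr0 -[r]mul1r; apply: Dmul.
have : P1 (b * r).
  case: hD' => p [_ [hp [s [hs ->]] ->]]; exists p, (x ^+ k.+1 * s); split=> //.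
  by exists (x ^+ k * s); split; [mem|rewrite exprS mulrA].
case/(prM hP1 hb hr) => // -[p' [_ [hp' [r' [hr' ->]] er]]].
have hxk : A (x ^+ k) by mem.
have h : D (x ^+ k) (b * r').
  apply: (cancel hxA) => //; first by mem.
  rewrite -exprS; have -> : x * (b * r') = b * r - b * p' by rewrite er; ring.
  apply: (idB hA (hD _)) => //; first by mem.
  by apply: DP; mem.
have [p2 [_ [hp2 [s [hs ->]] er']]] := IH _ hr' h.
exists (p' + x * p2), (x ^+ k.+1 * s); split; [mem|by exists s|].
by rewrite er er' exprS; ring.
Qed.

Let xinf c : A c -> (forall n, D (x ^+ n) c) -> P c.
Proof.
move=> hc h; apply: (krull_intersection hN hL hPI) => n.
have [p [_ [hp [s [hs ->]] ->]]] := h n; exists p, (x ^+ n * s); split=> //.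
by apply: (idMr (idpow_ideal n hA hm)) => //; apply: idpow_exp.
Qed.

Let xfact c : A c -> ~ P c -> exists e c', [/\ A c', ~ P1 c' & P (c - x ^+ e * c')].
Proof.
move=> hc nc; have [n hn] : exists n, ~ D (x ^+ n) c.
  by apply: NNPP => h; apply: nc; apply: xinf => // n; apply: NNPP => hn; apply: h; exists n.
elim: n hn => [|n IH] hn.
  by case: hn; rewrite expr0 -[c]mul1r; apply: Dmul.
case: (classic (D (x ^+ n) c)) => // -[p [_ [hp [s [hs ->]] e]]].
exists n, s; split=> //; last by rewrite e addrK.
case=> p' [_ [hp' [s' [hs' ->]] es]]; apply: hn.
exists (p + x ^+ n * p'), (x ^+ n.+1 * s'); split; [|by exists s'|by rewrite e es exprSr; ring].
have hxn : A (x ^+ n) by mem.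
    by mem.
Qed.

Let congX u v n : A u -> A v -> P (u - v) -> P (u ^+ n - v ^+ n).
Proof.
move=> hu hv h; rewrite subrXX; apply: (idMr hPI) => //.
by apply: sr_sum => // i _; mem.
Qed.

Let H a b c := forall n, D (b ^+ n) (c * a ^+ n).

(** The case of [P1] gives $a\equiv br+xa'$. Expanding $c(a-br)^n$ shows that $b^n$ divides
    $x^nca'^n$ modulo [P]; by [xdiv] the cofactor is divisible by $x^n$, so $x^n$ cancels and $a'$
    inherits the hypothesis. *)
Let step a b c : A a -> A b -> A c -> ~ P1 b -> ~ P1 c -> H a b c ->
  exists r a', [/\ A r, A a', P (a - (b * r + x * a')) & H a' b c].
Proof.
move=> ha hb hc nb nc h.
have [|_ [_ [[p [_ [hp [t [ht ->]] ->]]] [r [hr ->]] e]]] := cicP1 ha hb hc nb nc.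
  move=> n; apply: addI_mono (h n) => // q; apply: addI_l; exact: principal_ideal.
have hpA := idS hPI hp.
exists r, t; split=> //; first by rewrite (_ : a - _ = p) // e; ring.
move=> n; have hbn : A (b ^+ n) by mem.
have h1 : D (b ^+ n) (c * (a - b * r) ^+ n).
  rewrite exprBn mulr_sumr; apply: (id_sum _ (hD hbn)) => i _.
  have [pi [_ [hpi [si [hsi ->]] ei]]] := h (n - i)%N.
  have -> : c * ((-1) ^+ i * a ^+ (n - i) * (b * r) ^+ i *+ 'C(n, i))
     = (c * a ^+ (n - i)) * ((-1) ^+ i * (b * r) ^+ i * 'C(n, i)%:R).
    by rewrite -mulr_natr; ring.
  have hu : A ((-1) ^+ i * 'C(n, i)%:R) by mem.
  exists (pi * ((-1) ^+ i * (b * r) ^+ i * 'C(n, i)%:R)), (b ^+ n * (si * r ^+ i * ((-1) ^+ i * 'C(n, i)%:R))); split.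
  - by mem.
  - by exists (si * r ^+ i * ((-1) ^+ i * 'C(n, i)%:R)); split=> //; mem.
  - have le : (i <= n)%N by rewrite -ltnS.
    by rewrite ei -[in b ^+ n](subnK le) exprD exprMn; ring.
have h2 : D (b ^+ n) (x ^+ n * (c * t ^+ n)).
  have -> : x ^+ n * (c * t ^+ n) = c * (a - b * r) ^+ n - c * ((a - b * r) ^+ n - (x * t) ^+ n).
    by rewrite exprMn; ring.
  apply: (idB hA (hD hbn)) => //; apply: DP => //.
  have : P ((a - b * r) ^+ n - (x * t) ^+ n).
    by apply: congX; [mem|mem|rewrite (_ : _ - _ = p) // e; ring].
  by move=> ?; mem.
have [p2 [_ [hp2 [s [hs ->]] e2]]] := h2.
have hxn : A (x ^+ n) by mem.
have [p3 [_ [hp3 [s' [hs' ->]] e3]]] : D (x ^+ n) s.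
  apply: (@xdiv (b ^+ n)) => //; first exact: powP1.
  exists (- p2), (x ^+ n * (c * t ^+ n)); split; [mem| |by rewrite e2; ring].
  by exists (c * t ^+ n); split=> //; mem.
exists (c * t ^+ n - b ^+ n * s'), (b ^+ n * s'); split; [|by exists s'|by rewrite subrK].
have : P (x ^+ n * (c * t ^+ n - b ^+ n * s')).
  rewrite mulrBr e2 e3; have -> : p2 + b ^+ n * (p3 + x ^+ n * s') - x ^+ n * (b ^+ n * s') = p2 + b ^+ n * p3 by ring.
  by mem.
by case/(prM hP hxn) => //; [mem|move/(@exp_neq n)].
Qed.

(** Iterating [step] writes [a] as a multiple of [b] up to $x^na'$, for every [n]. *)
Let main1 a b c : A a -> A b -> A c -> ~ P1 b -> ~ P1 c -> H a b c -> D b a.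
Proof.
move=> ha hb hc nb nc h.
apply: (krull_intersection hN hL (hD hb)) => n.
have [r [a' [hr ha' hp _]]] : exists r a', [/\ A r, A a', P (a - (b * r + x ^+ n * a')) & H a' b c].
  elim: n => [|n [r [a' [hr ha' hp h']]]].
    by exists 0, a; split=> //; [mem|rewrite mulr0 add0r expr0 mul1r subrr; mem].
  have [r' [a2 [hr' ha2 hp' h2]]] := step ha' hb hc nb nc h'.
  exists (r + x ^+ n * r'), a2; split=> //; first by mem.
  rewrite (_ : a - _ = (a - (b * r + x ^+ n * a')) + x ^+ n * (a' - (b * r' + x * a2))).
    have hxn : A (x ^+ n) by mem.
    by mem.
  by rewrite exprS; ring.
exists (a - (b * r + x ^+ n * a') + b * r), (x ^+ n * a'); split; last by ring.
  by apply: (idD (hD hb)); [exact: DP|exact: Dmul].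
by apply: (idMr (idpow_ideal n hA hm)) => //; apply: idpow_exp.
Qed.

Let main2 a b c : A a -> A b -> A c -> ~ P1 b -> ~ P c -> H a b c -> D b a.
Proof.
move=> ha hb hc nb nc h; have [e [c' [hc' nc' hcc]]] := xfact hc nc.
apply: (main1 ha hb hc') => // n.
have [p [_ [hp [s [hs ->]] e1]]] := h n.
have hbn : A (b ^+ n) by mem. have hxe : A (x ^+ e) by mem. have han : A (a ^+ n) by mem.
have [p3 [_ [hp3 [s' [hs' ->]] e3]]] : D (x ^+ e) s.
  apply: (@xdiv (b ^+ n)) => //; first exact: powP1.
  exists ((c - x ^+ e * c') * a ^+ n - p), (x ^+ e * (c' * a ^+ n)); split.
  - by mem.
  - by exists (c' * a ^+ n); split=> //; mem.
  - have -> : b ^+ n * s = c * a ^+ n - p by rewrite e1; ring.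
    by ring.
exists (c' * a ^+ n - b ^+ n * s'), (b ^+ n * s'); split; [|by exists s'|by rewrite subrK].
have : P (x ^+ e * (c' * a ^+ n - b ^+ n * s')).
  have -> : x ^+ e * (c' * a ^+ n - b ^+ n * s') = p + b ^+ n * p3 - (c - x ^+ e * c') * a ^+ n.
    have -> : p = c * a ^+ n - b ^+ n * s by rewrite e1 addrK.
    by rewrite e3; ring.
  by mem.
by case/(prM hP hxe) => //; [mem|move/(@exp_neq e)].
Qed.

(** Write $b\equiv x^sb'$ and use induction on [s]. If [x] divides [a], cancel it on both sides; if
    not, $x^n$ divides $ca^n$ and hence [c] for all [n], which would put [c] into [P]. *)
Lemma cic_step : cic_mod P.
Proof.
move=> a b c ha hb hc nb nc h.
have [s [b' [hb' nb' hbb]]] := xfact hb nb.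
have hB : A (x ^+ s * b') by mem.
suff [p [_ [hp [r [hr ->]] e]]] : D (x ^+ s * b') a.
  exists (p - (b - x ^+ s * b') * r), (b * r); split; [mem|by exists r|by rewrite e; ring].
have {}h : H a (x ^+ s * b') c.
  move=> n; have [p [_ [hp [r [hr ->]] e]]] := h n.
  exists (p + (b ^+ n - (x ^+ s * b') ^+ n) * r), ((x ^+ s * b') ^+ n * r); split.
  - by have ? := congX n hb hB hbb; mem.
  - by exists r.
  - by rewrite e; ring.
elim: s {b hb nb hbb hB} a ha h => [|s IH] a ha h.
  by rewrite expr0 mul1r in h *; apply: main2 h.
case: (classic (P1 a)) => [[p [_ [hp [a' [ha' ->]] e]]]|na].
  have hw : A (x ^+ s * b') by mem.
  have [p' [_ [hp' [r [hr ->]] e']]] : D (x ^+ s * b') a'.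
    apply: IH => // n.
    have hxn : A (x ^+ n) by mem. have han : A (a' ^+ n) by mem.
    apply: (cancel hxn) => //; [mem|mem|].
    have -> : x ^+ n * (x ^+ s * b') ^+ n = (x ^+ s.+1 * b') ^+ n by rewrite -exprMn exprS mulrA.
    have -> : x ^+ n * (c * a' ^+ n) = c * a ^+ n - c * (a ^+ n - (x * a') ^+ n) by rewrite exprMn; ring.
    have hw' : A ((x ^+ s.+1 * b') ^+ n) by mem.
    apply: (idB hA (hD hw')) => //; apply: DP => //.
    have : P (a ^+ n - (x * a') ^+ n) by apply: congX => //; [mem|rewrite e addrK].
    by move=> ?; mem.
  exists (p + x * p'), (x ^+ s.+1 * b' * r); split; [mem|by exists r|by rewrite e e' exprS; ring].
case: nc; apply: xinf => // n; apply: (@xdiv (a ^+ n)) => //; [mem|exact: powP1|].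
have [p [_ [hp [r [hr ->]] e]]] := h n.
rewrite mulrC e; exists p, (x ^+ n * ((x ^+ s * b') ^+ n * r)); split=> //.
  by exists ((x ^+ s * b') ^+ n * r); split=> //; mem.
by rewrite exprS !exprMn; ring.
Qed.

End Step.

Lemma tower_cic P s : tower A m P s -> cic_mod P.
Proof.
elim: s P => [|x s IH] P /= [hP].
  move=> hmP a b c ha hb hc nb nc _.
  have [|y [hy e]] := loc_unit hL hb; first by move/hmP.
  apply: (addI_r (prI hP)); exists (y * a); split; first by mem.
  by rewrite mulrA e mul1r.
case=> hx nx ht; apply: (cic_step hP hx nx (tower_prime ht)); exact: IH.
Qed.

End CompleteIntegralClosure.

Arguments idpow : simpl never.

(** * Independence of the monomials in a system of parameters *)

Section Forms.
Variable F : fieldType.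
Implicit Types (I J K P Q : F -> Prop) (a b c q x y z : F).
Variables (A m : F -> Prop).
Hypotheses (hN : noetherian A) (hL : is_local A m).
Let hA := loc_sr hL.
Let hm := loc_id hL.
Let hmp n := idpow_ideal n hA hm.
Variable s : seq F.
Local Notation d := (size s).
Implicit Types (al be : 'X_{1..d}).

Let v (i : 'I_d) := s`_i.
Let mval al := \prod_i v i ^+ al i.

Lemma idpow_prod (T : Type) (r : seq T) (f : T -> F) (e : T -> nat) :
  (forall i, m (f i)) -> idpow A m (\sum_(i <- r) e i)%N (\prod_(i <- r) f i ^+ e i).
Proof.
move=> hf; elim: r => [|i r IH]; first by rewrite !big_nil; apply: (sr1 hA).
by rewrite !big_cons; apply: idpow_mul => //; apply: idpow_exp.
Qed.

Lemma mval_pow al : all_in m s -> idpow A m (mdeg al) (mval al).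
Proof. by move=> hs; rewrite mdegE; apply: idpow_prod => i; apply: hs. Qed.

Lemma mvalU al i : (0 < al i)%N -> mval al = v i * mval (al - U_(i))%MM.
Proof.
move=> hi; rewrite /mval (bigD1 i) //= [in RHS](bigD1 i) //= mnmBE mnm1E eqxx mulrA -exprS subn1 prednK //.
congr (_ * _); apply: eq_bigr => j hj; rewrite mnmBE mnm1E eq_sym (negbTE hj) subn0 //.
Qed.

(* The monomials involving one of the first [i] variables already lie in [P]. *)
Lemma tower_coef k i P : (i + k = d)%N -> tower A m P (drop i s) -> all_in m s ->
  (forall j, (j < i)%N -> P s`_j) ->
  forall e (r : seq 'X_{1..d}) (c : 'X_{1..d} -> F), uniq r -> (forall al, al \in r -> mdeg al = e) ->
  (forall al, A (c al)) -> addI P (idpow A m e.+1) (\sum_(al <- r) c al * mval al) ->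
  forall al, al \in r -> (forall j : 'I_d, (j < i)%N -> al j = 0%N) -> m (c al).
Proof.
move=> + + hs; elim: k i P => [|k IHk] i P hik ht hPs.
  have ei : i = d by rewrite -hik addn0.
  have hP := tower_prime ht.
  move=> e r c hu hdeg hc hsum al hal h0.
  have al0 : mdeg al = 0%N by rewrite mdegE big1 // => j _; apply: h0; rewrite ei.
  have e0 : e = 0%N by rewrite -(hdeg _ hal).
  have rr be : be \in r -> be = al.
    move=> hbe; have := hdeg _ hbe; rewrite e0 => /eqP; rewrite mdeg_eq0 => /eqP ->.
    by move/eqP: al0; rewrite mdeg_eq0 => /eqP ->.
  move: hsum; rewrite (bigD1_seq al) //= big1_seq ?addr0; last first.
    by move=> be /andP [hne /rr hbe]; rewrite hbe eqxx in hne.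
  have -> : mval al = 1.
    by rewrite /mval big1 // => j _; rewrite h0 ?expr0 // ei.
  rewrite mulr1 e0 idpow1 // => -[p [w [hp hw ->]]].
  by have := prime_sub_max hL hP hp => ?; mem.
have hi : (i < d)%N by rewrite -hik addnS ltnS leq_addr.
rewrite (drop_nth 0 hi) in ht; set x := s`_i in ht.
have hst := tower_star hN hL ht; have [hP [hx nx ht']] := ht.
have hPI := prI hP; have hxA := idS hm hx; have hpx := principal_ideal hA hxA.
have hPe n := addI_ideal hA hPI (hmp n).
pose io := Ordinal hi.
have hmv al : A (mval al) := idS (hmp _) (mval_pow al hs).
elim=> [|e IHe] r c hu hdeg hc hsum.
(* Monomials that also avoid the variable [i] are handled by the rest of the tower, over $P+xA$. *)
all: have hout al : al \in r -> (forall j : 'I_d, (j <= i)%N -> al j = 0%N) -> m (c al).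
1,3: move=> hal h0; apply: (IHk i.+1 _ _ ht' _ _ r c hu hdeg hc _ al hal h0);
  [by rewrite addSnnS|
   by move=> j; rewrite ltnS leq_eqVlt => /orP [/eqP ->|hj];
     [apply: (addI_r hPI); apply: principal_self|apply: (addI_l hpx); apply: hPs]|
   by apply: addI_mono hsum => // q; exact: (addI_l hpx)].
all: move=> al hal h0.
  apply: hout => // j _; have := hdeg _ hal; move/eqP; rewrite mdeg_eq0 => /eqP ->.
  by rewrite mnmE.
have [hi0|hi0] := posnP (al io).
  apply: hout => // j; rewrite leq_eqVlt => /orP [/eqP ej|]; last exact: h0.
  by rewrite (_ : j = io) //; apply: val_inj.
(* The monomials outside [G] contribute nothing modulo $P+m^{e+2}$: they lie in [P] or have a
   coefficient in [m] by [hout]. Those in [G] are divisible by [x], which [tower_star] cancels. *)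
pose G be := [forall j : 'I_d, (j < i)%N ==> (be j == 0%N)] && (0 < be io)%N.
have hsumG : addI P (idpow A m e.+2) (\sum_(be <- r | G be) c be * mval be).
  have -> : \sum_(be <- r | G be) c be * mval be =
     \sum_(be <- r) c be * mval be - \sum_(be <- r | ~~ G be) c be * mval be.
    by rewrite [X in _ = X - _](bigID G) /= addrK.
  apply: (idB hA (hPe _)) => //; rewrite big_seq_cond; apply: (id_sum _ (hPe _)) => be /andP [hbe].
  rewrite negb_and => hG.
  case: (boolP [forall j : 'I_d, (j < i)%N ==> (be j == 0%N)]) hG => /= [hf|].
    rewrite -eqn0Ngt => /eqP hbi; apply: (addI_r hPI).
    rewrite mulrC; apply: idpowS_mul; first by rewrite -(hdeg _ hbe); apply: mval_pow.
    apply: hout => // j; rewrite leq_eqVlt => /orP [/eqP ej|hj].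
      by rewrite (_ : j = io) //; apply: val_inj.
    by apply/eqP; move/forallP/(_ j)/implyP: hf; apply.
  move=> /forallPn [j]; rewrite negb_imply => /andP [hj hbj] _.
  apply: (addI_l (hmp _)); apply: (idM hPI) => //.
  rewrite (@mvalU be j) ?lt0n //; apply: (idMr hPI) => //; exact: hPs.
pose r' := [seq (be - U_(io))%MM | be <- r & G be].
have hle be : (0 < be io)%N -> (U_(io) <= be)%MM.
  by move=> h; apply/mnm_lepP => j; rewrite mnm1E; case: eqP => // <-.
have -> : al = (al - U_(io) + U_(io))%MM by rewrite submK //; apply: hle.
apply: (IHe r' (fun be => c (be + U_(io))%MM)).
- rewrite map_inj_in_uniq ?filter_uniq // => be be'; rewrite !mem_filter.
  move=> /andP [/andP [_ h1] _] /andP [/andP [_ h2] _] h3.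
  by rewrite -(submK (hle _ h1)) h3 submK //; apply: hle.
- move=> be /mapP [be' + ->]; rewrite mem_filter => /andP [/andP [_ h1] h2].
  by have := hdeg _ h2; rewrite -{1}(submK (hle _ h1)) mdegD mdeg1 addn1 => -[].
- by move=> be.
- apply: hst; first by apply: sr_sum => // be _; have := hc (be + U_(io))%MM => ?; have := hmv be => ?; mem.
  rewrite big_map big_filter mulr_sumr.
  rewrite (eq_bigr (fun be => c be * mval be)) // => be /andP [_ h].
  by rewrite submK ?hle // (mvalU h) mulrCA.
- by apply/mapP; exists al => //; rewrite mem_filter hal andbT /G hi0 andbT; apply/forallP => j; apply/implyP => hj; rewrite h0.
- by move=> j hj; rewrite mnmBE h0.
Qed.
End Forms.

(** * Orders under a quadratic transform *)

Section PolyCoef.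
Variables (F : fieldType) (d : nat).
Implicit Types (p q : {mpoly F[d]}) (al be ga : 'X_{1..d}) (A I K : F -> Prop).

Lemma mcoeffM_ind K p q al : K 0 -> (forall a b, K a -> K b -> K (a + b)) ->
  (forall be ga, (be + ga)%MM = al -> K (p@_be * q@_ga)) -> K (p * q)@_al.
Proof.
move=> K0 KD h; rewrite mcoeffM; apply: (big_ind K) => // k /eqP e.
exact: h.
Qed.

Definition coefs_in K p := forall al, K p@_al.

Lemma coefs_inM A p q : subring A -> coefs_in A p -> coefs_in A q -> coefs_in A (p * q).
Proof.
move=> hA hp hq al; apply: mcoeffM_ind; [mem|by move=> *; mem|].
by move=> be ga _; apply: (srM hA).
Qed.
Lemma coefs_in_sum A I (T : Type) (r : seq T) (f : T -> {mpoly F[d]}) : is_ideal A I ->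
  (forall i, coefs_in I (f i)) -> coefs_in I (\sum_(i <- r) f i).
Proof.
move=> hI h al; elim: r => [|i r IH]; first by rewrite big_nil mcoeff0; mem.
by rewrite big_cons mcoeffD; apply: (idD hI) => //; apply: h.
Qed.
Lemma coefs_inC A c : subring A -> A c -> coefs_in A c%:MP.
Proof. by move=> hA hc al; rewrite mcoeffC; apply: (srM hA) => //; mem. Qed.
Lemma coefs_inX A al : subring A -> coefs_in A 'X_[al].
Proof. by move=> hA be; rewrite mcoeffX; mem. Qed.
Lemma coefs_inD A p q : subring A -> coefs_in A p -> coefs_in A q -> coefs_in A (p + q).
Proof. by move=> hA hp hq al; rewrite mcoeffD; apply: (srD hA). Qed.
Lemma coefs_in_exp A p n : subring A -> coefs_in A p -> coefs_in A (p ^+ n).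
Proof.
move=> hA hp; elim: n => [|n IH]; first by rewrite expr0; apply: coefs_inC => //; mem.
by rewrite exprS; apply: coefs_inM.
Qed.
Lemma coefs_in_prod A (T : Type) (r : seq T) (f : T -> {mpoly F[d]}) : subring A ->
  (forall i, coefs_in A (f i)) -> coefs_in A (\prod_(i <- r) f i).
Proof.
move=> hA h; elim: r => [|i r IH]; first by rewrite big_nil; apply: coefs_inC => //; mem.
by rewrite big_cons; apply: coefs_inM.
Qed.

Lemma coefs_in_comp A I p (lq : d.-tuple {mpoly F[d]}) : subring A -> is_ideal A I ->
  coefs_in I p -> (forall i, coefs_in A (tnth lq i)) -> coefs_in I (p \mPo lq).
Proof.
move=> hA hI hp hq; rewrite comp_mpolyE; apply: (coefs_in_sum _ hI) => be al.
rewrite mcoeffZ; apply: (idMr hI) => //.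
by apply: coefs_in_prod => // i; apply: coefs_in_exp.
Qed.

Definition deg_le n p := forall al, (n < mdeg al)%N -> p@_al = 0.

Lemma deg_leM n k p q : deg_le n p -> deg_le k q -> deg_le (n + k) (p * q).
Proof.
move=> hp hq al hal; apply: (@mcoeffM_ind (fun c => c = 0)) => //.
  by move=> a b -> ->; rewrite addr0.
move=> be ga e; move: hal; rewrite -e mdegD => hal.
case: (ltnP n (mdeg be)) => h; first by rewrite hp ?mul0r.
by rewrite hq ?mulr0 //; lia.
Qed.
Lemma deg_le_exp n p k : deg_le n p -> deg_le (n * k) (p ^+ k).
Proof.
move=> hp; elim: k => [|k IH]; last by rewrite exprS mulnS; apply: deg_leM.
move=> al; rewrite expr0 muln0 mcoeff1; case: eqP => [->|//]; by rewrite mdeg0.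
Qed.
Lemma deg_le_prod (T : Type) (r : seq T) (f : T -> {mpoly F[d]}) (e : T -> nat) :
  (forall i, deg_le (e i) (f i)) -> deg_le (\sum_(i <- r) e i) (\prod_(i <- r) f i).
Proof.
move=> h; elim: r => [|i r IH]; last by rewrite !big_cons; apply: deg_leM.
move=> al; rewrite !big_nil mcoeff1; case: eqP => [->|//]; by rewrite mdeg0.
Qed.

Lemma mcoeff0_meval p : p@_0%MM = p.@[fun=> 0].
Proof.
elim/mpolyind: p => [|c be p _ _ IH]; first by rewrite mcoeff0 meval0.
rewrite mcoeffD mevalD IH mcoeffZ mevalZ mcoeffX mevalX; congr (_ * _ + _).
case: eqP => [->|ne]; first by rewrite big1 // => i _; rewrite mnmE expr0.
have /forallPn [i hi] : ~~ [forall i, be i == 0%N].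
  by apply/forallP => h; apply: ne; apply/mnmP => i; rewrite mnmE; apply/eqP.
by rewrite (bigD1 i) //= expr0n (negbTE hi) mul0r.
Qed.

End PolyCoef.

Section Translation.
Variables (F : fieldType) (d : nat) (y : 'I_d -> F).
Implicit Types (p q : {mpoly F[d]}).

Definition trl p := p \mPo [tuple 'X_i + (y i)%:MP | i < d].

Lemma trlM p q : trl (p * q) = trl p * trl q.
Proof. exact: rmorphM. Qed.
Lemma trlD p q : trl (p + q) = trl p + trl q.
Proof. exact: rmorphD. Qed.

Lemma trl_const p : (trl p)@_0%MM = p.@[y].
Proof.
rewrite mcoeff0_meval comp_mpoly_meval; apply: meval_eq => i.
by rewrite tnth_mktuple mevalD mevalXU mevalC add0r.
Qed.

Lemma trlK p : trl p \mPo [tuple 'X_i - (y i)%:MP | i < d] = p.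
Proof.
elim/mpolyind: p => [|c be p _ _ IH]; first by rewrite /trl !comp_mpoly0.
rewrite trlD comp_mpolyD IH /trl !comp_mpolyZ; congr (_ *: _ + _).
rewrite comp_mpolyX rmorph_prod [RHS]mpolyXE_id; apply: eq_bigr => i _.
rewrite rmorphXn /= tnth_mktuple comp_mpolyD comp_mpolyC comp_mpolyXU.
by rewrite -tnth_nth tnth_mktuple subrK.
Qed.

Lemma trl_coefs A I p : subring A -> is_ideal A I -> (forall i, A (y i)) ->
  coefs_in I p -> coefs_in I (trl p).
Proof.
move=> hA hI hy hp; apply: (coefs_in_comp hA hI hp) => i; rewrite tnth_mktuple.
by apply: coefs_inD => //; [exact: coefs_inX|exact: coefs_inC].
Qed.

Lemma trl_coefs_inv A I p : subring A -> is_ideal A I -> (forall i, A (y i)) ->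
  coefs_in I (trl p) -> coefs_in I p.
Proof.
move=> hA hI hy hp; rewrite -[p]trlK; apply: (coefs_in_comp hA hI hp) => i; rewrite tnth_mktuple.
by rewrite -mpolyCN; apply: coefs_inD => //; [exact: coefs_inX|apply: coefs_inC => //; apply: (srN hA)].
Qed.

Lemma trl_deg p e : p \is e.-homog -> deg_le e (trl p).
Proof.
move=> /dhomogP hp al hal; rewrite /trl comp_mpolyE raddf_sum big_seq big1 // => be hbe.
rewrite /= mcoeffZ; set pr := bigop _ _ _.
suff -> : pr@_al = 0 by rewrite mulr0.
have hdeg : mdeg be = e := hp _ hbe.
have : deg_le (\sum_i be i) (\prod_(i < d) (tnth [tuple 'X_i + (y i)%:MP | i < d] i) ^+ be i).
  apply: deg_le_prod => i; rewrite -[X in deg_le X](mul1n (be i)); apply: deg_le_exp.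
  rewrite tnth_mktuple => ga hga; rewrite mcoeffD mcoeffX mcoeffC.
  case: eqP => [e1|_]; first by rewrite -e1 mdeg1 in hga.
  case: eqP => [e1|_]; first by rewrite e1 mdeg0 in hga.
  by rewrite mulr0 addr0.
by apply; rewrite -mdegE hdeg.
Qed.

End Translation.

Section OrderDrop.
Variable F : fieldType.
Implicit Types (a b c x z t : F).
Variables (A m : F -> Prop).
Hypotheses (hN : noetherian A) (hL : is_local A m).
Let hA := loc_sr hL.
Let hm := loc_id hL.
Let hmp n := idpow_ideal n hA hm.
Variable s : seq F.
Local Notation d := (size s).
Hypothesis htw : tower A m (@zeroI F) s.
Let v (i : 'I_d) := s`_i.
Let hs := tower_all_in htw.
Implicit Types (G H U p q : {mpoly F[d]}).

Let m_gen : subset_of m (gen_ideal A s).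
Proof.
move=> q /(tower_gen htw); rewrite (@addI_zero _ A) //.
by apply: gen_ideal_ideal => //; apply: (all_in_sub hL).
Qed.

Lemma form_coef G e : G \is e.-homog -> coefs_in A G -> idpow A m e.+1 G.@[v] -> coefs_in m G.
Proof.
move=> /dhomogP hG hc hv al; case: (boolP (al \in msupp G)) => hal; last first.
  by rewrite memN_msupp_eq0 //; mem.
apply: (@tower_coef _ A m hN hL s d 0%N (@zeroI F) _ _ _ _ e (msupp G) (fun al => G@_al)) => //.
- by rewrite drop0.
- by rewrite (addI_zero (hmp _)); move: hv; rewrite mevalE.
Qed.

Lemma form_pow G e : G \is e.-homog -> coefs_in A G -> idpow A m e G.@[v].
Proof.
move=> /dhomogP hG hc; rewrite mevalE big_seq; apply: (id_sum _ (hmp _)) => al hal.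
by apply: (idM (hmp _)) => //; rewrite -(hG _ hal); apply: mval_pow.
Qed.

Lemma form_powS G e : G \is e.-homog -> coefs_in m G -> idpow A m e.+1 G.@[v].
Proof.
move=> /dhomogP hG hc; rewrite mevalE big_seq; apply: (id_sum _ (hmp _)) => al hal.
by rewrite mulrC; apply: idpowS_mul => //; rewrite -(hG _ hal); apply: mval_pow.
Qed.

Lemma pow_form a e : idpow A m e a -> exists G, [/\ G \is e.-homog, coefs_in A G & a = G.@[v]].
Proof.
elim: e a => [|e IH] a.
  move=> ha; exists a%:MP; split; [|exact: coefs_inC|by rewrite mevalC].
  by apply/dhomogP => al; rewrite mcoeff_msupp mcoeffC; case: (al =P 0%MM) => [->|_]; [move=> _; apply: mdeg0|rewrite mulr0 eqxx].
have hid : is_ideal A (fun a => exists G, [/\ G \is e.+1.-homog, coefs_in A G & a = G.@[v]]).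
  split.
  - by move=> _ [G [hG hc ->]]; apply: (idS (hmp e.+1)); apply: form_pow.
  - by exists 0; split; [exact: dhomog0|move=> al; rewrite mcoeff0; mem|rewrite meval0].
  - move=> _ _ [G [hG hc ->]] [G' [hG' hc' ->]]; exists (G + G'); split; last by rewrite mevalD.
      exact: dhomogD.
    exact: coefs_inD.
  - move=> c _ hc' [G [hG hc ->]]; exists (c *: G); split; last by rewrite mevalZ.
      exact: dhomogZ.
    by move=> al; rewrite mcoeffZ; apply: (srM hA).
move: a; apply: (idpowS_ind hid) => u w /IH [G [hG hc ->]] /m_gen [c [hc' ->]].
exists (G * \sum_i c i *: 'X_i); split.
- rewrite -addn1; apply: dhomogM => //; apply: rpred_sum => i _; apply: dhomogZ.
  by rewrite dhomogX /= mdeg1.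
- apply: coefs_inM => // al; rewrite raddf_sum; apply: sr_sum => // i _ /=.
  by rewrite mcoeffZ; apply: (srM hA) => //; apply: coefs_inX.
- rewrite mevalM raddf_sum; congr (_ * _); apply: eq_bigr => i _.
  by rewrite /= mevalZ mevalXU.
Qed.

Variables (A1 m1 : F -> Prop) (z : F).
Hypotheses (hL1 : is_local A1 m1) (hAA1 : subset_of A A1) (hmm1 : subset_of m m1).
Hypotheses (hcontr : forall a, A a -> m1 a -> m a) (hz : m z) (z0 : z != 0).
Hypothesis hyA : forall i : 'I_d, A1 (s`_i / z).
Hypothesis hrep : forall t, A1 t -> exists e a b,
  [/\ idpow A m e a, idpow A m e b, ~ m1 (b / z ^+ e) & t * b = a].
Let hA1 := loc_sr hL1.
Let hm1 := loc_id hL1.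
Let y (i : 'I_d) := s`_i / z.
Let tr := trl y.

Let hy i : A1 (y i). Proof. exact: hyA. Qed.

(** The reduction of [p] modulo [m1] vanishes to order at least [n] at the origin. *)
Definition vanishing_order n (p : {mpoly F[d]}) :=
  coefs_in A1 p /\ forall al, (mdeg al < n)%N -> m1 p@_al.

Let lowM n k p q : vanishing_order n p -> vanishing_order k q -> vanishing_order (n + k) (p * q).
Proof.
move=> [hp hp'] [hq hq']; split; first exact: coefs_inM.
move=> al hal; apply: mcoeffM_ind; [mem|by move=> *; mem|move=> be ga e].
move: hal; rewrite -e mdegD => hal.
case: (ltnP (mdeg be) n) => h; first by apply: (idMr hm1) => //; apply: hp'.
by apply: (idM hm1) => //; apply: hq'; lia.
Qed.
Let low0 p : coefs_in A1 p -> vanishing_order 0 p. Proof. by []. Qed.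
Let lowD n p q : vanishing_order n p -> vanishing_order n q -> vanishing_order n (p + q).
Proof.
move=> [hp hp'] [hq hq']; split; first exact: coefs_inD.
by move=> al hal; rewrite mcoeffD; apply: (idD hm1); [apply: hp'|apply: hq'].
Qed.

(** Modulo [m1] the constant term of [u] is invertible, so the coefficients of [p] are cleared by
    induction on the degree. *)
Let low_cancel n u p : coefs_in A1 u -> coefs_in A1 p -> ~ m1 u@_0%MM ->
  vanishing_order n (u * p) -> vanishing_order n p.
Proof.
move=> hu hp hu0 [_ hup]; split=> // al.
have [k] := ubnP (mdeg al); elim: k al => // k IH al hk hal.
have := hup al hal.
have -> : u = (u@_0%MM)%:MP + (u - (u@_0%MM)%:MP) by rewrite addrC subrK.
rewrite mulrDl mcoeffD mcoeffCM => h.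
have h2 : m1 ((u - (u@_0%MM)%:MP) * p)@_al.
  apply: mcoeffM_ind; [mem|by move=> *; mem|move=> be ga e].
  rewrite mcoeffB mcoeffC; case: eqP => [->|/eqP hbe].
    by rewrite mulr1 subrr mul0r; mem.
  rewrite mulr0 subr0; apply: (idM hm1) => //.
  by apply: IH; move: hk hal hbe; rewrite -e mdegD -mdeg_eq0; lia.
have : m1 (u@_0%MM * p@_al).
  by have := idB hA1 hm1 h h2; rewrite addrK.
by case/(prM (loc_prime hL1) (hu _) (hp _)).
Qed.

Let meval_y G e : G \is e.-homog -> G.@[v] = z ^+ e * G.@[y].
Proof.
move=> /dhomogP hG; rewrite !mevalE mulr_sumr big_seq [RHS]big_seq; apply: eq_bigr => al hal.
rewrite mulrCA; congr (_ * _).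
rewrite -(hG _ hal) /= mdegE -prodrXr -big_split /=; apply: eq_bigr => i _.
by rewrite -exprMn /y mulrC divfK.
Qed.

Let trA G : coefs_in A G -> coefs_in A1 (tr G).
Proof.
have h1 : is_ideal A1 A1 by split=> // *; mem.
move=> hG; apply: (trl_coefs hA1 h1 hy) => al.
exact/hAA1/hG.
Qed.

(* [t = H(x) / U(x)] where the translate of [H] to the point [x / z] has order at least [n]
   there and [U] does not vanish there. *)
Let quot n t := exists e U H, [/\ U \is e.-homog, H \is e.-homog, coefs_in A U & coefs_in A H] /\
  [/\ ~ m1 U.@[y], t * U.@[v] = H.@[v] & vanishing_order n (tr H)].

(** Writing an element of [m1] as $H(v)/U(v)$ makes the constant term of the translated [H] lie in
    [m1]. Each factor from [m1] thus adds one to the vanishing order, and sums are brought to a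
    common denominator. *)
Let pow_quot n t : idpow A1 m1 n t -> quot n t.
Proof.
have base t' : A1 t' -> exists e U H, [/\ U \is e.-homog, H \is e.-homog, coefs_in A U & coefs_in A H] /\
  [/\ ~ m1 U.@[y], t' * U.@[v] = H.@[v] & H.@[y] = t' * U.@[y]].
  move=> ht'; have [e [a [b [ha hb nb e1]]]] := hrep ht'.
  have [H [hH hcH eH]] := pow_form ha; have [U [hU hcU eU]] := pow_form hb.
  have ze : z ^+ e != 0 by rewrite expf_neq0.
  exists e, U, H; split=> //; split.
  - by move: nb; rewrite eU (meval_y hU) mulrC mulKf.
  - by rewrite -eU -eH.
  - apply: (mulfI ze); rewrite mulrCA -(meval_y hH) -(meval_y hU).
    by rewrite -eU -eH.
elim: n t => [|n IH] t ht.
  have [e [U [H [hh [h1 h2 h3]]]]] := base t ht.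
  by exists e, U, H; split=> //; split=> //; apply: low0; apply: trA; case: hh.
have unit_y U e : U \is e.-homog -> coefs_in A U -> A1 U.@[y].
  move=> hU hc; rewrite -trl_const; exact: trA.
case: ht => k [u [w [huw ->]]].
apply: (big_ind (quot n.+1)).
- exists 0%N, 1, 0; split.
    split; [exact: dhomog1|exact: dhomog0| |by move=> al; rewrite mcoeff0; mem].
    by apply: coefs_inC => //; mem.
  split; [by rewrite meval1; exact: loc_1 hL1|by rewrite meval0 mul0r|].
  by rewrite /tr /trl comp_mpoly0; split=> al *; rewrite mcoeff0; mem.
- move=> t1 t2 [e [U [H [[hU hH hcU hcH] [nU e1 lo]]]]] [e' [U' [H' [[hU' hH' hcU' hcH'] [nU' e1' lo']]]]].
  exists (e + e')%N, (U * U'), (H * U' + U * H'); split.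
    split; [exact: dhomogM|by apply: dhomogD; apply: dhomogM|exact: coefs_inM|].
    by apply: coefs_inD => //; apply: coefs_inM.
  split.
  - by rewrite mevalM => /(prM (loc_prime hL1) (unit_y _ _ hU hcU) (unit_y _ _ hU' hcU')) [].
  - by rewrite mevalD !mevalM -e1 -e1'; ring.
  - rewrite /tr trlD !trlM; apply: lowD.
      by rewrite -[n.+1]addn0; apply: lowM => //; apply: low0; apply: trA.
    by rewrite -[n.+1]add0n; apply: lowM => //; apply: low0; apply: trA.
- move=> j _; have [/IH [e [U [H [[hU hH hcU hcH] [nU e1 lo]]]]] hw] := huw j.
  have [e' [U' [H' [[hU' hH' hcU' hcH'] [nU' e1' ey]]]]] := base _ (idS hm1 hw).
  exists (e + e')%N, (U * U'), (H * H'); split.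
    by split; [exact: dhomogM|exact: dhomogM|exact: coefs_inM|exact: coefs_inM].
  split.
  - by rewrite mevalM => /(prM (loc_prime hL1) (unit_y _ _ hU hcU) (unit_y _ _ hU' hcU')) [].
  - by rewrite !mevalM -e1 -e1'; ring.
  - rewrite /tr trlM -addn1; apply: lowM => //; split; first exact: trA.
    move=> al; rewrite ltnS leqn0 mdeg_eq0 => /eqP ->; rewrite trl_const ey.
    by apply: (idMr hm1) => //; apply: unit_y hU' hcU'.
Qed.

Lemma order_drop a r : idpow A m r a -> idpow A1 m1 r.+1 (a / z ^+ r) -> idpow A m r.+1 a.
Proof.
move=> /pow_form [G [hG hcG ->]] /pow_quot [e [U [H [[hU hH hcU hcH] [nU e1 lo]]]]].
apply: form_powS => //.
have [L [hLL hcL eL]] : exists G, [/\ G \is 1.-homog, coefs_in A G & z = G.@[v]].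
  by apply: pow_form; rewrite idpow1.
have hLr : L ^+ r \is r.-homog by rewrite -[X in X.-homog]mul1n; apply: dhomogMn.
have hcLr : coefs_in A (L ^+ r) by apply: coefs_in_exp.
(* Both products take the same value at the parameters [v], so their difference is a form with value
   0. *)
have hK : coefs_in m (G * U - L ^+ r * H).
  have ze : z ^+ r != 0 by rewrite expf_neq0.
  apply: (@form_coef _ (r + e)%N).
  - by apply: dhomogD; [|rewrite dhomogN]; apply: dhomogM.
  - move=> al; rewrite mcoeffB; apply: (srB hA); exact: coefs_inM.
  - rewrite mevalB !mevalM rmorphXn /= -eL -e1.
    rewrite mulrA [z ^+ r * _]mulrC divfK // subrr; exact: id0 (hmp _).
have hlow : vanishing_order r.+1 (tr U * tr G).
  have -> : tr U * tr G = tr (G * U - L ^+ r * H) + tr (L ^+ r * H).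
    by rewrite /tr -trlD subrK trlM mulrC.
  apply: lowD; last by rewrite /tr trlM -[r.+1]add0n; apply: lowM => //; apply: low0; apply: trA.
  have : coefs_in m1 (tr (G * U - L ^+ r * H)).
    by apply: (trl_coefs hA1 hm1 hy) => al; apply: hmm1; apply: hK.
  by move=> h; split=> // al; apply: (idS hm1).
have {}hlow : vanishing_order r.+1 (tr G).
  apply: low_cancel hlow; [exact: trA|exact: trA|].
  by rewrite trl_const.
(* Low coefficients lie in [m1] by the vanishing order; those of degree above [r] are zero, as [G]
   has degree [r]. *)
have h1 : coefs_in m1 (tr G).
  move=> al; case: (ltnP (mdeg al) r.+1) => hal; first by case: hlow => _; apply.
  by rewrite (trl_deg y hG) //; mem.
by move=> al; apply: hcontr => //; apply: (trl_coefs_inv hA1 hm1 hy h1).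
Qed.

End OrderDrop.

(** * The order valuation of a regular local ring *)

Section OrderValuation.
Variable F : fieldType.
Implicit Types (a b c q x z t : F).
Variables (A m : F -> Prop).

Lemma regular_local_tower d : regular_local A m d -> exists s, tower A m (@zeroI F) s.
Proof.
move=> [hN hL [[P [hpr hlt]] _] [s [hsz hsA hgen]]].
have hA := loc_sr hL; have hm := loc_id hL.
have hs : all_in m s by move=> i hi; apply/hgen; apply: gen_in.
exists s; apply: regular_tower => //.
  by rewrite (addI_zero (gen_ideal_ideal hA hsA)) => q /hgen.
rewrite hsz; have hz := zero_prime (F := F) hA.
have hch k i : (i + k = d)%N -> pchain A k (P i).
  elim: k i => [|k IH] i e; first by split=> //; apply: hpr; lia.
  split; first by apply: hpr; lia.
  by exists (P i.+1); split; [apply: hlt; lia|apply: IH; lia].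
(* The chain realizing the dimension need not start at 0; its bottom prime is exchanged for 0, still
   strictly below the next one. *)
case: d {hsz} hpr hlt hch => [|d] hpr hlt hch; first by split.
split=> //; exists (P 1%N); split; last by apply: hch.
have h1 := prI (hpr 1%N isT); have h0 := prI (hpr 0%N isT).
split; first by move=> q ->; exact: id0 h1.
have [_ [q [hq nq]]] := hlt 0%N isT; exists q; split=> // q0; apply: nq.
by rewrite q0; exact: id0 h0.
Qed.

Hypotheses (hN : noetherian A) (hL : is_local A m) (hF : frac_field A).
Variable s : seq F.
Hypothesis htw : tower A m (@zeroI F) s.
Let hA := loc_sr hL.
Let hm := loc_id hL.
Let hmp n := idpow_ideal n hA hm.

Lemma regular_cic c t : A c -> c != 0 -> (forall n, A (c * t ^+ n)) -> A t.
Proof.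
move=> hc c0 h; have [a [b [ha hb b0 et]]] := hF t.
have [] // := tower_cic hN hL htw ha hb hc _ _ _.
- by move/eqP; rewrite (negbTE b0).
- by move/eqP; rewrite (negbTE c0).
- move=> n; exists 0, (b ^+ n * (c * t ^+ n)); split=> //; last first.
    by rewrite add0r et expr_div_n mulrCA [b ^+ n * _]mulrC divfK ?expf_neq0.
  by exists (c * t ^+ n).
move=> _ [_ [-> [r [hr ->]]]]; rewrite add0r => e.
by rewrite et e mulrC mulKf.
Qed.

Lemma has_ord_exists a : A a -> a != 0 -> exists e, has_ord A m a e.
Proof.
move=> ha a0; have [n hn] : exists n, ~ idpow A m n a.
  apply: NNPP => h; move/eqP: a0; apply.
  apply: (krull_intersection hN hL (prI (zero_prime hA))) => n.
  by rewrite (addI_zero (hmp n)); apply: NNPP => hn; apply: h; exists n.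
elim: n hn => [|n IH] hn; first by case: hn.
by case: (classic (idpow A m n a)) => // h; exists n.
Qed.

Lemma has_ord_le a e n : has_ord A m a e -> idpow A m n a <-> (n <= e)%N.
Proof.
move=> [ha a0 h1 h2]; split=> [hn|hn]; last exact: idpow_le h1.
rewrite leqNgt; apply/negP => hlt; apply: h2; exact: idpow_le hn.
Qed.

Lemma has_ord_uniq a e e' : has_ord A m a e -> has_ord A m a e' -> e = e'.
Proof.
move=> h h'; apply/eqP; rewrite eqn_leq.
by case: (h) => _ _ h1 _; case: (h') => _ _ h1' _; apply/andP; split; [apply/(has_ord_le _ h')|apply/(has_ord_le _ h)].
Qed.

Lemma has_ordM a b e e' : has_ord A m a e -> has_ord A m b e' -> has_ord A m (a * b) (e + e').
Proof.
move=> [ha a0 h1 h2] [hb b0 h1' h2']; split.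
- by mem.
- by rewrite mulf_neq0.
- exact: idpow_mul.
- move=> h; have := tower_gr_domain hN hL htw (k := e) (l := e') (a := a) (b := b).
  by rewrite !(addI_zero (hmp _)) => /(_ h1 h1' h) [].
Qed.

Lemma ordF_uniq q w w' : ordF A m q w -> ordF A m q w' -> w = w'.
Proof.
move=> [a [b [ea [eb [ha hb eq ew]]]]] [a' [b' [ea' [eb' [ha' hb' eq' ew']]]]].
have b0 : b != 0 by case: hb. have b0' : b' != 0 by case: hb'.
have e : a * b' = a' * b by apply/eqP; rewrite -eqr_div // -eq eq'.
have h1 := has_ordM ha hb'; have h2 := has_ordM ha' hb.
rewrite e in h1; have := has_ord_uniq h1 h2; rewrite ew ew'; lia.
Qed.

Lemma ordF_exists q : q != 0 -> exists w, ordF A m q w.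
Proof.
move=> q0; have [a [b [ha hb b0 eq]]] := hF q.
have a0 : a != 0 by apply: contraNneq q0 => e; rewrite eq e mul0r.
have [ea hea] := has_ord_exists ha a0; have [eb heb] := has_ord_exists hb b0.
by exists (ea%:Z - eb%:Z), a, b, ea, eb.
Qed.

Definition order_valuation (v : F -> int) :=
  [/\ forall q w, ordF A m q w <-> q != 0 /\ w = v q,
      forall a b, a != 0 -> b != 0 -> v (a * b) = v a + v b,
      forall a b, a != 0 -> b != 0 -> a + b != 0 -> Num.min (v a) (v b) <= v (a + b) &
      forall a n, A a -> a != 0 -> idpow A m n a <-> n%:Z <= v a].

Lemma order_valuation_exists : exists v, order_valuation v.
Proof.
have hex q : {w | q != 0 -> ordF A m q w}.
  apply: constructive_indefinite_description.
  case: (eqVneq q 0) => [->|q0]; first by exists 0.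
  by have [w hw] := ordF_exists q0; exists w.
pose v q := sval (hex q).
have vP q : q != 0 -> ordF A m q (v q) := svalP (hex q).
have vE q w : ordF A m q w -> w = v q.
  move=> h; apply: (ordF_uniq h); apply: vP.
  case: h => a [b [ea [eb [[_ a0 _ _] [_ b0 _ _] -> _]]]].
  by rewrite mulf_neq0 // invr_eq0.
have vA a e : has_ord A m a e -> v a = e%:Z.
  move=> h; apply/esym/vE; exists a, 1, e, 0%N; split=> //; rewrite ?divr1 ?subr0 //.
  split; [mem|exact: oner_neq0|exact: sr1|].
  by rewrite idpow1 //; exact: loc_1 hL.
have vM a b : a != 0 -> b != 0 -> v (a * b) = v a + v b.
  move=> /vP [p [r [ep [er [hp hr ea ->]]]]] /vP [p' [r' [ep' [er' [hp' hr' eb ->]]]]].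
  apply/esym/vE; exists (p * p'), (r * r'), (ep + ep')%N, (er + er')%N; split.
  - exact: has_ordM.
  - exact: has_ordM.
  - case: hr hr' => [_ r0 _ _] [_ r0' _ _]; rewrite ea eb; field; by rewrite r0 r0'.
  - lia.
have vn a n : A a -> a != 0 -> idpow A m n a <-> n%:Z <= v a.
  move=> ha a0; have [e he] := has_ord_exists ha a0.
  by rewrite (vA _ _ he) (has_ord_le _ he) lez_nat.
exists v; split=> //.
- move=> q w; split; last by case=> q0 ->; apply: vP.
  move=> h; split; last exact: vE.
  case: h => a [b [ea [eb [[_ a0 _ _] [_ b0 _ _] -> _]]]].
  by rewrite mulf_neq0 // invr_eq0.
- have vAD a b : A a -> A b -> a != 0 -> b != 0 -> a + b != 0 -> Num.min (v a) (v b) <= v (a + b).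
    move=> ha hb a0 b0 ab0.
    have [e he] := has_ord_exists ha a0; have [e' he'] := has_ord_exists hb b0.
    rewrite (vA _ _ he) (vA _ _ he').
    have hab : A (a + b) by mem.
    suff : (minn e e')%:Z <= v (a + b) by lia.
    apply/vn => //; apply: (idD (hmp _)).
      by apply/(has_ord_le _ he); apply: geq_minl.
    by apply/(has_ord_le _ he'); apply: geq_minr.
  move=> a b a0 b0 ab0.
  have [p [r [hp hr r0 ea]]] := hF a; have [p' [r' [hp' hr' r0' eb]]] := hF b.
  have rr0 : r * r' != 0 by rewrite mulf_neq0.
  have e1 : a * (r * r') = p * r' by rewrite ea; field.
  have e2 : b * (r * r') = p' * r by rewrite eb; field.
  have : Num.min (v (a * (r * r'))) (v (b * (r * r'))) <= v ((a + b) * (r * r')).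
    rewrite mulrDl; apply: vAD; rewrite -?mulrDl ?mulf_neq0 //; first by rewrite e1; mem.
    by rewrite e2; mem.
  rewrite (vM a) // (vM b) // (vM (a + b)) //; lia.
Qed.

End OrderValuation.

(** * Elements and orders in a quadratic transform *)

Section Transform.
Variable F : fieldType.
Implicit Types (a b c q x t : F).
Variables (A m A1 m1 : F -> Prop) (v : F -> int).
Hypotheses (hL : is_local A m) (hL1 : is_local A1 m1) (hv : order_valuation A m v).
Hypothesis hqt : local_quadratic_transform A m A1.
Let hA := loc_sr hL.
Let hm := loc_id hL.
Let hmp n := idpow_ideal n hA hm.
Let hA1 := loc_sr hL1.
Let hm1 := loc_id hL1.

(** The elements of $A[m/z]$ are the $a/z^e$ with $a\in m^e$; a numerator and a denominator are
    given the same exponent by multiplying with powers of [z]. *)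
Lemma transform_facts : exists z, [/\ m z, ~ idpow A m 2 z, subset_of A A1 & subset_of m m1] /\
  [/\ (forall e a, idpow A m e a -> A1 (a / z ^+ e)) &
      (forall t, A1 t -> exists e a b, [/\ idpow A m e a, idpow A m e b, ~ m1 (b / z ^+ e) & t * b = a])].
Proof.
have [z [hz [nz [Q [hQ [hmQ hB]]]]]] := hqt.
have eB : A1 = localize_at (blowup_ring A m z) Q by apply: set_ext.
rewrite localize_atE in eB; set C := blowup_ring A m z in hQ eB.
have z0 : z != 0 by apply/eqP => z0; apply: nz; rewrite z0; exact: id0 (hmp _).
have hC : subring C.
  split.
  - by move=> B hB' _; mem.
  - by move=> B hB' _; mem.
  - by move=> a b ha hb B hB' hsub; apply: (srB hB'); [apply: ha|apply: hb].
  - by move=> a b ha hb B hB' hsub; apply: (srM hB'); [apply: ha|apply: hb].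
have hAC : subset_of A C by move=> q hq B hB' hsub; apply: hsub; left.
have hmzC a : m a -> C (a / z) by move=> ha B hB' hsub; apply: hsub; right; exists a.
have hpowC e a : idpow A m e a -> C (a / z ^+ e).
  elim: e a => [|e IH] a; first by rewrite expr0 divr1; apply: hAC.
  case=> k [u [w [h ->]]]; rewrite mulr_suml; apply: sr_sum => // j _.
  have [hu hw] := h j.
  have -> : u j * w j / z ^+ e.+1 = (u j / z ^+ e) * (w j / z).
    by rewrite exprSr; field; rewrite expf_neq0 // z0.
  by apply: (srM hC); [apply: IH|apply: hmzC].
have hexp q e k : idpow A m e (z ^+ e * q) -> idpow A m (k + e) (z ^+ (k + e) * q).
  by move=> h; rewrite exprD -mulrA; apply: idpow_mul => //; apply: idpow_exp.
have hCrep q : C q -> exists e, idpow A m e (z ^+ e * q).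
  move=> hq; apply: (hq (fun q => exists e, idpow A m e (z ^+ e * q))).
    split.
    - by exists 0%N; rewrite mulr0; exact: id0 (hmp _).
    - by exists 0%N; rewrite mulr1; exact: sr1.
    - move=> a b [e he] [e' he']; exists (e' + e)%N.
      rewrite mulrBr; apply: (idB hA (hmp _)); first exact: hexp.
      by rewrite addnC; apply: hexp.
    - move=> a b [e he] [e' he']; exists (e + e')%N.
      by rewrite exprD mulrACA; apply: idpow_mul.
  move=> q' [hq'|[a [ha ->]]]; first by exists 0%N; rewrite mul1r.
  by exists 1%N; rewrite idpow1 // expr1 mulrC divfK.
have hM := offset_ms hC hQ.
have hCA1 : subset_of C A1 by rewrite eB; apply: (fracs_in hM).
have hQm1 q : C q -> m1 q <-> Q q.
  move=> hq; split=> [h|h].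
    apply: NNPP => nq; apply: (loc_1 hL1).
    have q0 : q != 0 by apply/eqP => q0; apply: nq; rewrite q0; exact: id0 (prI hQ).
    rewrite -(divff q0); apply: (idMr hm1) => //; rewrite eB; exact: (fracs_inv hC hM).
  apply/(loc_nonunit hL1); split; first exact: hCA1.
  case=> _ [y [+ e]]; rewrite eB => -[a [b [ha [hb nb] ey]]].
  have b0 : b != 0 := ms_neq0 hM (conj hb nb).
  apply: nb.
  have -> : b = q * a by rewrite -[b]mul1r -e ey -mulrA divfK.
  exact: (idMr (prI hQ)).
exists z; split; split=> //.
- by move=> q /hAC /hCA1.
- move=> q hq; apply/hQm1; last exact: hmQ.
  by apply: hAC; apply: (idS hm).
- by move=> e a /hpowC /hCA1.
- move=> t; rewrite eB => -[a [b [ha [hb nb] et]]].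
  have [e he] := hCrep _ ha; have [e' he'] := hCrep _ hb.
  have b0 : b != 0 := ms_neq0 hM (conj hb nb).
  exists (e' + e)%N, (z ^+ (e' + e) * a), (z ^+ (e' + e) * b); split.
  - exact: hexp.
  - by rewrite addnC; apply: hexp.
  - rewrite mulrC mulKf ?expf_neq0 // => h; apply: nb; exact/hQm1.
  - by rewrite et mulrCA divfK.
Qed.

(** The order of [A] is the valuation along the exceptional divisor $zA_1$: if $b/z^e$ is a unit of
    [A1], then [b] has order exactly [e], since otherwise [z] would divide that unit. *)
Lemma transform_order z : m z -> ~ idpow A m 2 z -> subset_of m m1 ->
  (forall e a, idpow A m e a -> A1 (a / z ^+ e)) ->
  (forall t, A1 t -> exists e a b, [/\ idpow A m e a, idpow A m e b, ~ m1 (b / z ^+ e) & t * b = a]) ->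
  [/\ z != 0, v z = 1, (forall q, A1 q -> q != 0 -> 0 <= v q) &
      (forall q, A1 q -> q != 0 -> 1 <= v q -> A1 (q / z))].
Proof.
move=> hz nz hmm1 hpow hrep; have [_ vM _ vA] := hv.
have z0 : z != 0 by apply/eqP => z0; apply: nz; rewrite z0; exact: id0 (hmp _).
have hzA : A z := idS hm hz.
have h1 : v z = 1.
  have : 1%N%:Z <= v z by apply/vA => //; rewrite idpow1.
  have : ~ 2%N%:Z <= v z by move=> /vA h; apply: nz; apply: h.
  lia.
have key q : A1 q -> q != 0 -> exists e a b, [/\ A1 (b / z ^+ e), ~ m1 (b / z ^+ e), q * b = a & 
   idpow A m e a /\ [/\ A a, a != 0, b != 0 & v q = v a - e%:Z]].
  move=> hq q0; have [e [a [b [ha hb nb e1]]]] := hrep q hq.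
  exists e, a, b; have ze : z ^+ e != 0 by rewrite expf_neq0.
  have hbA : A b := idS (hmp _) hb; have haA : A a := idS (hmp _) ha.
  have b0 : b != 0 by apply/eqP => b0; apply: nb; rewrite b0 mul0r; mem.
  have a0 : a != 0 by rewrite -e1 mulf_neq0.
  split=> //; first exact: hpow.
  split=> //; split=> //.
  have : e%:Z <= v b by apply/vA.
  have : ~ e.+1%:Z <= v b.
    move=> /vA h; apply: nb.
    have -> : b / z ^+ e = z * (b / z ^+ e.+1) by rewrite exprS; field; rewrite ze z0.
    by apply: (idMr hm1); [exact: hmm1|apply: hpow; apply: h].
  rewrite -e1 vM //; lia.
split=> // q hq q0; have [e [a [b [hb nb e1 [ha [haA a0 b0 ->]]]]]] := key q hq q0.
  by rewrite subr_ge0; apply/vA.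
move=> hva; have {}ha : idpow A m e.+1 a by apply/vA => //; lia.
have [w [hw ew]] := loc_unit hL1 hb nb.
have ze : z ^+ e != 0 by rewrite expf_neq0.
have -> : q / z = (a / z ^+ e.+1) * w.
  have -> : w = z ^+ e / b.
    apply: (mulfI (x := b / z ^+ e)); first by rewrite mulf_neq0 ?invr_eq0.
    by rewrite ew; field; rewrite ze b0.
  by rewrite -e1 exprS; field; rewrite ze z0 b0.
by apply: (srM hA1) => //; apply: hpow.
Qed.

End Transform.

(** * Discrete valuation rings *)

Section DVR.
Variable F : fieldType.
Implicit Types (A B C I J K M P : F -> Prop) (a b c q u w x y t : F).

(** Krull's intersection theorem bounds the power of [p] dividing a nonzero element, so the exponent
    of [p] is the valuation. *)
Lemma principal_dvr B n p : noetherian B -> is_local B n -> frac_field B -> p != 0 ->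
  n p -> (forall q, n q -> exists r, B r /\ q = p * r) -> is_DVR B.
Proof.
move=> hN hL hF p0 hp hpr; have hB := loc_sr hL; have hn := loc_id hL; have hpB := idS hn hp.
pose unit u := B u /\ ~ n u.
have unit0 u : unit u -> u != 0 by move=> [_ hu]; apply/eqP => u0; apply: hu; rewrite u0; mem.
have unitM u w : unit u -> unit w -> unit (u * w).
  by move=> [hu nu] [hw nw]; split; [mem|move/(prM (loc_prime hL) hu hw) => []].
have unitV u : unit u -> unit u^-1.
  move=> hu; have u0 := unit0 _ hu; case: hu => hu nu; have [w [hw e]] := loc_unit hL hu nu.
  have -> : u^-1 = w by apply: (mulfI u0); rewrite divff.
  by split=> // nw; apply: (loc_1 hL); rewrite -e; mem.
have factB b : B b -> b != 0 -> exists e u, unit u /\ b = u * p ^+ e.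
  move=> hb b0; have [k hk] : exists k, ~ principal B (p ^+ k) b.
    apply: NNPP => h; move/eqP: b0; apply.
    apply: (krull_intersection hN hL (prI (zero_prime hB))) => k.
    rewrite (addI_zero (idpow_ideal k hB hn)).
    have [r [hr ->]] : principal B (p ^+ k) b by apply: NNPP => hk; apply: h; exists k.
    by apply: (idMr (idpow_ideal k hB hn)) => //; apply: idpow_exp.
  elim: k hk => [|k IH] hk; first by case: hk; exists b; rewrite expr0 mul1r.
  case: (classic (principal B (p ^+ k) b)) => // -[u [hu e]].
  exists k, u; rewrite mulrC; split=> //; split=> // /hpr [r [hr eu]].
  by apply: hk; exists r; rewrite e eu exprSr mulrA.
have fact q : q != 0 -> exists k : int, exists u, unit u /\ q = u * p ^ k.
  move=> q0; have [a [b [ha hb b0 eq]]] := hF q.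
  have a0 : a != 0 by apply: contraNneq q0 => e; rewrite eq e mul0r.
  have [e [u [hu ea]]] := factB a ha a0; have [e' [u' [hu' eb]]] := factB b hb b0.
  exists (e%:Z - e'%:Z), (u / u'); split; first by apply: unitM => //; apply: unitV.
  rewrite eq ea eb expfzDr // -exprnP -invr_expz -exprnP.
  by field; rewrite expf_neq0 // unit0.
have notlt u w (k l : int) : unit u -> unit w -> u * p ^ k = w * p ^ l -> l <= k.
  move=> hu hw e; rewrite leNgt; apply/negP => hlt; case: (hu) => _; apply.
  have -> : u = w * p ^ (l - k).
    by rewrite expfzDr // mulrA -e -mulrA -expfzDr // subrr expr0z mulr1.
  have [j ->] : exists j, l - k = j.+1%:Z by exists (`|l - k|.-1)%N; lia.
  by case: hw => hw _; rewrite -exprnP; mem.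
have hex q : {k : int | q != 0 -> exists u, unit u /\ q = u * p ^ k}.
  apply: constructive_indefinite_description; case: (eqVneq q 0) => [->|q0]; first by exists 0.
  by have [k hk] := fact q q0; exists k.
pose v q := sval (hex q).
have vP q : q != 0 -> exists u, unit u /\ q = u * p ^ (v q) := svalP (hex q).
have vE q u k : unit u -> q = u * p ^ k -> v q = k.
  move=> hu e; have q0 : q != 0 by rewrite e mulf_neq0 ?expfz_neq0 // unit0.
  have [w [hw ew]] := vP q q0; apply: le_anti; rewrite (notlt w u (v q) k) //; last by rewrite -ew -e.
  by rewrite (notlt u w k (v q)) // -ew -e.
have un1 : unit 1 by split; [mem|exact: loc_1 hL].
have vB b : B b -> b != 0 -> 0 <= v b.
  by move=> hb b0; have [e [u [hu ->]]] := factB b hb b0; rewrite exprnP (vE _ u e%:Z).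
have vge q : q != 0 -> 0 <= v q -> B q.
  move=> q0 hv; have [u [[hu _] ->]] := vP q q0.
  by case: (v q) hv => // e _; rewrite -exprnP; mem.
split=> //; exists v; split.
- move=> a b a0 b0; have [u [hu eu]] := vP a a0; have [w [hw ew]] := vP b b0.
  apply: (vE _ (u * w)); first exact: unitM.
  by rewrite expfzDr // mulrACA -eu -ew.
- suff H a b : a != 0 -> b != 0 -> a + b != 0 -> v a <= v b -> v a <= v (a + b).
    move=> a b a0 b0 ab0; case: (leP (v a) (v b)) => h; first exact: H.
    by rewrite addrC; apply: H => //; [rewrite addrC|exact: ltW].
  move=> a0 b0 ab0 hle; have [u [hu eu]] := vP a a0; have [w [hw ew]] := vP b b0.
  pose c := u + w * p ^ (v b - v a).
  have ec : a + b = c * p ^ (v a).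
    by rewrite mulrDl -mulrA -expfzDr // subrK -eu -ew.
  have hc : B c.
    rewrite /c; case: hu hw => [hu _] [hw _]; have [j ->] : exists j : nat, v b - v a = j%:Z by exists `|v b - v a|%N; lia.
    by rewrite -exprnP; mem.
  have c0 : c != 0 by apply: contraNneq ab0 => c0; rewrite ec c0 mul0r.
  have [e [w' [hw' ew']]] := factB c hc c0.
  rewrite (vE (a + b) w' (e%:Z + v a)) //; last by rewrite expfzDr // mulrA -exprnP -ew'.
  by rewrite lerDr.
- by move=> k; exists (p ^ k); split; [rewrite expfz_neq0|apply: (vE _ 1); rewrite ?mul1r].
- move=> q; case: (eqVneq q 0) => [->|q0]; first by split; [left|move=> _; mem].
  split=> [hq|[/eqP|[_]]]; [right; split=> //; exact: vB|by rewrite (negbTE q0)|exact: vge].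
Qed.

Lemma common_denominator A M K (ys : seq F) : subring A -> mult_set A M -> is_ideal A K ->
  all_in (fracs K M) ys -> exists t, M t /\ forall i, (i < size ys)%N -> K (t * ys`_i).
Proof.
move=> hA hM hK; have [MA M1 M0 MM] := hM.
elim: ys => [|y ys IH] hys; first by exists 1.
have [t [ht h]] := IH (fun i hi => hys i.+1 hi).
have [a [s [ha hs e]]] : fracs K M y := hys 0%N isT.
have hsA := MA _ hs; have htA := MA _ ht.
exists (t * s); split; first exact: MM.
case=> [|i] /= hi; last by rewrite mulrAC; apply: (idMr hK) => //; apply: h.
by rewrite e -mulrA [s * _]mulrC divfK ?(ms_neq0 hM hs) //; mem.
Qed.

(** Integral closedness in the form used by the determinant trick; no monic equation has to be
    written. *)
Definition stable_closed C := forall y I, is_ideal C I -> (exists w, I w /\ w != 0) ->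
  (forall w, I w -> I (y * w)) -> C y.

Lemma stabilizes_gen A I y (s : seq F) : is_ideal A I -> set_eq I (gen_ideal A s) ->
  (forall i, (i < size s)%N -> I (y * s`_i)) -> forall w, I w -> I (y * w).
Proof.
move=> hI e h w /e [c [hc ->]]; rewrite mulr_sumr; apply: (id_sum _ hI) => i _.
by rewrite mulrCA; apply: (idM hI) => //; apply: h.
Qed.

(** With [t] clearing the denominators of [y] times generators of $I\cap A$, the element [t * y]
    carries $I\cap A$ into itself. All $a(ty)^n$ with [a] fixed then lie in [A], hence so does
    [t * y]. *)
Lemma fracs_stable_closed A M : subring A -> noetherian A -> mult_set A M ->
  (forall c t, A c -> c != 0 -> (forall n, A (c * t ^+ n)) -> A t) -> stable_closed (fracs A M).
Proof.
move=> hA hN hM hcic y I hI [w [hw w0]] hy; have [MA M1 M0 MM] := hM.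
have hAf := fracs_in hM (I := A).
have hI0 : is_ideal A (fun q => A q /\ I q).
  split=> [q []//|||].
  - by split; mem.
  - by move=> a b [? ?] [? ?]; split; mem.
  - by move=> a b ha [? ?]; split; [mem|apply: (idM hI) => //; apply: hAf].
have [s [hs es]] := hN _ hI0.
have hsI i : (i < size s)%N -> A s`_i /\ I s`_i by move=> hi; apply/es; apply: gen_in.
have hAA : is_ideal A A by split=> // *; mem.
have [|t [ht hts]] := @common_denominator A M A [seq y * g | g <- s] hA hM hAA.
  move=> i; rewrite size_map => hi; rewrite (nth_map 0) //.
  by apply: (idS hI); apply: hy; case: (hsI i hi).
rewrite size_map in hts.
have hst := @stabilizes_gen A _ (t * y) s hI0 es.
have [a [r [ha hr ew]]] := idS hI hw; have r0 := ms_neq0 hM hr.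
have ea : a = r * w by rewrite ew mulrC divfK.
have a0 : a != 0 by rewrite ea mulf_neq0.
have hIa : A a /\ I a by split=> //; rewrite ea; apply: (idM hI) => //; apply: hAf; apply: MA.
have hty : A (t * y).
  apply: (hcic a) => // n; suff [] : A (a * (t * y) ^+ n) /\ I (a * (t * y) ^+ n) by [].
  elim: n => [|n IH]; first by rewrite expr0 mulr1.
  rewrite exprSr mulrA [_ * (t * y)]mulrC; apply: hst => // i hi.
  have := hts i hi; rewrite (nth_map 0) // => h; rewrite -mulrA; split=> //.
  by apply: (idM hI); [apply: hAf; apply: MA|apply: hy; case: (hsI i hi)].
exists (t * y), t; split=> //.
by rewrite mulrC mulKf // (ms_neq0 hM ht).
Qed.

(** For $q=a/b$, a maximal proper colon ideal $P=(bC:c)$ containing $(bC:a)$ is prime. [q] is not in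
    $C_P$, because a denominator of [q] outside [P] would lie in $(bC:a)$; and the maximal ideal of
    $C_P$ is generated by $b/c$. *)
Lemma dvr_avoiding C q : subring C -> noetherian C -> frac_field C -> stable_closed C -> ~ C q ->
  exists V, [/\ is_DVR V, subset_of C V & ~ V q].
Proof.
move=> hC hN hF hst nq; have [a [b [ha hb b0 eq]]] := hF q.
pose J c t := C t /\ principal C b (t * c).
have hpb := principal_ideal hC hb.
have hJ c : C c -> is_ideal C (J c) by move=> hc; apply: colon_ideal.
have [|P [hP [c [hc nc eP haP]] hmax]] := @noeth_max _ C
  (fun I => exists c, [/\ C c, ~ principal C b c, I = J c & subset_of (J a) I]) hC hN.
  exists (J a); split; first exact: hJ.
  exists a; split=> // -[r [hr e]]; apply: nq.
  by rewrite eq e mulrC mulKf.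
have prP : is_prime C P.
  split=> //; first by rewrite eP => -[_]; rewrite mul1r.
  move=> x y hx hy hxy; apply: NNPP => /not_or_and [nx ny]; apply: ny.
  have hle : subset_of P (J (x * c)).
    by rewrite eP => t [ht h]; split=> //; rewrite mulrCA; apply: (idM hpb).
  have hxc : C (x * c) by mem.
  apply: (hmax (J (x * c))) => //; first exact: hJ.
    exists (x * c); split=> //; last by move=> t /haP /hle.
    by move=> h; apply: nx; rewrite eP; split.
  by split=> //; move: hxy; rewrite eP => -[_]; rewrite mulrA [y * x]mulrC.
have hM := offset_ms hC prP; have hB := fracs_subring hC hM; have hL := ext_local hC prP.
have hCB := fracs_in hM (I := C); have hBN := fracs_noeth hC hM hN.
set M := offset C P in hM hB hL hCB hBN *; set n := fracs P M in hL.
have hn := loc_id hL.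
exists (fracs C M); split=> //; last first.
  case=> r [t [hr [ht nt] e]].
  have t0 : t != 0 := ms_neq0 hM (conj ht nt).
  apply: nt; apply: haP; split=> //; exists r; split=> //.
  by apply/eqP; rewrite [b * r]mulrC [t * a]mulrC -eqr_div // -eq e.
have c0 : c != 0 by apply/eqP => c0; apply: nc; exists 0; split; [mem|rewrite c0 mulr0].
have hPB p : n p -> fracs C M (c / b * p).
  case=> p' [t [hp' ht ->]]; move: hp'; rewrite eP => -[hp' [r [hr e]]].
  exists r, t; split=> //.
  have -> : c / b * (p' / t) = (p' * c) / (b * t) by field; rewrite b0 (ms_neq0 hM ht).
  by rewrite e; field; rewrite b0 (ms_neq0 hM ht).
(* Otherwise some $t\,c/b$ with [t] outside [P] carries [P] into itself, so it lies in [C], and then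
   [t] belongs to $(bC:c)=P$. *)
have [p [hp np]] : exists p, n p /\ ~ n (c / b * p).
  apply: NNPP => hno; have {}hno p : n p -> n (c / b * p).
    by move=> hp; apply: NNPP => np; apply: hno; exists p.
  have [s [hs es]] := hN _ hP.
  have hsP i : (i < size s)%N -> P s`_i by move=> hi; apply/es; apply: gen_in.
  have [|t [[ht nt] hts]] := @common_denominator C M P [seq c / b * g | g <- s] hC hM hP.
    move=> i; rewrite size_map => hi; rewrite (nth_map 0) //.
    by apply: hno; apply: (fracs_in hM); apply: hsP.
  rewrite size_map in hts; apply: nt; rewrite eP; split=> //.
  have h : C (t * (c / b)).
    apply: (hst _ P) => //.
      by exists b; split=> //; rewrite eP; split=> //; exists c.
    apply: (stabilizes_gen hP es) => i hi.
    by have := hts i hi; rewrite (nth_map 0) // mulrA.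
  exists (t * (c / b)); split=> //; by field.
have [w [hw ew]] := loc_unit hL (hPB _ hp) np.
have epi : b / c = p * w.
  have cb0 : c / b != 0 by rewrite mulf_neq0 // invr_eq0.
  by apply: (mulfI cb0); rewrite [RHS]mulrA ew; field; rewrite b0 c0.
apply: (@principal_dvr (fracs C M) n (b / c)) => //.
- move=> t; have [a' [b' [ha' hb' b0' ->]]] := hF t.
  by exists a', b'; split=> //; apply: hCB.
- by rewrite mulf_neq0 // invr_eq0.
- by rewrite epi; apply: (idMr hn).
- move=> r hr; exists (c / b * r); split; first exact: hPB.
  by field; rewrite b0 c0.
Qed.
End DVR.

(** * Sequences of quadratic transforms *)

Section Sequence.
Variable F : fieldType.
Implicit Types (a b c q u w y t : F) (i j k l n : nat).
Variables (R m : nat -> F -> Prop) (v : nat -> F -> int) (z : nat -> F).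
Hypotheses (hL : forall i, is_local (R i) (m i)) (hN : forall i, noetherian (R i)).
Hypotheses (hF : forall i, frac_field (R i)).
Hypothesis hcic : forall i c t, R i c -> c != 0 -> (forall n, R i (c * t ^+ n)) -> R i t.
Hypothesis hv : forall i, order_valuation (R i) (m i) (v i).
Hypotheses (hz : forall i, m i (z i)) (z0 : forall i, z i != 0) (vz : forall i, v i (z i) = 1).
Hypotheses (hRR : forall i, subset_of (R i) (R i.+1)) (hmm : forall i, subset_of (m i) (m i.+1)).
Hypothesis hpow : forall i e a, idpow (R i) (m i) e a -> R i.+1 (a / z i ^+ e).
Hypothesis hrep : forall i t, R i.+1 t -> exists e a b,
  [/\ idpow (R i) (m i) e a, idpow (R i) (m i) e b, ~ m i.+1 (b / z i ^+ e) & t * b = a].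
Hypothesis hge : forall i q, R i.+1 q -> q != 0 -> 0 <= v i q.
Hypothesis hdiv : forall i q, R i.+1 q -> q != 0 -> 1 <= v i q -> R i.+1 (q / z i).
Hypothesis hdrop : forall i a (e : nat), R i a -> a != 0 -> v i a = e%:Z -> v i.+1 (a / z i ^+ e) <= e%:Z.

Let hA i := loc_sr (hL i).
Let hm i := loc_id (hL i).

Let vM i a b : a != 0 -> b != 0 -> v i (a * b) = v i a + v i b.
Proof. by case: (hv i) => _ h _ _; apply: h. Qed.
Let vD i a b : a != 0 -> b != 0 -> a + b != 0 -> Num.min (v i a) (v i b) <= v i (a + b).
Proof. by case: (hv i) => _ _ h _; apply: h. Qed.
Let vpow i a n : R i a -> a != 0 -> idpow (R i) (m i) n a <-> n%:Z <= v i a.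
Proof. by case: (hv i) => _ _ _ h; apply: h. Qed.
Let v1 i : v i 1 = 0.
Proof. have := vM i (oner_neq0 F) (oner_neq0 F); rewrite mulr1; move: (v i 1) => w; lia. Qed.
Let vX i a n : a != 0 -> v i (a ^+ n) = n%:Z * v i a.
Proof.
move=> a0; elim: n => [|n IH]; first by rewrite expr0 v1 mul0r.
by rewrite exprS vM ?expf_neq0 // IH; lia.
Qed.
Let vV i a : a != 0 -> v i a^-1 = - v i a.
Proof. by move=> a0; have := vM i a0; move=> /(_ a^-1); rewrite invr_eq0 divff // v1 => /(_ a0); lia. Qed.
Let vR i a : R i a -> a != 0 -> 0 <= v i a.
Proof. by move=> ha a0; apply/(vpow 0). Qed.
Let vm i a : m i a -> a != 0 -> 1 <= v i a.
Proof.
by move=> ha a0; apply/(vpow 1) => //; [apply: (idS (hm i))|rewrite idpow1].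
Qed.

Let zn i n : z i ^+ n != 0. Proof. by rewrite expf_neq0. Qed.

Let R_mono i j : (i <= j)%N -> subset_of (R i) (R j).
Proof. by move=> /subnKC <-; elim: (j - i)%N => [|k IH] q; rewrite ?addn0 ?addnS // => /IH /hRR. Qed.
Let m_mono i j : (i <= j)%N -> subset_of (m i) (m j).
Proof. by move=> /subnKC <-; elim: (j - i)%N => [|k IH] q; rewrite ?addn0 ?addnS // => /IH /hmm. Qed.
Let zR i j : (i <= j)%N -> R j (z i).
Proof. by move=> hij; apply: (R_mono hij); apply: (idS (hm i)). Qed.

Let unit_inv i a : R i a -> ~ m i a -> R i a^-1 /\ a != 0.
Proof.
move=> ha na; have [b [hb e]] := loc_unit (hL i) ha na.
have a0 : a != 0 by apply/eqP => a0; apply: na; rewrite a0; exact: id0 (hm i).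
by split=> //; have -> : a^-1 = b by apply: (mulfI a0); rewrite divff.
Qed.

Local Notation S := (union_seq R).
Local Notation N := (union_seq m).

Lemma S_subring : subring S.
Proof.
split.
- by exists 0%N; exact: sr0.
- by exists 0%N; exact: sr1.
- move=> a b [i ha] [j hb]; exists (maxn i j); apply: (srB (hA _)).
    exact: R_mono (leq_maxl _ _) _ ha.
  exact: R_mono (leq_maxr _ _) _ hb.
- move=> a b [i ha] [j hb]; exists (maxn i j); apply: (srM (hA _)).
    exact: R_mono (leq_maxl _ _) _ ha.
  exact: R_mono (leq_maxr _ _) _ hb.
Qed.
Let hS := S_subring.

Lemma N_S a : N a -> S a. Proof. by case=> i hi; exists i; apply: (idS (hm i)). Qed.

Lemma N_no_inv a : N a -> a != 0 -> ~ S a^-1.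
Proof.
move=> [i hi] a0 [j hj]; apply: (loc_1 (hL (maxn i j))); rewrite -(divff a0).
apply: (idMr (hm _)); first exact: m_mono (leq_maxl _ _) _ hi.
exact: R_mono (leq_maxr _ _) _ hj.
Qed.

Lemma S_inv a : S a -> ~ N a -> S a^-1 /\ a != 0.
Proof.
move=> [i ha] na; have [|hi a0] := unit_inv ha; first by move=> h; apply: na; exists i.
by split=> //; exists i.
Qed.

(** Descending from $R_j$ to $R_k$ only inverts elements that become units once $z_k,\dots,z_{j-1}$
    do. [B] is left abstract: it is applied to a localization of $R_j$ and to $S[1/x]$. *)
Lemma fraction_rep (B : F -> Prop) k j : subring B -> (k <= j)%N -> subset_of (R j) B ->
  (forall l, (k <= l < j)%N -> B (z l)^-1) ->
  forall q, R j q -> exists a s, [/\ R k a, R k s, s != 0, B s^-1 & q = a / s].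
Proof.
move=> hB /subnKC <-; elim: (j - k)%N => [|d IH].
  rewrite addn0 => _ _ q hq; exists q, 1; split=> //; [exact: sr1|exact: oner_neq0|by rewrite invr1; mem|by rewrite divr1].
rewrite addnS; set i := (k + d)%N in IH *; move=> hRB hzB q /hrep [e [a [b [ha hb nb eq]]]].
have haR := idS (idpow_ideal e (hA i) (hm i)) ha; have hbR := idS (idpow_ideal e (hA i) (hm i)) hb.
have [hu u0] := unit_inv (hpow hb) nb.
have b0 : b != 0 by apply: contraNneq u0 => ->; rewrite mul0r.
have hzi : B (z i)^-1 by apply: hzB; rewrite leq_addr ltnSn.
have hbB : B b^-1.
  have -> : b^-1 = (b / z i ^+ e)^-1 * (z i)^-1 ^+ e by rewrite exprVn; field; rewrite zn b0.
  by have := hRB _ hu => ?; mem.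
have hzB' l : (k <= l < i)%N -> B (z l)^-1.
  by move=> /andP [h1 h2]; apply: hzB; rewrite h1 ltnS ltnW.
have {}IH := IH (fun q hq => hRB _ (hRR hq)) hzB'.
have [a1 [s1 [ha1 hs1 s10 hsB1 ea]]] := IH _ haR.
have [b1 [s2 [hb1 hs2 s20 hsB2 eb]]] := IH _ hbR.
have b10 : b1 != 0 by apply: contraNneq b0 => e1; rewrite eb e1 mul0r.
have hAk := hA k.
exists (a1 * s2), (s1 * b1); split; [mem|mem|by rewrite mulf_neq0| |].
  have -> : (s1 * b1)^-1 = s1^-1 * (b^-1 * s2^-1) by rewrite eb; field; rewrite s10 s20 b10.
  by mem.
have -> : q = a / b by rewrite -eq mulfK.
by rewrite ea eb; field; rewrite s10 s20 b10.
Qed.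

(** * Strict transforms become units *)

Section StrictTransform.
Variables (i0 : nat) (X : nat -> F) (e : nat -> nat).
Hypothesis X0 : forall i, X i != 0.
Hypothesis vXe : forall i, (i0 <= i)%N -> v i (X i) = (e i)%:Z.
Hypothesis XS : forall i, (i0 <= i)%N -> X i.+1 = X i / z i ^+ e i.

Let pi k j := \prod_(k <= l < j) z l.
(** $R_j[1/(z_k\cdots z_{j-1})]$; for $k=j$ the product is empty and this is $R_j$. *)
Let B k j q := exists n, R j (q * pi k j ^+ n).

Let pi0 k j : pi k j != 0.
Proof. by rewrite /pi; apply: (big_ind (fun q : F => q != 0)) => //; [exact: oner_neq0|exact: mulf_neq0]. Qed.
Let piR k j : R j (pi k j).
Proof.
rewrite /pi big_nat_cond; apply: (big_ind (R j)); [exact: sr1|exact: srM|].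
by move=> l /andP [/andP [_ hl] _]; apply: zR; apply: ltnW.
Qed.

Let RB k j : subset_of (R j) (B k j).
Proof. by move=> q hq; exists 0%N; rewrite expr0 mulr1. Qed.

Let Bmono k j q n n' : (n <= n')%N -> R j (q * pi k j ^+ n) -> R j (q * pi k j ^+ n').
Proof.
move=> /subnKC <- h; rewrite exprD mulrA; apply: (srM (hA j)) => //.
exact: (srX (hA j)).
Qed.

Let Bsub k j : subring (B k j).
Proof.
have h := hA j; have hp := piR k j; split.
- by apply: RB; mem.
- by apply: RB; mem.
- move=> a b [n ha] [n' hb]; exists (maxn n n'); rewrite mulrBl.
  have := Bmono (leq_maxl n n') ha; have := Bmono (leq_maxr n n') hb => ? ?; mem.
- move=> a b [n ha] [n' hb]; exists (n + n')%N; rewrite exprD mulrACA; mem.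
Qed.

Let piB k j : B k j (pi k j)^-1.
Proof. by exists 1%N; rewrite expr1 mulVf //; exact: sr1. Qed.

Let zB k j l : (k <= l < j)%N -> B k j (z l)^-1.
Proof.
move=> /andP [hkl hlj].
have epi : pi k j = z l * (pi k l * pi l.+1 j).
  by rewrite /pi (big_cat_nat (n := l)) //=; [rewrite (big_ltn hlj) mulrCA|exact: ltnW].
have -> : (z l)^-1 = (pi k l * pi l.+1 j) * (pi k j)^-1.
  rewrite epi; have := pi0 k l; have := pi0 l.+1 j => h1 h2; field; by rewrite h1 h2 z0.
apply: (srM (Bsub k j)) => //; apply: RB; apply: (srM (hA j)) => //.
exact: (R_mono (ltnW hlj)).
Qed.

Let X_prod i j : (i0 <= i)%N -> (i <= j)%N -> X i = X j * \prod_(i <= l < j) z l ^+ e l.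
Proof.
move=> hi /subnKC <-; elim: (j - i)%N => [|d IH]; first by rewrite addn0 big_geq // mulr1.
rewrite addnS IH big_nat_recr ?leq_addr //= XS; last by rewrite (leq_trans hi) ?leq_addr.
rewrite [X in _ = _ / _ * X]mulrC mulrA divfK //.
Qed.

(** If $z_k$ is not yet a unit in [B k.+1 j], every unit of that ring lying in $R_j$ has order 0 for
    [v k]. As $X_j$ also has order 0, the element $X_j^{-1}(z_k\cdots z_{j-1})^n$ has order exactly
    [n], so it is divisible by $z_k^n$ and the factor $z_k^n$ drops out. *)
Let step k j : (i0 <= k)%N -> (k < j)%N -> B k j (X j)^-1 -> B k.+1 j (X j)^-1.
Proof.
move=> hik hkj [n ht]; have hB := Bsub k.+1 j; have hRB : subset_of (R j) (B k.+1 j) := @RB k.+1 j.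
have epi : pi k j = z k * pi k.+1 j by rewrite /pi big_ltn.
have hpB := piB k.+1 j.
case: (classic (B k.+1 j (z k)^-1)) => hzk.
  have -> : (X j)^-1 = ((X j)^-1 * pi k j ^+ n) * ((z k)^-1 ^+ n * (pi k.+1 j)^-1 ^+ n).
    by rewrite -exprMn -invfM -epi exprVn mulfK // expf_neq0.
  by have := hRB _ ht => ?; mem.
have hrepB := @fraction_rep (B k.+1 j) k.+1 j hB hkj hRB (@zB k.+1 j).
(* A denominator of positive order would be divisible by $z_k$ in $R_{k+1}$ and would make $z_k$
   invertible. *)
have vs s : R k.+1 s -> s != 0 -> B k.+1 j s^-1 -> v k s = 0.
  move=> hs s0 hsB; apply: NNPP => hne; apply: hzk.
  have h1 : 1 <= v k s by have := hge hs s0; lia.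
  have -> : (z k)^-1 = (s / z k) * s^-1 by field; rewrite s0 z0.
  by have := hRB _ (R_mono hkj (hdiv hs s0 h1)) => ?; mem.
have vunit q : R j q -> q != 0 -> B k.+1 j q^-1 -> v k q = 0.
  move=> hq q0 hqB; have [a [s [ha hs s0 hsB eq]]] := hrepB q hq.
  have a0 : a != 0 by apply: contraNneq q0 => e1; rewrite eq e1 mul0r.
  rewrite eq vM ?invr_eq0 // vV // (vs s) // (vs a) //.
  have -> : a^-1 = q^-1 * s^-1 by rewrite eq; field; rewrite a0 s0.
  by mem.
have vz' l : (k < l < j)%N -> v k (z l) = 0.
  move=> hl; apply: vunit => //; last exact: zB.
  by apply: zR; lia.
have vprod (f : nat -> nat) : v k (\prod_(k.+1 <= l < j) z l ^+ f l) = 0 /\ \prod_(k.+1 <= l < j) z l ^+ f l != 0.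
  rewrite big_nat_cond; apply: (big_ind (fun q => v k q = 0 /\ q != 0)).
  - by rewrite v1 oner_neq0.
  - by move=> a b [ea a0] [eb b0]; rewrite vM // ea eb mulf_neq0.
  - by move=> l /andP [hl _]; rewrite vX // vz' // mulr0 zn.
have vpi : v k (pi k.+1 j) = 0 by apply: vunit.
have vXj : v k (X j) = 0.
  have : v k (X k.+1) = 0.
    by rewrite XS // vM ?invr_eq0 ?zn // vV // vX // vz vXe //; lia.
  rewrite (@X_prod k.+1 j) //; last by lia.
  by have [h1 h2] := vprod e; rewrite vM // h1; lia.
set t := (X j)^-1 * _ in ht.
have t0 : t != 0 by rewrite mulf_neq0 ?invr_eq0 ?expf_neq0.
have vt : v k t = n%:Z.
  rewrite vM ?invr_eq0 ?expf_neq0 // vV // vXj vX // epi vM // vz vpi; lia.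
have [a [s [ha hs s0 hsB et]]] := hrepB t ht.
have a0 : a != 0 by apply: contraNneq t0 => e1; rewrite et e1 mul0r.
have va : v k a = n%:Z by rewrite -vt et vM ?invr_eq0 // vV // (vs s) //; lia.
have haz l : (l <= n)%N -> R k.+1 (a / z k ^+ l).
  elim: l => [|l IH] hl; first by rewrite expr0 divr1.
  have -> : a / z k ^+ l.+1 = a / z k ^+ l / z k by rewrite exprS; field; rewrite zn z0.
  apply: hdiv; [apply: IH; lia|by rewrite mulf_neq0 ?invr_eq0 ?zn|].
  rewrite vM ?invr_eq0 ?zn // vV ?zn // vX // vz va; lia.
have -> : (X j)^-1 = (a / z k ^+ n) * s^-1 * (pi k.+1 j)^-1 ^+ n.
  rewrite [a / _ / s]mulrAC -et exprVn /t epi exprMn.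
  by have := zn k n; have := expf_neq0 n (pi0 k.+1 j) => h1 h2; field; rewrite h1 h2 X0.
by have := hRB _ (R_mono hkj (haz n (leqnn n))) => ?; mem.
Qed.

(** In any $R_j$ with $j>i_0$ containing the quotient, $X_j^{-1}$ lies in [B i0 j]; applying [step]
    for each [k] brings it into [B j j], which is $R_j$. *)
Lemma strict_transform_unit n : S (z i0 ^+ n / X i0) -> exists i, (i0 <= i)%N /\ ~ m i (X i).
Proof.
move=> [j0 hj0]; apply: NNPP => hno.
pose j := maxn j0 i0.+1.
have hij : (i0 < j)%N by rewrite leq_maxr.
have hj : R j (z i0 ^+ n / X i0) by apply: R_mono hj0; exact: leq_maxl.
have hm' : m j (X j) by apply: NNPP => h; apply: hno; exists j; split=> //; apply: ltnW.
have start : B i0 j (X j)^-1.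
  exists n; have epi : pi i0 j = z i0 * pi i0.+1 j by rewrite /pi big_ltn.
  have -> : (X j)^-1 * pi i0 j ^+ n = (z i0 ^+ n / X i0) * (\prod_(i0 <= l < j) z l ^+ e l) * pi i0.+1 j ^+ n.
    rewrite epi exprMn {1}(@X_prod i0 j) //; last exact: ltnW.
    have : \prod_(i0 <= l < j) z l ^+ e l != 0 by apply: (big_ind (fun q : F => q != 0)) => //; [exact: oner_neq0|exact: mulf_neq0].
    by move=> h; field; rewrite h X0.
  have hj' := hA j; apply: (srM hj'); last by apply: (srX hj').
  apply: (srM hj') => //; rewrite big_nat_cond; apply: (big_ind (R j)); [exact: sr1|exact: srM|].
  by move=> l /andP [/andP [_ hl] _]; apply: (srX hj'); apply: zR; apply: ltnW.
have all_k k : (i0 + k <= j)%N -> B (i0 + k)%N j (X j)^-1.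
  elim: k => [|k IH] hk; first by rewrite addn0.
  by rewrite addnS; apply: step; [exact: leq_addr|lia|apply: IH; lia].
have := all_k (j - i0)%N; rewrite subnKC ?(ltnW hij) // => /(_ (leqnn j)) [n'].
rewrite /pi big_geq // expr1n mulr1 => hinv; apply: (loc_1 (hL j)).
by rewrite -(mulfV (X0 j)); apply: (idMr (hm j)).
Qed.

End StrictTransform.

(* The minimum [r i] of the orders of numerator and denominator of [q], after cancelling powers
   of the [z i], never increases; once it is constant, a denominator attaining it keeps doing so. *)
Lemma eventually_comparable q : q != 0 ->
  (exists i0, forall i, (i0 <= i)%N -> 0 <= v i q) \/ (exists i0, forall i, (i0 <= i)%N -> v i q <= 0).
Proof.
move=> q0; have [a [b [ha hb b0 eq]]] := hF 0 q.
pose rr i w := `|Num.min (v i (q * w)) (v i w)|%N.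
pose f := fix f i := match i with 0 => b | i'.+1 => f i' / z i' ^+ rr i' (f i') end.
have fP i : [/\ f i != 0, R i (f i) & R i (q * f i)].
  elim: i => [|i [h0 h1 h2]] /=; first by split=> //; rewrite eq divfK.
  have qf0 : q * f i != 0 by rewrite mulf_neq0.
  have p1 := vR h1 h0; have p2 := vR h2 qf0.
  split; first by rewrite mulf_neq0 ?invr_eq0 ?zn.
    by apply: hpow; apply/vpow => //; rewrite /rr; lia.
  by rewrite mulrA; apply: hpow; apply/vpow => //; rewrite /rr; lia.
pose r i := rr i (f i).
have rE i : (r i)%:Z = Num.min (v i (q * f i)) (v i (f i)).
  have [h0 h1 h2] := fP i; have qf0 : q * f i != 0 by rewrite mulf_neq0.
  by have p1 := vR h1 h0; have p2 := vR h2 qf0; rewrite /r /rr; lia.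
have db i : v i (f i) = (r i)%:Z -> v i.+1 (f i.+1) <= (r i)%:Z.
  by move=> e; have [h0 h1 h2] := fP i; apply: (hdrop h1 h0 e).
have da i : v i (q * f i) = (r i)%:Z -> v i.+1 (q * f i.+1) <= (r i)%:Z.
  by move=> e; have [h0 h1 h2] := fP i; rewrite /= mulrA; apply: (hdrop h2 _ e); rewrite mulf_neq0.
have rS i : (r i.+1 <= r i)%N.
  by have := rE i; have := rE i.+1; have := da i; have := db i; lia.
have [i1 hi1] : exists i1, forall i, (i1 <= i)%N -> r i = r i1.
  suff H n i : (r i < n)%N -> exists i1, forall i, (i1 <= i)%N -> r i = r i1 by exact: (H _ 0%N (ltnSn _)).
  elim: n i => // n IH i hn.
  case: (classic (exists j, (i <= j)%N /\ (r j < r i)%N)) => [[j [hij hj]]|h].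
    by apply: (IH j); lia.
  exists i => j hij; have hle : (r j <= r i)%N.
    by move: hij => /subnKC <-; elim: (j - i)%N => [|d IHd]; rewrite ?addn0 // addnS; exact: leq_trans (rS _) IHd.
  by apply/eqP; rewrite eqn_leq hle leqNgt; apply/negP => hlt; apply: h; exists j.
have vq i : v i q = v i (q * f i) - v i (f i).
  by have [h0 _ _] := fP i; rewrite vM //; lia.
(* If the denominator never attains the minimum from [i1] on, the numerator does, and [q] has
   nonpositive order there. *)
case: (classic (exists i, (i1 <= i)%N /\ v i (f i) = (r i)%:Z)) => [[i [hi e]]|h]; last first.
  right; exists i1 => i hi; have : ~ v i (f i) = (r i)%:Z by move=> e; apply: h; exists i.
  by have := rE i; rewrite vq; lia.
left; exists i => j /subnKC <-.
suff : v (i + (j - i))%N (f (i + (j - i))%N) = (r (i + (j - i))%N)%:Z by rewrite vq; have := rE (i + (j - i))%N; lia.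
elim: (j - i)%N => [|d IH]; first by rewrite addn0.
rewrite addnS; have := db _ IH; have := rE (i + d).+1.
have := hi1 (i + d).+1; have := hi1 (i + d)%N; lia.
Qed.

(** * The hull, the boundary valuation ring and the implications *)

Section PrimaryElement.
Variable x : F.
Hypotheses (hxS : S x) (hxprim : primary_to S N (principal S x)).

Let xN : N x.
Proof. by apply/hxprim; split=> //; exists 1%N; rewrite expr1; exact: principal_self. Qed.

Let N_pow y : N y -> exists n s, S s /\ y ^+ n = x * s.
Proof. by move=> /hxprim [_ [n [s [hs e]]]]; exists n, s. Qed.

Let x0 : x != 0.
Proof.
apply/eqP => e0; have [|n [s [_ e]]] := @N_pow (z 0); first by exists 0%N.
by move/eqP: (zn 0 n); rewrite e e0 mul0r.
Qed.
Let xn n : x ^+ n != 0. Proof. by rewrite expf_neq0. Qed.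
Let vxn i q n : q != 0 -> v i (q / x ^+ n) = v i q - n%:Z * v i x.
Proof. by move=> q0; rewrite vM ?invr_eq0 // vV // vX. Qed.

Let x_ev : exists i0, forall i, (i0 <= i)%N -> m i x.
Proof. by have [i0 h] := xN; exists i0 => i hi; apply: m_mono h. Qed.

Definition inv_x q := exists k, S (q * x ^+ k).

Let Tsub : subring inv_x.
Proof.
have le q k k' : (k <= k')%N -> S (q * x ^+ k) -> S (q * x ^+ k').
  by move=> /subnKC <- h; rewrite exprD mulrA; mem.
split.
- by exists 0%N; rewrite mul0r; mem.
- by exists 0%N; rewrite expr0 mulr1; mem.
- move=> a b [k ha] [k' hb]; exists (maxn k k'); rewrite mulrBl.
  have := le _ _ _ (leq_maxl k k') ha; have := le _ _ _ (leq_maxr k k') hb => ? ?; mem.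
- move=> a b [k ha] [k' hb]; exists (k + k')%N; rewrite exprD mulrACA; mem.
Qed.
Let S_T : subset_of S inv_x. Proof. by move=> q hq; exists 0%N; rewrite expr0 mulr1. Qed.
Let xV_T : inv_x x^-1. Proof. by exists 1%N; rewrite expr1 mulVf //; mem. Qed.

(** If [w x] is positive, [w] is positive on all of [N], because each element of [N] has a power
    divisible by [x]. Then every element of [V] already lies in [S], against proper inclusion. *)
Lemma dvr_has_inv (V : F -> Prop) : is_DVR V -> proper_subset S V -> V x^-1.
Proof.
move=> [hV [w [wM wD wsurj wV]]] [hSV [q [hq nq]]]; apply: NNPP => hnx; apply: nq.
have w1 : w 1 = 0.
  have := wM 1 1 (oner_neq0 F) (oner_neq0 F); rewrite mulr1; move: (w 1) => ?; lia.
have wi a : a != 0 -> w a^-1 = - w a.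
  by move=> a0; have := wM a a^-1 a0; rewrite invr_eq0 divff // w1 => /(_ a0); lia.
have wX a n : a != 0 -> w (a ^+ n) = n%:Z * w a.
  move=> a0; elim: n => [|n IH]; first by rewrite expr0 w1 mul0r.
  by rewrite exprS wM ?expf_neq0 // IH; lia.
have wS a : S a -> a != 0 -> 0 <= w a.
  by move=> /hSV /wV [->|[]//]; rewrite eqxx.
have wx : 1 <= w x.
  have : ~ (0 <= w x^-1) by move=> h; apply: hnx; apply/wV; right; rewrite invr_eq0.
  by rewrite wi //; lia.
have wN y : N y -> y != 0 -> 1 <= w y.
  move=> hy y0; have [n [s [hs e]]] := N_pow hy.
  have s0 : s != 0.
    by apply/eqP => s0; move/eqP: (expf_neq0 n y0); rewrite e s0 mulr0.
  have h1 := wX y n y0; rewrite e wM // in h1; have h2 := wS s hs s0.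
  have := wS _ (N_S hy) y0; case: (w y) h1 => // -[|k] // h1 _; lia.
have red i a b : R i a -> R i b -> (m i b -> S (a / b)) -> S (a / b).
  move=> ha hb h; case: (classic (m i b)) => // /(unit_inv hb) [hinv _].
  by exists i; apply: (srM (hA i)).
(* While [b] is a nonunit so is [a], and dividing both by [z i] moves to the next ring and lowers
   [w b]; the induction bound is the value of the denominator. *)
have key k : forall i a b, R i a -> R i b -> a != 0 -> b != 0 -> w b <= k%:Z -> w b <= w a -> S (a / b).
  elim: k => [|k IH] i a b ha hb a0 b0 hbk hba; apply: (red i) => // hbm.
    have : 1 <= w b by apply: wN => //; exists i.
    by lia.
  have wb : 1 <= w b by apply: wN => //; exists i.
  have ham : m i a.
    apply: NNPP => na; have [hinv _] := unit_inv ha na.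
    have : 0 <= w a^-1 by apply: wS; [exists i|rewrite invr_eq0].
    by rewrite wi //; lia.
  have hdv c : m i c -> R i.+1 (c / z i).
    by move=> hc; rewrite -[z i]expr1; apply: hpow; rewrite idpow1.
  have wz : 1 <= w (z i) by apply: wN => //; exists i.
  have -> : a / b = (a / z i) / (b / z i) by field; rewrite b0 z0.
  apply: (IH i.+1); rewrite ?mulf_neq0 ?invr_eq0 //; [exact: hdv|exact: hdv| |].
    by rewrite wM ?invr_eq0 // wi //; lia.
  by rewrite (wM a) ?(wM b) ?invr_eq0 //; lia.
case: (eqVneq q 0) => [->|q0]; first by mem.
have [a [b [ha hb b0 e]]] := hF 0 q.
have a0 : a != 0 by apply: contraNneq q0 => e1; rewrite e e1 mul0r.
rewrite e; apply: (key `|w b|%N 0%N) => //; first by lia.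
move/wV: hq => [/eqP|[_]]; first by rewrite (negbTE q0).
by rewrite e wM ?invr_eq0 // wi //; lia.
Qed.

Lemma hull_eq : noetherian_hull S = inv_x.
Proof.
apply: set_ext => q; split; last first.
  move=> [k hk] V hV hSV; have hx := dvr_has_inv hV hSV; have hVr : subring V by case: hV.
  have -> : q = (q * x ^+ k) * x^-1 ^+ k by rewrite exprVn mulfK.
  by have := proj1 hSV _ hk => ?; mem.
move=> hq; apply: NNPP => nq.
have [i0 hi0] := x_ev.
pose M s := [/\ R i0 s, s != 0 & inv_x s^-1].
have hM : mult_set (R i0) M.
  split.
  - by move=> s [].
  - by split; [exact: sr1|exact: oner_neq0|rewrite invr1; mem].
  - by case=> _; rewrite eqxx.
  - move=> a b [ha a0 hTa] [hb b0 hTb]; split; [exact: (srM (hA i0))|by rewrite mulf_neq0|].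
    by rewrite invfM; mem.
have hR_T i : subset_of (R i) inv_x by move=> t ht; apply: S_T; exists i.
have eT : inv_x = fracs (R i0) M.
  apply: set_ext => t; split; last first.
    by case=> a [s [ha [hs s0 hTs] ->]]; have := hR_T _ _ ha => ?; mem.
  (* For [l] at least [i0], [x] lies in [m l] and is divisible by [z l] in the next ring, so
     inverting [x] inverts every [z l]. *)
  have hR : forall j, (i0 <= j)%N -> forall u, R j u -> fracs (R i0) M u.
    move=> j hj u hu; have [|a [s [ha hs s0 hTs e]]] := fraction_rep Tsub hj (@hR_T j) _ hu.
      move=> l /andP [hl _].
      have -> : (z l)^-1 = (x / z l) * x^-1 by field; rewrite x0 z0.
      apply: (srM Tsub) => //; apply: (hR_T l.+1).
      by rewrite -[z l]expr1; apply: hpow; rewrite idpow1 //; apply: hi0.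
    by exists a, s.
  move=> [k [j hj]].
  have hf := fracs_subring (hA i0) hM.
  have -> : t = (t * x ^+ k) * x^-1 ^+ k by rewrite exprVn mulfK.
  apply: (srM hf); first by apply: (hR (maxn i0 j)); [exact: leq_maxl|exact: R_mono (leq_maxr _ _) _ hj].
  apply: (srX hf); apply: (fracs_inv (hA i0) hM); split=> //.
  exact: (idS (hm i0) (hi0 _ (leqnn i0))).
have hst := fracs_stable_closed (hA i0) (@hN i0) hM (@hcic i0).
have hTN := fracs_noeth (hA i0) hM (@hN i0).
rewrite -eT in hst hTN.
have hTF : frac_field inv_x.
  by move=> t; have [a [b [ha hb b0 e]]] := hF i0 t; exists a, b; split=> //; apply: hR_T; [exact: ha|exact: hb].
have [V [hV hTV nVq]] := dvr_avoiding Tsub hTN hTF hst nq.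
apply: nVq; apply: hq => //; split; first by move=> t /S_T /hTV.
exists x^-1; split; first exact: hTV.
exact: N_no_inv.
Qed.

Let evpos q := exists i0, forall i, (i0 <= i)%N -> 0 <= v i q.

(* This is [S = V /\ T]: cancelling the parameters [z i] from numerator and denominator of
   [q = (q x^k) / x^k], the denominator eventually becomes a unit. *)
Lemma hull_evpos q : inv_x q -> q != 0 -> evpos q -> S q.
Proof.
move=> [k [j1 hk]] q0 [j2 hpos]; have [j3 hx3] := hxS.
pose i0 := maxn j1 (maxn j2 j3).
pose X0 := x ^+ k.
(* The denominator is divided by its full order at each stage; the numerator admits the same
   division because [q] has nonnegative order from [i0] on. *)
pose f := fix f d := match d with 0 => X0 | d'.+1 => f d' / z (i0 + d') ^+ `|v (i0 + d')%N (f d')|%N end.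
have fP d : [/\ f d != 0, R (i0 + d)%N (f d) & R (i0 + d)%N (q * f d)].
  elim: d => [|d [h0 h1 h2]].
    rewrite addn0; split; first exact: xn.
      by apply: (srX (hA _)); apply: R_mono hx3; rewrite /i0; lia.
    by apply: R_mono hk; rewrite /i0; lia.
  have qf0 : q * f d != 0 by rewrite mulf_neq0.
  have p1 := vR h1 h0; have p2 : 0 <= v (i0 + d)%N q by apply: hpos; rewrite /i0; lia.
  have e1 := vM (i0 + d)%N q0 h0.
  have eabs : `|v (i0 + d)%N (f d)|%N%:Z = v (i0 + d)%N (f d) by rewrite gez0_abs.
  have -> : f d.+1 = f d / z (i0 + d) ^+ `|v (i0 + d)%N (f d)|%N by [].
  rewrite addnS; split; first by rewrite mulf_neq0 ?invr_eq0 ?zn.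
    by apply: hpow; apply/vpow => //; rewrite eabs.
  by rewrite mulrA; apply: hpow; apply/vpow => //; rewrite eabs e1 lerDr.
pose X i := f (i - i0)%N.
pose e i := `|v i (X i)|%N.
have hXP i : (i0 <= i)%N -> [/\ X i != 0, R i (X i) & R i (q * X i)].
  by move=> hi; have := fP (i - i0)%N; rewrite subnKC.
(* Here primariness enters: [x] divides a power of [z i0], so [x ^+ k] divides the power with
   exponent [n * k]. *)
have [n [s [hs es]]] : exists n s, S s /\ z i0 ^+ n = x * s by apply: N_pow; exists i0.
have [| | | | i [hi nm]] := @strict_transform_unit i0 X e _ _ _ (n * k)%N.
- by move=> i; case: (fP (i - i0)%N).
- by move=> i /hXP [h0 h1 _]; have := vR h1 h0; rewrite /e; lia.
- by move=> i hi; rewrite /X subSn // /= subnKC.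
- have -> : z i0 ^+ (n * k) / X i0 = s ^+ k; last by mem.
  by rewrite /X subnn /= /X0 exprM es exprMn mulrC mulKf ?xn.
have [h0 h1 h2] := hXP i hi; have [hinv _] := unit_inv h1 nm.
have -> : q = (q * X i) * (X i)^-1 by rewrite mulfK.
by exists i; apply: (srM (hA i)).
Qed.

Local Notation V := (boundary_val_ring R m).

Lemma boundaryE q : V q <-> q = 0 \/ (q != 0 /\ evpos q).
Proof.
have ordE i w : w != 0 -> ord_nonneg (R i) (m i) w <-> 0 <= v i w.
  move=> w0; have [h _ _ _] := hv i; split.
    case=> [e|[u [/h [_ ->] //]]]; by rewrite e eqxx in w0.
  by move=> hw; right; exists (v i w); split=> //; apply/h.
case: (eqVneq q 0) => [->|q0].
  by split=> _; [left|exists 0%N => i _; left].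
split.
  by move=> [i0 h]; right; split=> //; exists i0 => i /h /ordE; apply.
case=> [e|[_ [i0 h]]]; first by rewrite e eqxx in q0.
by exists i0 => i /h h'; apply/ordE.
Qed.

Let V_S : subset_of S V.
Proof.
move=> q [j hj]; apply/boundaryE; case: (eqVneq q 0) => [->|q0]; [by left|right; split=> //].
by exists j => i hi; apply: vR => //; apply: R_mono hj.
Qed.

Lemma V_subring : subring V.
Proof.
have vN i a : a != 0 -> v i (- a) = v i a.
  move=> a0; have n0 : -1 != 0 :> F by rewrite oppr_eq0 oner_neq0.
  have := vM i n0 n0; rewrite mulrNN mulr1 v1 => h.
  by rewrite -mulN1r vM //; lia.
split.
- by apply: V_S; mem.
- by apply: V_S; mem.
- move=> a b /boundaryE ha /boundaryE hb; apply/boundaryE.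
  case: ha hb => [->|[a0 [i ha]]] [->|[b0 [j hb]]].
  + by left; rewrite subr0.
  + by right; rewrite sub0r oppr_eq0; split=> //; exists j => l /hb; rewrite vN.
  + by right; rewrite subr0; split=> //; exists i.
  case: (eqVneq (a - b) 0) => [->|ab0]; [by left|right; split=> //].
  exists (maxn i j) => l; rewrite geq_max => /andP [/ha h1 /hb h2].
  have nb0 : - b != 0 by rewrite oppr_eq0.
  by have := vD l a0 nb0 ab0; rewrite vN //; lia.
- move=> a b /boundaryE ha /boundaryE hb; apply/boundaryE.
  case: ha hb => [->|[a0 [i ha]]] [->|[b0 [j hb]]]; rewrite ?mul0r ?mulr0; try by left.
  right; rewrite mulf_neq0 //; split=> //.
  exists (maxn i j) => l; rewrite geq_max => /andP [/ha h1 /hb h2].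
  by rewrite vM //; lia.
Qed.
Let hV := V_subring.

Let not_evpos q : q != 0 -> ~ evpos q -> exists i0, forall i, (i0 <= i)%N -> v i q <= 0.
Proof. by move=> q0 h; case: (eventually_comparable q0). Qed.

(** By comparability both quotients have order at most 0 for large [i], and one more factor [x] has
    order at least 1. *)
Let ab_contra a b n k : a != 0 -> b != 0 -> ~ evpos (a / x ^+ n) -> ~ evpos (b / x ^+ k) ->
  ~ evpos (a * b / x ^+ (n + k).+1).
Proof.
move=> a0 b0 ha hb [i3 h3].
have [|i1 h1] := not_evpos _ ha; first by rewrite mulf_neq0 ?invr_eq0.
have [|i2 h2] := not_evpos _ hb; first by rewrite mulf_neq0 ?invr_eq0.
have [i4 h4] := x_ev.
pose i := maxn (maxn i1 i2) (maxn i3 i4).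
have := h1 i; have := h2 i; have := h3 i; have := vm (h4 i _) x0.
rewrite !vxn ?mulf_neq0 // vM // => p4 p3 p2 p1.
have {}p1 : v i a - n%:Z * v i x <= 0 by apply: p1; rewrite /i; lia.
have {}p2 : v i b - k%:Z * v i x <= 0 by apply: p2; rewrite /i; lia.
have {}p3 : 0 <= v i a + v i b - (n + k).+1%:Z * v i x by apply: p3; rewrite /i; lia.
have {}p4 : 1 <= v i x by apply: p4; rewrite /i; lia.
nia.
Qed.

Local Notation P := (power_intersection S x).
Local Notation nz := (exists q, P q /\ q != 0).

Let PS q : P q -> S q.
Proof. by move=> /(_ 1%N isT) [s [hs ->]]; rewrite expr1; mem. Qed.
Let P_div q n : P q -> S (q / x ^+ n).
Proof.
case: n => [|n] h; first by rewrite expr0 divr1; apply: PS.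
by have [s [hs ->]] := h n.+1 isT; rewrite mulrC mulKf.
Qed.
Let div_P q : (forall n, (0 < n)%N -> S (q / x ^+ n)) -> P q.
Proof. by move=> h n hn; exists (q / x ^+ n); split; [exact: h|rewrite mulrC divfK]. Qed.

(** A nonunit [a] lies in [N], so a power of it is a multiple of [x]; hence divisibility by all
    powers of [a] gives divisibility by all powers of [x]. *)
Lemma arch_nz : ~ archimedean S <-> nz.
Proof.
split=> [hna|[q [hq q0]] harch]; last first.
  move/eqP: q0; apply; apply: (harch x) => //.
  case=> _ [y [hy e]]; apply: (N_no_inv xN x0).
  by have -> : x^-1 = y by apply: (mulfI x0); rewrite divff.
apply: NNPP => hno; apply: hna => a ha nu q hq; apply: NNPP => /eqP q0; apply: hno.
exists q; split=> // n hn.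
have aN : N a.
  apply: NNPP => na; have [hi a0] := S_inv ha na; apply: nu; split=> //.
  by exists a^-1; rewrite divff.
have [[|k] [s [hs e]]] := N_pow aN.
  case: (N_no_inv xN x0); have -> : x^-1 = s by apply: (mulfI x0); rewrite divff.
  by [].
have [|t [ht ->]] := hq (k.+1 * n)%N; first by rewrite muln_gt0.
by exists (s ^+ n * t); split; [mem|rewrite exprM e exprMn mulrA].
Qed.

(** An element divisible by every power of [x] is a common denominator for $S[1/x]$. *)
Lemma nz_fractional : nz -> fractional_ideal S (noetherian_hull S).
Proof.
move=> [q [hq q0]]; rewrite hull_eq; split.
- by mem.
- by move=> a b ha hb; mem.
- by move=> a b /S_T ha hb; mem.
exists q; split=> //; first exact: PS.
move=> t [k hk]; have -> : q * t = (q / x ^+ k) * (t * x ^+ k) by field.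
by have := P_div k hq => ?; mem.
Qed.

Lemma adjoinE t q : adjoin S t q <-> exists p : {poly F}, (forall i, S p`_i) /\ q = p.[t].
Proof.
split.
  move=> [k [c [hc ->]]].
  exists (\poly_(j < k) (if insub j is Some j' then c j' else 0)); split.
    by move=> i; rewrite coef_poly; case: ltnP => // hi; [case: insubP => // *; mem|mem].
  rewrite horner_poly; apply: eq_bigr => j _.
  by rewrite valK.
by move=> [p [hp ->]]; exists (size p), (fun i => p`_i); split=> //; rewrite horner_coef.
Qed.

Lemma fractional_cic : fractional_ideal S (noetherian_hull S) ->
  set_eq (complete_int_closure S) (noetherian_hull S).
Proof.
move=> [_ _ _ [d [hd d0 hdT]]] t; split.
  move=> [_ _ _ [c [hc c0 h]]] W hW [hSW _].
  have {}h n : S (c * t ^+ n).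
    apply: h; apply/adjoinE; exists 'X^n; split; last by rewrite hornerXn.
    by move=> i; rewrite coefXn; mem.
  case: hW => hWr [w [wM _ _ wV]]; apply/wV.
  case: (eqVneq t 0) => [->|t0]; [by left|right; split=> //].
  have w1 : w 1 = 0.
    have := wM 1 1 (oner_neq0 F) (oner_neq0 F); rewrite mulr1; move: (w 1) => ?; lia.
  have wX n : w (t ^+ n) = n%:Z * w t.
    elim: n => [|n IH]; first by rewrite expr0 w1 mul0r.
    by rewrite exprS wM ?expf_neq0 // IH; lia.
  rewrite leNgt; apply/negP => hneg.
  (* With [w t] at most -1, this exponent already makes the value of [c * t ^+ n] negative. *)
  have /wV [/eqP|[_]] := hSW _ (h `|w c|.+1%N); first by rewrite mulf_eq0 (negbTE c0) expf_eq0 (negbTE t0) andbF.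
  rewrite wM ?expf_neq0 // wX; nia.
move=> ht; rewrite hull_eq in ht hdT.
have hAT q : adjoin S t q -> inv_x q.
  by move=> [k [c [hc ->]]]; apply: sr_sum => // j _; have := S_T (hc j) => ?; mem.
split.
- by apply/adjoinE; exists 0; split; [move=> i; rewrite coef0; mem|rewrite horner0].
- move=> a b /adjoinE [p [hp ->]] /adjoinE [p' [hp' ->]]; apply/adjoinE; exists (p + p').
  by rewrite hornerD; split=> // i; rewrite coefD; apply: (srD hS).
- move=> a b ha /adjoinE [p [hp ->]]; apply/adjoinE; exists (a *: p).
  by rewrite hornerZ; split=> // i; rewrite coefZ; apply: (srM hS).
- by exists d; split=> // q /hAT; apply: hdT.
Qed.

(** Tested on $1/x$: a common denominator of its powers is divisible by every power of [x]. *)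
Lemma cic_nz : set_eq (complete_int_closure S) (noetherian_hull S) -> nz.
Proof.
move=> h; have : noetherian_hull S x^-1 by rewrite hull_eq.
move=> /h [_ _ _ [d [hd d0 hdd]]]; exists d; split=> //; apply: div_P => n _.
rewrite -exprVn; apply: hdd; apply/adjoinE; exists 'X^n; split; last by rewrite hornerXn.
by move=> i; rewrite coefXn; mem.
Qed.

(** The prime is $\bigcap_n x^nV$. It misses [x], as $1/x$ is not in $V$, and this one fact rules
    out both the maximal ideal and contraction to [N]. *)
Lemma nz_boundary_prime : nz -> exists Q : F -> Prop,
  [/\ is_prime V Q, (exists q, Q q /\ q != 0), ~ set_eq Q (nonunits V) &
      ~ set_eq (fun q => Q q /\ S q) N].
Proof.
move=> [q [hq q0]]; pose Q t := forall n, V (t / x ^+ n).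
have nV : ~ V x^-1.
  move/boundaryE; case=> [/eqP|[_ [i1 h1]]]; first by rewrite invr_eq0 (negbTE x0).
  have [i2 h2] := x_ev; have := h1 (maxn i1 i2) (leq_maxl _ _).
  by have := vm (h2 (maxn i1 i2) (leq_maxr _ _)) x0; rewrite vV //; lia.
have Qx : ~ Q x.
  by move/(_ 2%N); rewrite (_ : x / x ^+ 2 = x^-1) //; field.
exists Q; split.
- split.
    split.
    + by move=> t /(_ 0%N); rewrite expr0 divr1.
    + by move=> n; rewrite mul0r; mem.
    + by move=> a b ha hb n; rewrite mulrDl; have := ha n; have := hb n => ? ?; mem.
    + by move=> a b ha hb n; rewrite -mulrA; have := hb n => ?; mem.
  + by move/(_ 1%N); rewrite expr1 mul1r.
  move=> a b ha hb hab.
  case: (eqVneq a 0) => [->|a0]; first by left=> n; rewrite mul0r; mem.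
  case: (eqVneq b 0) => [->|b0]; first by right=> n; rewrite mul0r; mem.
  apply: NNPP => /not_or_and [/not_all_ex_not [n na] /not_all_ex_not [k nb]].
  have nev c l : ~ V (c / x ^+ l) -> c != 0 -> ~ evpos (c / x ^+ l).
    by move=> h c0 h'; apply: h; apply/boundaryE; right; rewrite mulf_neq0 ?invr_eq0.
  apply: (ab_contra a0 b0 (nev _ _ na a0) (nev _ _ nb b0)).
  have /boundaryE [/eqP|[]//] := hab (n + k).+1.
  by rewrite !mulf_eq0 invr_eq0 (negbTE a0) (negbTE b0) (negbTE (xn _)).
- by exists q; split=> // n; apply: V_S; apply: P_div.
- move=> h; apply: Qx; apply/h; split; first exact: V_S.
  case=> _ [y [hy e]]; apply: nV.
  by have -> : x^-1 = y by apply: (mulfI x0); rewrite divff.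
- by move=> /(_ x) [_ /(_ xN) []].
Qed.

Local Notation grows := (exists y : F, [/\ R 0%N y, y != 0 &
         forall n : nat, (0 < n)%N -> exists i0 : nat, forall i : nat, (i0 <= i)%N ->
           forall vy vx : int, ordF (R i) (m i) y vy -> ordF (R i) (m i) x vx ->
             n%:Z * vx <= vy]).

(** A prime containing [x] would contract to [N], so [x] is outside [Q]. For [a] in [Q], if $a/x^n$
    were not in the valuation ring, [a] would divide $x^n$ there and put [x] into [Q]. Clearing a
    denominator brings [a] into [R 0]. *)
Lemma boundary_prime_grows : (exists Q : F -> Prop,
  [/\ is_prime V Q, (exists q, Q q /\ q != 0), ~ set_eq Q (nonunits V) &
      ~ set_eq (fun q => Q q /\ S q) N]) -> grows.
Proof.
move=> [Q [hQ [q [hq q0]] _ hlie]]; have hQI := prI hQ.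
have nx : ~ Q x.
  move=> hx; apply: hlie => y; split.
    move=> [hy hyS]; apply: NNPP => ny; have [hi y0] := S_inv hyS ny.
    by apply: (pr1 hQ); rewrite -(divff y0); have := V_S hi => ?; mem.
  move=> hy; split; last exact: N_S.
  have [n [s [hs e]]] := N_pow hy.
  apply: (prX (n := n) hV hQ); first exact: V_S (N_S hy).
  by rewrite e; have := V_S hs => ?; mem.
have [a [b [ha hb b0 e]]] := hF 0 q.
have ea : a = q * b by rewrite e divfK.
have a0 : a != 0 by rewrite ea mulf_neq0.
have hbV : V b by apply: V_S; exists 0%N.
have haQ : Q a by rewrite ea; mem.
exists a; split=> // n _.
have [i0 h0] : evpos (a / x ^+ n).
  apply: NNPP => hne; apply: nx.
  have [|i0 h0] := not_evpos _ hne; first by rewrite mulf_neq0 ?invr_eq0.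
  have xV : V x := V_S hxS.
  apply: (prX (n := n) hV hQ) => //.
  have -> : x ^+ n = a * (a / x ^+ n)^-1 by field; rewrite a0 xn.
  apply: (idMr hQI) => //; apply/boundaryE; right.
  split; first by rewrite invr_eq0 mulf_neq0 ?invr_eq0.
  by exists i0 => i /h0; rewrite vV ?mulf_neq0 ?invr_eq0 //; lia.
exists i0 => i /h0 h1 vy vx.
have [hord _ _ _] := hv i; move=> /hord [_ ->] /hord [_ ->].
by move: h1; rewrite vxn //; lia.
Qed.

(** $y/x^n$ lies in $S[1/x]$ and has eventually nonnegative order, so it is in $S$ by
    [hull_evpos]. *)
Lemma grows_nz : grows -> nz.
Proof.
move=> [y [hy y0 h]]; exists y; split=> //; apply: div_P => n hn.
have [i0 hi0] := h n hn.
apply: hull_evpos.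
- by exists n; rewrite divfK //; exists 0%N.
- by rewrite mulf_neq0 ?invr_eq0.
- exists i0 => i hi; have [hord _ _ _] := hv i.
  have : n%:Z * v i x <= v i y by apply: (hi0 i hi); apply/hord.
  by rewrite vxn //; lia.
Qed.

Lemma nz_grows : nz -> grows.
Proof.
move=> [q [hq q0]]; have [a [b [ha hb b0 e]]] := hF 0 q.
have ea : a = q * b by rewrite e divfK.
have a0 : a != 0 by rewrite ea mulf_neq0.
exists a; split=> // n hn.
have [j hj] : S (a / x ^+ n).
  have -> : a / x ^+ n = (q / x ^+ n) * b by rewrite ea; ring.
  have : S b by exists 0%N.
  by have := P_div n hq => ? ?; mem.
exists j => i hi vy vx; have [hord _ _ _] := hv i; move=> /hord [_ ->] /hord [_ ->].
have := vR (R_mono hi hj); rewrite mulf_neq0 ?invr_eq0 // => /(_ isT).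
by rewrite vxn //; lia.
Qed.

Lemma nz_prime : nz -> is_prime S P /\ nz.
Proof.
move=> h; split=> //; split.
- split.
  + exact: PS.
  + by apply: div_P => n _; rewrite mul0r; mem.
  + move=> a b ha hb; apply: div_P => n _; rewrite mulrDl.
    by have := P_div n ha; have := P_div n hb => ? ?; mem.
  + by move=> a b ha hb; apply: div_P => n _; rewrite -mulrA; have := P_div n hb => ?; mem.
- by move=> /(P_div 1); rewrite expr1 mul1r; apply: N_no_inv.
move=> a b ha hb hab.
case: (eqVneq a 0) => [->|a0]; first by left; apply: div_P => n _; rewrite mul0r; mem.
case: (eqVneq b 0) => [->|b0]; first by right; apply: div_P => n _; rewrite mul0r; mem.
apply: NNPP => /not_or_and [na nb].
(* A failure of divisibility in [S] is detected by orders alone, through [hull_evpos]; then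
   [ab_contra] applies as for the boundary prime. *)
have nev c : S c -> c != 0 -> ~ P c -> exists n, ~ evpos (c / x ^+ n).
  move=> hc c0 nc; apply: NNPP => hno; apply: nc; apply: div_P => n _.
  apply: hull_evpos; [by exists n; rewrite divfK|by rewrite mulf_neq0 ?invr_eq0|].
  by apply: NNPP => hne; apply: hno; exists n.
have [n hn] := nev a ha a0 na; have [k hk] := nev b hb b0 nb.
apply: (ab_contra a0 b0 hn hk).
have /V_S /boundaryE [/eqP|[]//] := P_div (n + k).+1 hab.
by rewrite !mulf_eq0 invr_eq0 (negbTE a0) (negbTE b0) (negbTE (xn _)).
Qed.

End PrimaryElement.
End Sequence.

Theorem theorem6p9 (F : fieldType) (R m : nat -> F -> Prop) (x : F)
  (hfrac : frac_field (R 0%N))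
  (hreg : forall i, exists d : nat, (2 <= d)%N /\ regular_local (R i) (m i) d)
  (hqt : forall i, local_quadratic_transform (R i) (m i) (R i.+1))
  (hstrict : forall i, proper_subset (R i) (R i.+1))
  (hxS : union_seq R x)
  (hxprim : primary_to (union_seq R) (union_seq m) (principal (union_seq R) x))
  (hT : is_localization_of (R 0%N) (noetherian_hull (union_seq R))) :
  [<-> ~ archimedean (union_seq R);
       fractional_ideal (union_seq R) (noetherian_hull (union_seq R));
       set_eq (complete_int_closure (union_seq R)) (noetherian_hull (union_seq R));
       exists P : F -> Prop,
         [/\ is_prime (boundary_val_ring R m) P,
             (exists q, P q /\ q != 0),
             ~ set_eq P (nonunits (boundary_val_ring R m)) &
             ~ set_eq (fun q => P q /\ union_seq R q) (union_seq m)];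
       is_prime (union_seq R) (power_intersection (union_seq R) x) /\
         (exists q, power_intersection (union_seq R) x q /\ q != 0);
       exists y : F, [/\ R 0%N y, y != 0 &
         forall n : nat, (0 < n)%N -> exists i0 : nat, forall i : nat, (i0 <= i)%N ->
           forall vy vx : int, ordF (R i) (m i) y vy -> ordF (R i) (m i) x vx ->
             n%:Z * vx <= vy]].
Proof.
have hL i : is_local (R i) (m i) by have [d [_ []]] := hreg i.
have hN i : noetherian (R i) by have [d [_ []]] := hreg i.
have htw i : exists s, tower (R i) (m i) (@zeroI F) s.
  by have [d [_ h]] := hreg i; apply: regular_local_tower h.
have hRR i : subset_of (R i) (R i.+1).
  by have [z [[_ _ h _] _]] := transform_facts (hL i) (hL i.+1) (hqt i).
have hF i : frac_field (R i).
  elim: i => [|i IH] // q; have [a [b [ha hb b0 e]]] := IH q.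
  by exists a, b; split=> //; apply: hRR.
have hvex i : {v | order_valuation (R i) (m i) v}.
  apply: constructive_indefinite_description; have [s hs] := htw i.
  exact: (order_valuation_exists (@hN i) (hL i) (hF i) hs).
pose v i := sval (hvex i); have hv i : order_valuation (R i) (m i) (v i) := svalP (hvex i).
have hzex i := constructive_indefinite_description _ (transform_facts (hL i) (hL i.+1) (hqt i)).
pose z i := sval (hzex i).
have hz i : m i (z i) by rewrite /z; case: (hzex i) => /= t [[]].
have hmm i : subset_of (m i) (m i.+1) by case: (hzex i) => /= t [[]].
have hpow i e a : idpow (R i) (m i) e a -> R i.+1 (a / z i ^+ e).
  by rewrite /z; case: (hzex i) => /= t [_ [h _]]; apply: h.
have hrep i t : R i.+1 t -> exists e a b,
    [/\ idpow (R i) (m i) e a, idpow (R i) (m i) e b, ~ m i.+1 (b / z i ^+ e) & t * b = a].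
  by rewrite /z; case: (hzex i) => /= ? [_ [_ h]]; apply: h.
have hord i : [/\ z i != 0, v i (z i) = 1, (forall q, R i.+1 q -> q != 0 -> 0 <= v i q) &
      (forall q, R i.+1 q -> q != 0 -> 1 <= v i q -> R i.+1 (q / z i))].
  apply: (transform_order (hL i) (hL i.+1) (hv i)) => //; last exact: hrep.
    by rewrite /z; case: (hzex i) => /= t [[]].
  by move=> e a; apply: hpow.
have z0 i : z i != 0 by case: (hord i).
have vz i : v i (z i) = 1 by case: (hord i).
have hge i q : R i.+1 q -> q != 0 -> 0 <= v i q by case: (hord i) => _ _ h _; apply: h.
have hdiv i q : R i.+1 q -> q != 0 -> 1 <= v i q -> R i.+1 (q / z i).
  by case: (hord i) => _ _ _ h; apply: h.
have hcic i c t : R i c -> c != 0 -> (forall n, R i (c * t ^+ n)) -> R i t.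
  have [s hs] := htw i; exact: (regular_cic (@hN i) (hL i) (hF i) hs).
have hdrop i a (e : nat) : R i a -> a != 0 -> v i a = e%:Z -> v i.+1 (a / z i ^+ e) <= e%:Z.
  move=> ha a0 eva; have [_ _ _ vA] := hv i; have [_ _ _ vA1] := hv i.+1.
  rewrite leNgt; apply/negP => hlt.
  have ha_e : idpow (R i) (m i) e a by apply/vA; rewrite ?eva.
  have [s hs] := htw i; have hA := loc_sr (hL i).
  suff /vA : idpow (R i) (m i) e.+1 a by move=> /(_ ha a0); rewrite eva; lia.
  apply: (order_drop (@hN i) (hL i) hs (hL i.+1) (@hRR i) (@hmm i) _ (hz i) (z0 i) _ (@hrep i)) => //.
  - move=> b hb hb1; apply: NNPP => nb; have [w [hw ew]] := loc_unit (hL i) hb nb.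
    by apply: (loc_1 (hL i.+1)); rewrite -ew; apply: (idMr (loc_id (hL i.+1))) => //; apply: hRR.
  - move=> j; rewrite -[z i]expr1; apply: hpow; rewrite idpow1 //; last exact: loc_id.
    by apply: (tower_all_in hs).
  - by apply/vA1 => //; [exact: hpow|rewrite mulf_neq0 ?invr_eq0 ?expf_neq0].
(* The cycle of implications returns to a nonzero element of the intersection of the $x^nS$ after
   (3), (4) and (6); these three facts are shared. *)
have nz_arch := arch_nz hL hz z0 hRR hmm hxS hxprim.
have hull_nz := cic_nz hL hN hF hcic hz z0 hRR hmm hpow hrep hxS hxprim.
have growth_nz := grows_nz hL hv hz z0 vz hRR hpow hrep hge hdiv hxS hxprim.
tfae.
- by move/nz_arch; apply: (nz_fractional hL hN hF hcic hz z0 hRR hmm hpow hrep hxS hxprim).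
- exact: (fractional_cic hL hN hF hcic hz z0 hRR hmm hpow hrep hxS hxprim).
- by move/hull_nz; apply: (nz_boundary_prime hL hF hv hz z0 hRR hmm hpow hdrop hxS hxprim).
- move/(boundary_prime_grows hL hF hv hz z0 hRR hpow hdrop hxS hxprim)/growth_nz.
  exact: (nz_prime hL hF hv hz z0 vz hRR hmm hpow hrep hge hdiv hdrop hxS hxprim).
- by case=> _; apply: (nz_grows hL hF hv hz z0 hRR hxS hxprim).
- by move/growth_nz => h; apply/nz_arch.
Qed.
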